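(* Let $\mathcal Q$ be a generalized star quiver of rank $r$ with $n$ incoming paths, and let $D=\sum_{i=1}^na_i$ be a divisor on $\mathbf P^1$ with the $a_i$ pairwise distinct. Then the Kähler quiver variety $\mathfrak X_\alpha$ is naturally identified with a moduli space of parabolic structures on the trivial rank $r$ vector bundle $E\to\mathbf P^1$, and the hyperkähler quiver variety $\mathfrak M_\alpha$ is naturally identified with a moduli space of strictly parabolic Higgs bundles on $\mathbf P^1$ whose underlying bundle type is trivial.
   Context: A generalized star quiver is a quiver consisting of a single sink of dimension $r$ (the rank) with $n$ incoming paths, the dimensions of the vertices strictly increasing toward the sink. With $\mathrm{Rep}=\bigoplus_{i\to j}\mathrm{Hom}(\mathbf C^{d_i},\mathbf C^{d_j})$ and $G$ the product of the unitary groups of all vertices (acting through its quotient by the overall diagonal circle), $\mathfrak X_\alpha=\mathrm{Rep}/\!/_\alpha G$ is the Kähler quotient and $\mathfrak M_\alpha=T^*\mathrm{Rep}/\!/\!/_{(\alpha,0)}G$ the hyperkähler quotient (complex level $0$), where $\alpha$ is a central level whose components at non-sink vertices are such that reducing each path gives a flag variety $\mathcal F_i$ of $\mathbf C^r$ (respectively $T^*\mathcal F_i$), of the flag type given by the dimensions along the $i$-th path. Parabolic structure on a rank $r$ holomorphic bundle $E\to\mathbf P^1$ (with flag types fixed by the paths of $\mathcal Q$): a choice at each $a_i$ of a flag $E_{a_i}=E^0_{a_i}\supset E^1_{a_i}\supset\cdots\supset E^{l_i}_{a_i}\supset0$ of the given type. A parabolic Higgs field is a section $\phi\in H^0(\mathbf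 P^1,\mathrm{End}\,E\otimes\mathcal O(D)\otimes K)$ whose residues $\phi_i$ at $a_i$ satisfy $\phi_i(E^j_{a_i})\subseteq E^j_{a_i}$; it is strictly parabolic if $\phi_i(E^j_{a_i})\subseteq E^{j+1}_{a_i}$ for all $i$ and $j=0,\dots,l_i$ (with $E^{l_i+1}_{a_i}=0$). ''A moduli space'' means the GIT quotient, by the group $GL(r)$ of changes of trivialization of $E\cong\mathbf C^r\times\mathbf P^1$ and with respect to the stability condition determined by $\alpha$, of the set of such parabolic structures (respectively of such pairs of a parabolic structure and a strictly parabolic Higgs field) on the trivial bundle. *)

(* Defs.v *)
From HB Require Import structures.
From mathcomp Require Import all_boot all_order all_algebra.
From mathcomp Require Import complex.
From mathcomp Require Import all_classical all_reals.
From mathcomp Require Import topology normedtype derive.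

Set Implicit Arguments.
Unset Strict Implicit.
Unset Printing Implicit Defensive.

Import Order.TTheory GRing.Theory Num.Theory numFieldNormedType.Exports.

Local Open Scope classical_set_scope.
Local Open Scope ring_scope.
Local Open Scope sesquilinear_scope.

(* R[i], typed so that the norm and topology that MathComp-Analysis puts on
   any numClosedFieldType are found. *)
Definition Cplx (R : realType) : numClosedFieldType := R[i]%C.

Definition ofreal (R : realType) (t : R) : Cplx R := (t%:C)%C.

(** * Families of matrices as a normed space *)

(* (+)_(a : A) Hom(C^(n a), C^(m a)), in coordinates: the entries of all the
   matrices of the family are the entries of one row vector. *)
Notation mxfam C m n :=
  ('rV[C]_#|{: {a : _ & ('I_(m a) * 'I_(n a))%type}}|).

Section MatrixFamilies.
Variables (C : numClosedFieldType) (A : finType) (m n : A -> nat).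

Definition fam_mx (x : mxfam C m n) (a : A) : 'M[C]_(m a, n a) :=
  \matrix_(k, l)
    x 0 (enum_rank (existT (fun b => ('I_(m b) * 'I_(n b))%type) a (k, l))).

Definition mx_fam (X : forall a, 'M[C]_(m a, n a)) : mxfam C m n :=
  \row_k let p := enum_val k in X (tag p) (tagged p).1 (tagged p).2.

End MatrixFamilies.

(** * Quotient spaces with their topology and holomorphic functions *)

Section Quotients.
Variable C : numClosedFieldType.

(* The quotient of [pts] by [eqv].  A subset of the quotient is represented by
   its preimage, a saturated subset of [pts], and a function on it by an
   invariant function; [opn] and [hol] single out the open subsets and the
   holomorphic functions on them. *)
Record quotient_space := QuotientSpace {
  carrier : Type;
  pts : set carrier;
  eqv : carrier -> carrier -> Prop;
  opn : set carrier -> Prop;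
  hol : set carrier -> (carrier -> C) -> Prop }.

Definition eqv_on (X : quotient_space) : Prop :=
  [/\ forall x, @pts X x -> eqv x x,
      forall x y, @pts X x -> @pts X y -> eqv x y -> eqv y x &
      forall x y z, @pts X x -> @pts X y -> @pts X z ->
        eqv x y -> eqv y z -> eqv x z].

Definition saturated (X : quotient_space) (U : set (carrier X)) : Prop :=
  U `<=` @pts X /\
  forall x y, @pts X x -> @pts X y -> eqv x y -> U x -> U y.

Definition invariant_on (X : quotient_space) (U : set (carrier X))
    (f : carrier X -> C) : Prop :=
  forall x y, U x -> U y -> eqv x y -> f x = f y.

(* [Phi] descends to a bijection of the quotients which is a homeomorphism and
   identifies the holomorphic functions on corresponding open subsets. *)
Definition identifies (X Y : quotient_space) (Phi : carrier X -> carrier Y) :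
    Prop :=
  let pull U := @pts X `&` Phi @^-1` U in
  [/\ eqv_on X /\ eqv_on Y,
      forall x, @pts X x -> @pts Y (Phi x),
      forall x x', @pts X x -> @pts X x' ->
        (eqv x x' <-> eqv (Phi x) (Phi x')),
      forall y, @pts Y y -> exists2 x, @pts X x & eqv (Phi x) y &
      forall U, saturated U ->
        (opn U <-> opn (pull U)) /\
        (opn U -> forall f, invariant_on U f ->
          (hol U f <-> hol (pull U) (f \o Phi)))].

(* Holomorphic functions on a locally analytic subset (with its reduced
   structure): locally, restrictions of holomorphic functions. *)
Definition holo_on (V : normedModType C) (Z : set V) (F : V -> C) : Prop :=
  forall p, Z p -> exists G : V -> C,
    (\forall q \near p, differentiable G q) /\
    (\forall q \near p, Z q -> F q = G q).

(* The quotient L/K of a moment map level L by the compact group K, where L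
   lies in the analytic subset Z, stable under the complexification KC (K and
   KC are given by their orbit relations).  A function on an open subset U/K
   is holomorphic when it comes from a KC-invariant holomorphic function on a
   KC-stable open subset of Z meeting L in U. *)
Definition level_quotient (V : normedModType C) (Z L : set V)
    (K KC : V -> V -> Prop) : quotient_space :=
  {| carrier := V;
     pts := L;
     eqv := K;
     opn := fun U => exists2 O : set V, open O & U = L `&` O;
     hol := fun U f => exists (W : set V) (F : V -> C),
       [/\ exists2 O : set V, open O & W = Z `&` O,
           forall x y, W x -> KC x y -> W y /\ F y = F x,
           W `&` L = U,
           holo_on W F &
           forall x, U x -> F x = f x] |}.

Section GITQuotient.
(* [M] is a set of geometric objects, of which [valid] are the ones under
   consideration; [valid] receives its topology and complex structure from the
   parameters [v : V], where [pres v m] says that [v] presents [m].  The group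
   acts on [M] with orbit relation [orb], and [ss] is the semistable locus. *)
Variables (V : normedModType C) (M : Type) (pres : V -> M -> Prop).
Variables (valid ss : set M) (orb : M -> M -> Prop).

Definition presented (U : set M) : set V := [set v | exists2 m, U m & pres v m].

Definition rel_open (S U : set M) : Prop :=
  U `<=` S /\ exists2 O : set V, open O & presented U = presented S `&` O.

Definition orbit_closure (x : M) : set M :=
  [set z | valid z /\
     forall U, rel_open valid U -> U z -> exists2 y, U y & orb x y].

(* Points of the GIT quotient: semistable points, two of them being identified
   when the closures of their orbits meet in the semistable locus. *)
Definition git_quotient : quotient_space :=
  {| carrier := M;
     pts := ss;
     eqv := fun x y =>
       exists z, [/\ ss z, orbit_closure x z & orbit_closure y z];
     opn := rel_open ss;
     hol := fun U f => exists F : V -> C,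
       (forall v m, U m -> pres v m -> F v = f m) /\ holo_on (presented U) F |}.

End GITQuotient.
End Quotients.

(** * Quiver varieties *)

Record quiver := Quiver {
  vert : finType;
  arr : finType;
  src : arr -> vert;
  tgt : arr -> vert }.

Section QuiverVarieties.
Variables (R : realType) (Q : quiver) (d : vert Q -> nat).
Let C := Cplx R.

Notation Rep := (mxfam C (fun a => d (tgt a)) (fun a => d (src a))).
(* The fibre of T^*Rep over each point, by the pairing sum_a tr(y_a x_a); this
   is the representation space of the opposite quiver. *)
Notation Rep' := (mxfam C (fun a => d (src a)) (fun a => d (tgt a))).

Definition gauge := forall v : vert Q, 'M[C]_(d v).

Definition act (g : gauge) (x : Rep) : Rep :=
  mx_fam (fun a => g (tgt a) *m fam_mx x a *m invmx (g (src a))).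

Definition act' (g : gauge) (y : Rep') : Rep' :=
  mx_fam (fun a => g (src a) *m fam_mx y a *m invmx (g (tgt a))).

(* The diagonal circle (resp. C^* ) acts trivially, so these are also the orbit
   relations of the quotient group. *)
Definition orbU (x x' : Rep) : Prop :=
  exists g : gauge, (forall v, g v \is unitarymx) /\ x' = act g x.
Definition orbGL (x x' : Rep) : Prop :=
  exists g : gauge, (forall v, g v \in unitmx) /\ x' = act g x.
Definition orbU_cot (p p' : Rep * Rep') : Prop :=
  exists g : gauge,
    (forall v, g v \is unitarymx) /\ p' = (act g p.1, act' g p.2).
Definition orbGL_cot (p p' : Rep * Rep') : Prop :=
  exists g : gauge,
    (forall v, g v \in unitmx) /\ p' = (act g p.1, act' g p.2).

(* [conform_mx 0] only transports along [tgt a = v] (or [src a = v]).  The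
   moment maps are written with values in Hermitian matrices, the Lie algebra
   of U(d v) up to a factor [i]. *)
Definition moment (x : Rep) (v : vert Q) : 'M[C]_(d v) :=
  \sum_(a | tgt a == v) conform_mx 0 (fam_mx x a *m (fam_mx x a)^t*)
  - \sum_(a | src a == v) conform_mx 0 ((fam_mx x a)^t* *m fam_mx x a).

Definition moment_real (p : Rep * Rep') (v : vert Q) : 'M[C]_(d v) :=
  \sum_(a | tgt a == v)
    conform_mx 0 (fam_mx p.1 a *m (fam_mx p.1 a)^t*
                  - (fam_mx p.2 a)^t* *m fam_mx p.2 a)
  + \sum_(a | src a == v)
    conform_mx 0 (fam_mx p.2 a *m (fam_mx p.2 a)^t*
                  - (fam_mx p.1 a)^t* *m fam_mx p.1 a).

Definition moment_cplx (p : Rep * Rep') (v : vert Q) : 'M[C]_(d v) :=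
  \sum_(a | tgt a == v) conform_mx 0 (fam_mx p.1 a *m fam_mx p.2 a)
  - \sum_(a | src a == v) conform_mx 0 (fam_mx p.2 a *m fam_mx p.1 a).

Definition kahler_quotient (alpha : vert Q -> R) : quotient_space C :=
  @level_quotient C Rep setT
    [set x | forall v, moment x v = (ofreal (alpha v))%:M]
    orbU orbGL.

(* In the complex structure for which T^*Rep is a complex vector space. *)
Definition hyperkahler_quotient (alpha : vert Q -> R) : quotient_space C :=
  @level_quotient C (Rep * Rep')%type
    [set p | forall v, moment_cplx p v = 0]
    [set p | (forall v, moment_real p v = (ofreal (alpha v))%:M) /\
             (forall v, moment_cplx p v = 0)]
    orbU_cot orbGL_cot.

End QuiverVarieties.

(** * Generalized star quivers *)

(* [dimp Q i j] is the dimension of the vertex at distance [j] from the sink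
   on the [i]-th path, for [j <= len Q i]; the other values are irrelevant. *)
Record star_quiver (n r : nat) := StarQuiver {
  len : 'I_n -> nat;
  dimp : 'I_n -> nat -> nat;
  rank_gt0 : (0 < r)%N;
  len_gt0 : forall i, (0 < len i)%N;
  dimp_sink : forall i, dimp i 0 = r;
  dimp_decr : forall i j, (j < len i)%N -> (dimp i j.+1 < dimp i j)%N;
  dimp_gt0 : forall i, (0 < dimp i (len i))%N }.

Section Star.
Variables (n r : nat) (Q : star_quiver n r).

(* The pair (i, j) is the vertex at distance j.+1 from the sink on the i-th
   path, and also the arrow leaving that vertex. *)
Definition star_arr : finType := {: {i : 'I_n & 'I_(len Q i)}}.
Definition star_vert : finType := {: option star_arr}.

Definition star_vtx (i : 'I_n) (j : nat) (lt : (j < len Q i)%N) : star_arr :=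
  existT (fun i => 'I_(len Q i)) i (Ordinal lt).

Definition star_tgt (a : star_arr) : star_vert :=
  let: existT i (Ordinal j lt) := a in
  match j return (j < len Q i)%N -> star_vert with
  | 0%N => fun=> None
  | j'.+1 => fun lt => Some (star_vtx (ltnW lt))
  end lt.

Definition star : quiver := @Quiver star_vert star_arr Some star_tgt.

Definition star_dim (v : vert star) : nat :=
  match v : star_vert with
  | None => r
  | Some a => dimp Q (tag a) (tagged a).+1
  end.

End Star.

Section StarVarieties.
Variables (R : realType) (n r : nat) (Q : star_quiver n r).
Let C := Cplx R.

Notation Rep := (mxfam C (fun a : arr (star Q) => star_dim (tgt a))
                         (fun a : arr (star Q) => star_dim (src a))).
Notation Rep' := (mxfam C (fun a : arr (star Q) => star_dim (src a))
                          (fun a : arr (star Q) => star_dim (tgt a))).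

(* The trace condition says that [alpha] vanishes on the diagonal circle.  On
   a path, the moment map equation at the vertex between x' and x (ordered
   towards the sink) reads x^* x = x' x'^* - alpha: with negative components
   all the maps are injective and the flag of their images in C^r has the type
   given by the dimensions, while for other values the path either has empty
   level set or carries non-injective maps. *)
Definition flag_level (alpha : vert (star Q) -> R) : Prop :=
  \sum_v (star_dim v)%:R * alpha v = 0 /\
  forall a : star_arr Q, alpha (Some a) < 0.

(* The composite C^(dimp i j.+1) -> C^r along the i-th path. *)
Fixpoint to_sink (x : Rep) (i : 'I_n) (j : nat) :
    forall lt : (j < len Q i)%N,
    'M[C]_(r, star_dim (src (star_vtx lt : arr (star Q)))) :=
  match j with
  | 0%N => fun lt => fam_mx x (star_vtx lt : arr (star Q))
  | j'.+1 => fun lt =>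
      to_sink x (ltnW lt) *m fam_mx x (star_vtx lt : arr (star Q))
  end.

(** ** Parabolic structures on the trivial bundle *)

(* [F i j] is E^j_(a_i), inside the fibre C^r at a_i. *)
Definition flags := 'I_n -> nat -> {vspace 'cV[C]_r}.

Definition is_parabolic (F : flags) : Prop :=
  forall i,
  [/\ F i 0%N = fullv,
      forall j, (j <= len Q i)%N -> (F i j.+1 <= F i j)%VS,
      forall j, (j <= len Q i)%N -> \dim (F i j) = dimp Q i j &
      forall j, (len Q i < j)%N -> F i j = 0%VS].

Definition mximg (g : 'M[C]_r) (S : {vspace 'cV[C]_r}) : {vspace 'cV[C]_r} :=
  (linfun (mulmx g) @: S)%VS.

Definition colspan (k : nat) (g : 'M[C]_(r, k)) : {vspace 'cV[C]_r} :=
  <<[seq col l g | l <- enum 'I_k]>>%VS.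

(* Parabolic weights: increasing along each flag, with jump -alpha_(i,j). *)
Definition par_weight (alpha : vert (star Q) -> R) (i : 'I_n) (j : nat) : R :=
  \sum_(k < len Q i | (k < j)%N) - alpha (Some (star_vtx (ltn_ord k))).

(* Parabolic degree of the constant subbundle S; its ordinary degree is 0. *)
Definition pardeg (alpha : vert (star Q) -> R) (F : flags)
    (S : {vspace 'cV[C]_r}) : R :=
  \sum_i \sum_(j < (len Q i).+1) par_weight alpha i j *
    ((\dim (S :&: F i j))%:R - (\dim (S :&: F i j.+1))%:R).

(* pardeg S / dim S <= pardeg E / rank E. *)
Definition slope_le (alpha : vert (star Q) -> R) (F : flags)
    (S : {vspace 'cV[C]_r}) : Prop :=
  r%:R * pardeg alpha F S <= (\dim S)%:R * pardeg alpha F fullv.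

Definition par_semistable (alpha : vert (star Q) -> R) (F : flags) : Prop :=
  is_parabolic F /\ forall S, slope_le alpha F S.

Definition flags_act (h : 'M[C]_r) (F : flags) : flags :=
  fun i j => mximg h (F i j).

Definition par_orbit (F F' : flags) : Prop :=
  exists2 h : 'M[C]_r, h \in unitmx & F' = flags_act h F.

(* The flag varieties get their structure from GL(r) -> GL(r)/P: a frame
   presents the flag of the spans of its first columns. *)
Notation mxtuple := (mxfam C (fun _ : 'I_n => r) (fun _ : 'I_n => r)).

Definition frame_flags (g : mxtuple) : flags := fun i j =>
  if (j <= len Q i)%N then
    <<[seq col k (fam_mx g i) | k : 'I_r <- enum 'I_r & (k < dimp Q i j)%N]>>%VS
  else 0%VS.

Definition presents_flags (g : mxtuple) (F : flags) : Prop :=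
  (forall i, fam_mx g i \in unitmx) /\ F = frame_flags g.

Definition parabolic_moduli (alpha : vert (star Q) -> R) : quotient_space C :=
  @git_quotient C mxtuple flags presents_flags
    is_parabolic (par_semistable alpha) par_orbit.

Definition parabolic_of_rep (x : Rep) : flags := fun i j =>
  match j with
  | 0%N => fullv
  | j'.+1 => if (insub j' : option 'I_(len Q i)) is Some k
             then colspan (to_sink x (ltn_ord k)) else 0%VS
  end.

(** ** Higgs fields on P^1 *)

(* The projective line, with [None] the point at infinity. *)
Definition P1 := option C.

(* Coordinates z and w = 1/z of a point of P^1, [None] outside the chart. *)
Definition coord_z (p : P1) : option C := p.
Definition coord_w (p : P1) : option C :=
  match p with
  | None => Some 0
  | Some z => if z == 0 then None else Some z^-1
  end.

(* The product of the t - b over the marked points selected by [P] that lie in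
   the chart, b being their coordinates. *)
Definition chart_prod (c : 'I_n -> option C) (P : pred 'I_n) (t : C) : C :=
  \prod_(i | P i) (if c i is Some b then t - b else 1).

(* A section of End E (x) O(D) (x) K is given by its coefficients (s.1, s.2) in
   the local frames dz / prod (z - a_i) and dw / prod (w - 1/a_i). *)
Definition field := ((C -> 'M[C]_r) * (C -> 'M[C]_r))%type.

(* The gluing condition uses dw = - z^-2 dz. *)
Definition is_field (a : 'I_n -> P1) (s : field) : Prop :=
  [/\ forall z : C, derivable s.1 z 1,
      forall w : C, derivable s.2 w 1 &
      forall z : C, z != 0 -> (forall i, a i <> Some z) ->
        (chart_prod (coord_z \o a) predT z)^-1 *: s.1 z =
        (- z ^- 2 * (chart_prod (coord_w \o a) predT z^-1)^-1) *: s.2 z^-1].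

(* Residue at a_i, in a chart containing a_i. *)
Definition chart_residue (c : 'I_n -> option C) (s : C -> 'M[C]_r)
    (i : 'I_n) : 'M[C]_r :=
  if c i is Some b then (chart_prod c (predC1 i) b)^-1 *: s b else 0.

Definition residue (a : 'I_n -> P1) (s : field) (i : 'I_n) : 'M[C]_r :=
  if a i is Some _ then chart_residue (coord_z \o a) s.1 i
  else chart_residue (coord_w \o a) s.2 i.

(* The form sum_i A_i dz / (z - a_i) (a_i finite) in the frames above; when
   sum_i A_i = 0 its expression in w is sum_i A_i dw / (w - 1/a_i) (a_i != 0),
   also if infinity is one of the a_i. *)
Definition chart_field (c : 'I_n -> option C) (A : 'I_n -> 'M[C]_r) (t : C) :
    'M[C]_r :=
  \sum_i (if c i is Some _ then chart_prod c (predC1 i) t *: A i else 0).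

Definition field_of_residues (a : 'I_n -> P1) (A : 'I_n -> 'M[C]_r) : field :=
  (chart_field (coord_z \o a) A, chart_field (coord_w \o a) A).

Definition strictly_parabolic (a : 'I_n -> P1) (F : flags) (s : field) :
    Prop :=
  forall i j, (j <= len Q i)%N ->
    (mximg (residue a s i) (F i j) <= F i j.+1)%VS.

Definition is_higgs (a : 'I_n -> P1) (p : flags * field) : Prop :=
  [/\ is_parabolic p.1, is_field a p.2 & strictly_parabolic a p.1 p.2].

Definition field_preserves (s : field) (S : {vspace 'cV[C]_r}) : Prop :=
  forall t : C, (mximg (s.1 t) S <= S)%VS /\ (mximg (s.2 t) S <= S)%VS.

Definition higgs_semistable (alpha : vert (star Q) -> R) (a : 'I_n -> P1)
    (p : flags * field) : Prop :=
  is_higgs a p /\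
  forall S, field_preserves p.2 S -> slope_le alpha p.1 S.

Definition field_act (h : 'M[C]_r) (s : field) : field :=
  (fun z => h *m s.1 z *m invmx h, fun w => h *m s.2 w *m invmx h).

Definition higgs_orbit (p p' : flags * field) : Prop :=
  exists2 h : 'M[C]_r, h \in unitmx &
    p' = (flags_act h p.1, field_act h p.2).

(* The space of sections is finite dimensional, and the residues are linear
   coordinates on it (they embed it in 'M_r^n). *)
Definition presents_higgs (a : 'I_n -> P1) (v : mxtuple * mxtuple)
    (p : flags * field) : Prop :=
  presents_flags v.1 p.1 /\ forall i, fam_mx v.2 i = residue a p.2 i.

Definition higgs_moduli (alpha : vert (star Q) -> R) (a : 'I_n -> P1) :
    quotient_space C :=
  @git_quotient C (mxtuple * mxtuple)%type (flags * field)%type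
    (presents_higgs a) (is_higgs a) (higgs_semistable alpha a) higgs_orbit.

(* x_i y_i, for x_i the last arrow of the i-th path and y_i its dual. *)
Definition sink_residue (p : Rep * Rep') (i : 'I_n) : 'M[C]_r :=
  let a : arr (star Q) := star_vtx (len_gt0 Q i) in
  fam_mx p.1 a *m fam_mx p.2 a.

Definition higgs_of_rep (a : 'I_n -> P1) (p : Rep * Rep') : flags * field :=
  (parabolic_of_rep p.1, field_of_residues a (sink_residue p)).

End StarVarieties.

(* Main.v *)
Require Import Defs.
From HB Require Import structures.
From mathcomp Require Import all_boot all_order all_algebra.
From mathcomp Require Import complex.
From mathcomp Require Import all_classical all_reals.
From mathcomp Require Import all_analysis.
From mathcomp Require Import ring lra.

Set Implicit Arguments.
Unset Strict Implicit.
Unset Printing Implicit Defensive.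

Import Order.TTheory GRing.Theory Num.Theory numFieldNormedType.Exports.

Local Open Scope classical_set_scope.
Local Open Scope ring_scope.
Local Open Scope sesquilinear_scope.

Section AdjointAlgebra.
Variable C : numClosedFieldType.

Lemma adj_mul m n p (A : 'M[C]_(m, n)) (B : 'M[C]_(n, p)) :
  (A *m B)^t* = B^t* *m A^t*.
Proof. by rewrite trmx_mul map_mxM. Qed.

Lemma unitary_adjK n (u : 'M[C]_n) : u \is unitarymx -> u^t* *m u = 1%:M.
Proof. by move=> /unitarymxP h; apply: mulmx1C. Qed.

Lemma trace_conj_left m n (u xi : 'M[C]_m) (w : 'M[C]_n) (x : 'M[C]_(m, n)) :
  w \is unitarymx ->
  \tr (xi *m (u *m x *m w^t* *m (u *m x *m w^t*)^t*)) =
  \tr (u^t* *m xi *m u *m (x *m x^t*)).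
Proof.
move=> /unitary_adjK K; rewrite !adj_mul trmxCK.
rewrite -!mulmxA (mulmxA (w^t*)) K mul1mx.
by rewrite !mulmxA mxtrace_mulC !mulmxA.
Qed.

Lemma trace_conj_right m n (xi w : 'M[C]_n) (u : 'M[C]_m) (x : 'M[C]_(m, n)) :
  u \is unitarymx ->
  \tr (xi *m ((u *m x *m w^t*)^t* *m (u *m x *m w^t*))) =
  \tr (w^t* *m xi *m w *m (x^t* *m x)).
Proof.
move=> /unitary_adjK K; rewrite !adj_mul trmxCK.
rewrite -!mulmxA (mulmxA (u^t*)) K mul1mx.
by rewrite !mulmxA mxtrace_mulC !mulmxA.
Qed.

Lemma trace_unitary_conj n (u xi : 'M[C]_n) : u \is unitarymx ->
  \tr (u^t* *m xi *m u) = \tr xi.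
Proof. by move=> /unitarymxP K; rewrite mxtrace_mulC mulmxA K mul1mx. Qed.

Lemma uact_mxK m n (u : 'M[C]_m) (w : 'M[C]_n) x :
  u \is unitarymx -> w \is unitarymx ->
  u *m (u^t* *m x *m (w^t*)^t*) *m w^t* = x.
Proof.
move=> /unitarymxP K /unitarymxP K'.
by rewrite trmxCK !mulmxA K mul1mx -mulmxA K' mulmx1.
Qed.

Lemma uact_mxKV m n (u : 'M[C]_m) (w : 'M[C]_n) x :
  u \is unitarymx -> w \is unitarymx ->
  u^t* *m (u *m x *m w^t*) *m (w^t*)^t* = x.
Proof.
move=> /unitary_adjK K /unitary_adjK K'.
by rewrite trmxCK !mulmxA K mul1mx -mulmxA K' mulmx1.
Qed.

Lemma uact_mxM m n (u u' : 'M[C]_m) (w w' : 'M[C]_n) x :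
  u *m (u' *m x *m w'^t*) *m w^t* = (u *m u') *m x *m (w *m w')^t*.
Proof. by rewrite adj_mul !mulmxA. Qed.

Lemma trace_linear n (a b : C) (A B : 'M[C]_n) :
  \tr (a *: A + b *: B) = a * \tr A + b * \tr B.
Proof. by rewrite linearD !linearZ. Qed.

End AdjointAlgebra.

Section GenLim.
Variable K : numFieldType.
Context {T : Type} {F : set_system T} {FF : Filter F}.
Lemma cvg_sumK (I : Type) (r : seq I) (P : pred I) (f : I -> T -> K) (l : I -> K) :
  (forall i, P i -> f i @ F --> l i) ->
  (fun t => \sum_(i <- r | P i) f i t) @ F --> \sum_(i <- r | P i) l i.
Proof.
move=> h; elim: r => [|i r IH].
  under eq_fun do rewrite big_nil; rewrite big_nil; exact: cvg_cst.
under eq_fun do rewrite big_cons; rewrite big_cons.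
case: ifP => // Pi.
exact: (cvgD (h i Pi) IH).
Qed.
Lemma cvg_mulK (f g : T -> K) (a b : K) : f @ F --> a -> g @ F --> b ->
  (fun t => f t * g t) @ F --> a * b.
Proof. exact: cvgM. Qed.
Lemma cvg_addK (f g : T -> K) (a b : K) : f @ F --> a -> g @ F --> b ->
  (fun t => f t + g t) @ F --> a + b.
Proof. exact: cvgD. Qed.
End GenLim.

Section ComplexBasics.
Variable R : realType.
Local Notation C := (Cplx R).

Definition re (z : C) : R := complex.Re z.
Definition im (z : C) : R := complex.Im z.

Lemma re_is_zmod : zmod_morphism re. Proof. by case=> a b [c e]. Qed.
HB.instance Definition _ := GRing.isZmodMorphism.Build C R re re_is_zmod.
Lemma im_is_zmod : zmod_morphism im. Proof. by case=> a b [c e]. Qed.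
HB.instance Definition _ := GRing.isZmodMorphism.Build C R im im_is_zmod.

Lemma ofreal_is_zmod : zmod_morphism (@ofreal R).
Proof. by move=> x y; rewrite /ofreal rmorphB. Qed.
HB.instance Definition _ := GRing.isZmodMorphism.Build R C (@ofreal R) ofreal_is_zmod.
Lemma ofreal_is_monoid : monoid_morphism (@ofreal R).
Proof. by split=> [|x y]; rewrite /ofreal ?rmorph1 ?rmorphM. Qed.
HB.instance Definition _ := GRing.isMonoidMorphism.Build R C (@ofreal R) ofreal_is_monoid.

Lemma reK (t : R) : re (ofreal t : C) = t. Proof. by []. Qed.
Lemma im_ofreal (t : R) : im (ofreal t) = 0. Proof. by []. Qed.
Lemma ofrealI : injective (@ofreal R). Proof. by move=> x y []. Qed.
Lemma ler_of (x y : R) : (ofreal x <= ofreal y) = (x <= y). Proof. exact: lecR. Qed.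
Lemma ltr_of (x y : R) : (ofreal x < ofreal y) = (x < y). Proof. exact: ltcR. Qed.
Lemma reZ (t : R) z : re (ofreal t * z) = t * re z.
Proof. by case: z => a b; rewrite /re /= mul0r subr0. Qed.
Lemma imZ (t : R) z : im (ofreal t * z) = t * im z.
Proof. by case: z => a b; rewrite /im /= mul0r addr0. Qed.

Definition nsq (z : C) : R := re z ^+ 2 + im z ^+ 2.

Lemma nsq_ge0 z : 0 <= nsq z. Proof. by rewrite addr_ge0 ?sqr_ge0. Qed.
Lemma nsqE z : ofreal (nsq z) = `|z| ^+ 2.
Proof. exact: add_Re2_Im2. Qed.
Lemma nsq_conj z : ofreal (nsq z) = z * z^*.
Proof. by rewrite nsqE normCK. Qed.
Lemma nsqM z w : nsq (z * w) = nsq z * nsq w.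
Proof. by apply: ofrealI; rewrite rmorphM /= !nsqE normrM exprMn. Qed.
Lemma nsq_of (t : R) : nsq (ofreal t : C) = t ^+ 2.
Proof. by rewrite /nsq reK im_ofreal expr0n addr0. Qed.
Lemma nsq_eq0 z : (nsq z == 0) = (z == 0).
Proof.
by rewrite -(inj_eq ofrealI) nsqE rmorph0 expf_eq0 normr_eq0.
Qed.
Lemma nsq0 : nsq 0 = 0. Proof. by apply/eqP; rewrite nsq_eq0. Qed.
Lemma nsq_gt0 z : (0 < nsq z) = (z != 0).
Proof. by rewrite lt0r nsq_eq0 nsq_ge0 andbT. Qed.
Lemma nsqN z : nsq (- z) = nsq z.
Proof. by apply: ofrealI; rewrite !nsqE normrN. Qed.

Lemma ofreal_ge0P (e : C) : 0 <= e -> e = ofreal (re e).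
Proof. by move=> /ger0_Im; case: e => a b /= ->. Qed.

Lemma norm_of (t : R) : `|ofreal t| = ofreal `|t|.
Proof. by rewrite [LHS]normc_def expr0n addr0 sqrtr_sqr. Qed.

Lemma normE z : `|z| = ofreal (Num.sqrt (nsq z)).
Proof. exact: normc_def. Qed.

Lemma le_nsq z (M : R) : 0 <= M -> (nsq z <= M ^+ 2) = (`|z| <= ofreal M).
Proof.
move=> M0; rewrite normE ler_of -[RHS](@ler_pXn2r _ 2) ?nnegrE ?sqrtr_ge0//.
by rewrite sqr_sqrtr ?nsq_ge0.
Qed.

Lemma re_le z : `|re z| <= Num.sqrt (nsq z).
Proof. by rewrite -sqrtr_sqr ler_wsqrtr// lerDl sqr_ge0. Qed.
Lemma im_le z : `|im z| <= Num.sqrt (nsq z).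
Proof. by rewrite -sqrtr_sqr ler_wsqrtr// lerDr sqr_ge0. Qed.
Lemma norm_le z : `|z| <= ofreal (`|re z| + `|im z|).
Proof.
rewrite normE ler_of -(ger0_norm (addr_ge0 (normr_ge0 (re z)) (normr_ge0 (im z)))).
rewrite -sqrtr_sqr ler_wsqrtr// /nsq sqrrD !real_normK ?num_real//.
by rewrite lerD2r lerDl mulrn_wge0// mulr_ge0.
Qed.

Section Limits.
Context {T : Type} {F : set_system T} {FF : Filter F}.

Lemma cvgC_re (f : T -> C) (l : C) : f @ F --> l ->
  (fun t => re (f t)) @ F --> re l.
Proof.
move=> /cvgrPdist_lt fl; apply/cvgrPdist_lt => e e0.
have e0' : 0 < ofreal e by rewrite ltr_of.
apply: filterS (fl _ e0') => t /=; rewrite normE ltr_of => h.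
by rewrite -raddfB (le_lt_trans (re_le _)).
Qed.
Lemma cvgC_im (f : T -> C) (l : C) : f @ F --> l ->
  (fun t => im (f t)) @ F --> im l.
Proof.
move=> /cvgrPdist_lt fl; apply/cvgrPdist_lt => e e0.
have e0' : 0 < ofreal e by rewrite ltr_of.
apply: filterS (fl _ e0') => t /=; rewrite normE ltr_of => h.
by rewrite -raddfB (le_lt_trans (im_le _)).
Qed.
Lemma cvgC_reim (f : T -> C) (l : C) :
  (fun t => re (f t)) @ F --> re l -> (fun t => im (f t)) @ F --> im l ->
  f @ F --> l.
Proof.
move=> /cvgrPdist_lt fr /cvgrPdist_lt fi; apply/cvgrPdist_lt => e e0.
have [e' ee] : exists e', e = ofreal e' by exists (re e); exact/ofreal_ge0P/ltW.
have e0' : 0 < e' / 2 by rewrite divr_gt0// -ltr_of -ee.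
apply: filterS2 (fr _ e0') (fi _ e0') => t /= h1 h2.
rewrite (le_lt_trans (norm_le _))// ee ltr_of !raddfB /=.
by rewrite (splitr e') ltrD.
Qed.
Lemma cvg_ofreal (f : T -> R) (l : R) : f @ F --> l ->
  (fun t => ofreal (f t)) @ F --> ofreal l.
Proof.
move=> fl; apply: cvgC_reim => //.
by rewrite im_ofreal; exact: cvg_cst.
Qed.
Lemma cvg_nsq (f : T -> C) (l : C) : f @ F --> l ->
  (fun t => nsq (f t)) @ F --> nsq l.
Proof.
move=> fl; rewrite /nsq; under eq_fun do rewrite !expr2.
by rewrite /nsq !expr2; apply: cvgD; apply: cvgM;
  (exact: cvgC_re || exact: cvgC_im).
Qed.
Lemma cvg_conj (f : T -> C) (l : C) : f @ F --> l ->
  (fun t => (f t)^*) @ F --> l^*.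
Proof.
move=> /cvgrPdist_lt fl; apply/cvgrPdist_lt => e e0.
by apply: filterS (fl _ e0) => t /=; rewrite -raddfB norm_conjC.
Qed.

Lemma cvg_cstR (a : R) : (fun _ : T => a) @ F --> a.
Proof. exact: cvg_cst. Qed.

Lemma cvg_sumR (I : Type) (r : seq I) (P : pred I) (f : I -> T -> R) (l : I -> R) :
  (forall i, P i -> f i @ F --> l i) ->
  (fun t => \sum_(i <- r | P i) f i t) @ F --> \sum_(i <- r | P i) l i.
Proof.
move=> h; elim: r => [|i r IH].
  under eq_fun do rewrite big_nil; rewrite big_nil; exact: cvg_cst.
under eq_fun do rewrite big_cons; rewrite big_cons.
case: ifP => // Pi.
exact: (cvgD (h i Pi) IH).
Qed.
End Limits.

Section Ultra.
Context {T : Type} {F : set_system T} {UF : UltraFilter F}.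

Lemma ultra_bounded_real (f : T -> R) (M : R) :
  F [set t | `|f t| <= M] -> exists l : R, f @ F --> l.
Proof.
move=> FM.
have UF' : UltraFilter (fmap f F).
  split; first exact: fmap_proper_filter.
  move=> G PG fG; apply/seteqP; split=> // A GA.
  have [//|] := in_ultra_setVsetC (f @^-1` A) UF.
  move=> FnA; have GnA : G (~` A) by apply: fG; rewrite /= /fmap /mkset preimage_setC.
  by have [x []] := @filter_ex _ _ PG _ (filterI GA GnA).
have := @segment_compact R (- M) M; rewrite compact_ultra.
move=> /(_ _ UF') [|l [_ fl]]; last by exists l.
apply: filterS FM => t h; rewrite /preimage /mkset /= in_itv /= -ler_norml; exact: h.
Qed.

Lemma ultra_bounded (f : T -> C) (M : R) :
  F [set t | nsq (f t) <= M] -> exists l : C, f @ F --> l.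
Proof.
move=> FM.
have b (g : C -> R) : (forall z, `|g z| <= Num.sqrt (nsq z)) ->
    exists l : R, (g \o f) @ F --> l.
  move=> hg; apply: (ultra_bounded_real (M := Num.sqrt M)).
  by apply: filterS FM => t /= h; rewrite (le_trans (hg _))// ler_wsqrtr.
have [a fa] := b _ re_le; have [c fc] := b _ im_le.
by exists (a +i* c)%C; apply: cvgC_reim.
Qed.
End Ultra.

Lemma cvg_uniqueC T (F : set_system T) {PF : ProperFilter F} (f : T -> C) (l l' : C) :
  f @ F --> l -> f @ F --> l' -> l = l'.
Proof. by move=> h h'; apply: (cvg_unique _ h h'). Qed.

Lemma nsqB z w : nsq (z - w) = nsq z + nsq w - 2 * re (z * w^*).
Proof.
suff -> : re (z * w^*) = re z * re w + im z * im w by rewrite /nsq !raddfB /=; ring.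
by case: z w => a b [c e]; rewrite /re /im /= mulrN opprK.
Qed.

Definition mkc (a b : R) : C := (a +i* b)%C.
Lemma re_mkc a b : re (mkc a b) = a. Proof. by []. Qed.
Lemma im_mkc a b : im (mkc a b) = b. Proof. by []. Qed.
Lemma mkc_eta z : z = mkc (re z) (im z). Proof. by case: z. Qed.
Lemma ceq z w : re z = re w -> im z = im w -> z = w.
Proof. by case: z w => a b [c e]; rewrite /re /im /= => -> ->. Qed.
Lemma reM z w : re (z * w) = re z * re w - im z * im w.
Proof. by case: z w => a b [c e]. Qed.
Lemma imM z w : im (z * w) = re z * im w + im z * re w.
Proof. by case: z w => a b [c e]. Qed.

Lemma re_inv z : re z^-1 = re z / nsq z. Proof. by case: z. Qed.
Lemma im_inv z : im z^-1 = - im z / nsq z. Proof. by case: z => a b; rewrite mulNr. Qed.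

Lemma conj_real z : z^* = z -> z = ofreal (re z).
Proof.
case: z => a b [] /eqP; rewrite eqNr => /eqP ->.
by [].
Qed.

Lemma conj_ofreal (t : R) : ((ofreal t : C)^*) = ofreal t.
Proof. exact: conjc_real. Qed.

Lemma ler_limits T (F : set_system T) {PF : ProperFilter F} (f g : T -> R) (l l' : R) :
  f @ F --> l -> g @ F --> l' -> F [set t | f t <= g t] -> l <= l'.
Proof.
move=> h h' fg; rewrite -subr_ge0; apply: (cvgr_to_ge (cvgB h' h)).
by apply: filterS fg => t /= ft; rewrite fctE subr_ge0.
Qed.

End ComplexBasics.

Global Opaque Cplx.


Section MatrixLimits.
Variable R : realType.
Local Notation C := (Cplx R).
Context {T : Type} {F : set_system T}.

Definition cvgmx (m n : nat) (X : T -> 'M[C]_(m, n)) (x : 'M[C]_(m, n)) :=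
  forall i j, (fun t => X t i j) @ F --> (x i j : C).

Section Filter.
Context {FF : Filter F}.

Lemma cvgmx_cst m n (x : 'M[C]_(m, n)) : cvgmx (fun=> x) x.
Proof. by move=> i j; exact: cvg_cst. Qed.

Lemma cvgmx_mul m n p (X : T -> 'M[C]_(m, n)) (Y : T -> 'M[C]_(n, p)) x y :
  cvgmx X x -> cvgmx Y y -> cvgmx (fun t => X t *m Y t) (x *m y).
Proof.
move=> hx hy i j; under eq_fun do rewrite mxE; rewrite mxE.
by apply: cvg_sumK => k _; apply: cvg_mulK; [exact: hx|exact: hy].
Qed.

Lemma cvgmx_adj m n (X : T -> 'M[C]_(m, n)) x :
  cvgmx X x -> cvgmx (fun t => (X t)^t*) (x^t*).
Proof.
move=> hx i j; under eq_fun do rewrite !mxE; rewrite !mxE.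
exact: cvg_conj.
Qed.
End Filter.

Lemma cvgmx_unique {PF : ProperFilter F} m n (X : T -> 'M[C]_(m, n)) x y :
  cvgmx X x -> cvgmx X y -> x = y.
Proof. by move=> hx hy; apply/matrixP => i j; apply: (cvg_uniqueC (hx i j) (hy i j)). Qed.

Lemma cvgmx_unitary {PF : ProperFilter F} n (X : T -> 'M[C]_n) x :
  (forall t, X t \is unitarymx) -> cvgmx X x -> x \is unitarymx.
Proof.
move=> uX hx; apply/unitarymxP.
apply: (cvgmx_unique (cvgmx_mul hx (cvgmx_adj hx))).
move=> i j; rewrite (_ : (fun=> _) = cst ((1%:M : 'M[C]_n) i j)); first exact: cvg_cst.
by apply/funext => t; rewrite (unitarymxP (uX t)).
Qed.

Lemma ultra_cvgmx {UF : UltraFilter F} m n (X : T -> 'M[C]_(m, n)) (M : R) :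
  (forall i j, F [set t | nsq (X t i j) <= M]) -> exists x, cvgmx X x.
Proof.
move=> h.
have h' (ij : 'I_m * 'I_n) : exists l : C, (fun t => X t ij.1 ij.2) @ F --> l.
  exact: ultra_bounded.
have [f hf] := choice h'.
by exists (\matrix_(i, j) f (i, j)) => i j; rewrite mxE; exact: (hf (i, j)).
Qed.

End MatrixLimits.
Arguments cvgmx {R T} F {m n} X x.

Section Unitary.
Variable R : realType.
Local Notation C := (Cplx R).

Lemma unitary_entry n (u : 'M[C]_n) i j : u \is unitarymx -> nsq (u i j) <= 1.
Proof.
move=> /unitarymxP/matrixP/(_ i i); rewrite !mxE eqxx => h.
have : ofreal (\sum_k nsq (u i k)) = 1 :> C.
  rewrite rmorph_sum -[RHS]h; apply: eq_bigr => k _.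
  by rewrite !mxE /= nsq_conj.
rewrite -(rmorph1 (@ofreal R)) => /ofrealI <-.
by rewrite (bigD1 j)//= lerDl sumr_ge0// => k _; exact: nsq_ge0.
Qed.

Lemma ultra_unitary T (F : set_system T) {UF : UltraFilter F} n
  (X : T -> 'M[C]_n) : (forall t, X t \is unitarymx) ->
  exists2 x, x \is unitarymx & cvgmx F X x.
Proof.
move=> uX; have [|x hx] := @ultra_cvgmx R _ F _ _ _ X 1.
  by move=> i j; apply: filterE => t; exact: unitary_entry.
by exists x => //; exact: cvgmx_unitary hx.
Qed.

Definition rdiag n (D : 'I_n -> R) : 'M[C]_n := diag_mx (\row_i ofreal (D i)).

Lemma rdiagM n (D E : 'I_n -> R) :
  rdiag D *m rdiag E = rdiag (fun i => D i * E i).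
Proof.
by rewrite /rdiag mulmx_diag; congr diag_mx; apply/rowP => i; rewrite !mxE rmorphM.
Qed.
Lemma rdiag1 n : rdiag (fun _ : 'I_n => 1) = 1%:M.
Proof. by apply/matrixP => i j; rewrite !mxE. Qed.
Lemma rdiag_mul m n (D : 'I_m -> R) (X : 'M[C]_(m, n)) i j :
  (rdiag D *m X) i j = ofreal (D i) * X i j.
Proof. by rewrite /rdiag mul_diag_mx !mxE. Qed.
Lemma mul_rdiag m n (D : 'I_n -> R) (X : 'M[C]_(m, n)) i j :
  (X *m rdiag D) i j = X i j * ofreal (D j).
Proof. by rewrite /rdiag mul_mx_diag !mxE. Qed.
Lemma rdiag_adj n (D : 'I_n -> R) : (rdiag D)^t* = rdiag D.
Proof.
apply/matrixP => i j; rewrite !mxE eq_sym rmorphMn /=.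
case: eqP => [->|_]; rewrite ?mulr0n // !mulr1n.
exact: conj_ofreal.
Qed.
Lemma invmx_rdiag n (D : 'I_n -> R) : (forall i, 0 < D i) ->
  rdiag D \in unitmx /\ invmx (rdiag D) = rdiag (fun i => (D i)^-1).
Proof.
move=> D0.
have e : rdiag D *m rdiag (fun i => (D i)^-1) = 1%:M.
  rewrite rdiagM -rdiag1; congr rdiag; apply/funext => i.
  by rewrite divff// gt_eqF.
have [u _] := mulmx1_unit e; split; first exact: u.
by rewrite -[LHS]mulmx1 -e mulmxA (mulVmx u) mul1mx.
Qed.

Lemma svd n (g : 'M[C]_n) : g \in unitmx ->
  exists u w D, [/\ u \is unitarymx, w \is unitarymx,
    forall i : 'I_n, 0 < D i & g = u *m rdiag D *m w].
Proof.
move=> gu.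
pose A := g^t* *m g; pose P := spectralmx A; pose l := spectral_diag A.
have Pu : P \is unitarymx by exact: spectral_unitarymx.
have An : A \is normalmx.
  by apply/normalmxP; rewrite /A trmx_mul map_mxM /= trmxCK.
have eA : A = P^t* *m diag_mx l *m P.
  by rewrite -invmx_unitary//; apply/orthomx_spectralP.
pose B := g *m P^t*.
have eB : B^t* *m B = diag_mx l.
  rewrite /B trmx_mul map_mxM /= trmxCK -mulmxA (mulmxA (g^t*)) -/A eA.
  by rewrite !mulmxA (unitarymxP Pu) mul1mx -mulmxA (unitarymxP Pu) mulmx1.
have Bu : B \in unitmx.
  rewrite unitmx_mul gu; apply: unitarymx_unit; rewrite trmxC_unitary; exact: Pu.
pose D2 i := \sum_k nsq (B k i).
have D2E i : l 0 i = ofreal (D2 i).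
  have /matrixP/(_ i i) := eB; rewrite !mxE eqxx mulr1n => <-.
  rewrite rmorph_sum; apply: eq_bigr => k _.
  by rewrite !mxE /= mulrC nsq_conj.
have D20 i : 0 < D2 i.
  rewrite lt0r sumr_ge0 ?andbT => [|k _]; last exact: nsq_ge0.
  apply: contraTneq Bu => Di; rewrite unitmxE unitfE negbK.
  apply/eqP; have := congr1 determinant eB; rewrite det_mulmx det_diag.
  rewrite (bigD1 i)//= D2E Di rmorph0 mul0r => /eqP.
  rewrite mulf_eq0 => /orP[|/eqP//].
  by rewrite det_map_mx det_tr fmorph_eq0 => /eqP.
pose D i := Num.sqrt (D2 i).
have D0 i : 0 < D i by rewrite sqrtr_gt0.
have [Du Dinv] := invmx_rdiag D0.
have lD : diag_mx l = rdiag D *m rdiag D.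
  rewrite rdiagM /rdiag; congr diag_mx; apply/rowP => i.
  by rewrite D2E !mxE -expr2 sqr_sqrtr// ltW.
exists (B *m invmx (rdiag D)), P, D; split; [|exact: Pu|exact: D0|].
  apply/unitarymxP/mulmx1C.
  rewrite trmx_mul map_mxM /= Dinv rdiag_adj -Dinv.
  by rewrite -mulmxA (mulmxA (B^t*)) eB lD !mulmxA (mulVmx Du) mul1mx (mulmxV Du).
by rewrite (mulmxKV Du) /B -mulmxA unitary_adjK// mulmx1.
Qed.

Lemma invmx_eq n (A B : 'M[C]_n) : A *m B = 1%:M -> invmx A = B.
Proof.
move=> e; have [u _] := mulmx1_unit e.
by rewrite -[LHS]mulmx1 -e mulmxA (mulVmx u) mul1mx.
Qed.

Lemma svd_act m n (u w : 'M[C]_m) (u' w' : 'M[C]_n) D D' (x : 'M[C]_(m, n)) :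
  u \is unitarymx -> u' \is unitarymx -> w' \is unitarymx ->
  (forall i, 0 < D' i) ->
  u^t* *m (u *m rdiag D *m w *m x *m invmx (u' *m rdiag D' *m w')) *m (u'^t*)^t*
  = rdiag D *m (w *m x *m w'^t*) *m rdiag (fun i => (D' i)^-1).
Proof.
move=> uu uu' uw' D0; rewrite trmxCK.
have [Du Dinv] := invmx_rdiag D0.
rewrite (@invmx_eq _ (u' *m rdiag D' *m w') (w'^t* *m invmx (rdiag D') *m u'^t*)).
  rewrite !mulmxA (unitary_adjK uu) mul1mx -!mulmxA (unitary_adjK uu') mulmx1.
  by rewrite Dinv.
rewrite !mulmxA -(mulmxA _ w') (unitarymxP uw') mulmx1 -(mulmxA u') (mulmxV Du).
by rewrite mulmx1 (unitarymxP uu').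
Qed.

End Unitary.

Section Representations.
Variables (R : realType) (Vt E : finType) (d : Vt -> nat) (s t : E -> Vt).
Local Notation C := (Cplx R).

Definition rep := forall e : E, 'M[C]_(d (t e), d (s e)).
Definition ggauge := forall v : Vt, 'M[C]_(d v).

Definition gact (g : ggauge) (x : rep) : rep :=
  fun e => g (t e) *m x e *m invmx (g (s e)).

Definition uact (u : ggauge) (x : rep) : rep :=
  fun e => u (t e) *m x e *m (u (s e))^t*.

Definition wmom (x : rep) (xi : ggauge) : C :=
  \sum_e (\tr (xi (t e) *m (x e *m (x e)^t*)) -
          \tr (xi (s e) *m ((x e)^t* *m x e))).

Definition level (alpha : Vt -> R) (x : rep) : Prop :=
  forall xi : ggauge, wmom x xi = \sum_v ofreal (alpha v) * \tr (xi v).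

Definition dgauge (phi : forall v, 'I_(d v) -> R) : ggauge :=
  fun v => rdiag (phi v).

Lemma wmom_diag x phi : wmom x (dgauge phi) =
  ofreal (\sum_e \sum_i \sum_j (phi (t e) i - phi (s e) j) * nsq (x e i j)).
Proof.
rewrite rmorph_sum; apply: eq_bigr => e _.
rewrite (eq_bigr (fun i => \sum_j phi (t e) i * nsq (x e i j) -
    \sum_j phi (s e) j * nsq (x e i j))); last first.
  by move=> i _; rewrite -sumrB; apply: eq_bigr => j _; rewrite mulrBl.
rewrite sumrB rmorphB /=; congr (_ - _).
  rewrite /mxtrace rmorph_sum; apply: eq_bigr => i _.
  rewrite rdiag_mul mxE rmorph_sum mulr_sumr; apply: eq_bigr => j _.
  by rewrite !mxE rmorphM /= nsq_conj.
rewrite /mxtrace exchange_big rmorph_sum; apply: eq_bigr => j _.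
rewrite rdiag_mul mxE rmorph_sum mulr_sumr; apply: eq_bigr => i _.
by rewrite !mxE rmorphM /= nsq_conj; congr (_ * _); rewrite mulrC.
Qed.

Definition tpair (alpha : Vt -> R) (phi : forall v, 'I_(d v) -> R) : R :=
  \sum_v \sum_i alpha v * phi v i.

Lemma tpairE (alpha : Vt -> R) phi :
  \sum_v ofreal (alpha v) * \tr (dgauge phi v) = ofreal (tpair alpha phi).
Proof.
rewrite rmorph_sum; apply: eq_bigr => v _.
rewrite rmorph_sum mulr_sumr; apply: eq_bigr => i _.
by rewrite rmorphM /= /dgauge /rdiag !mxE eqxx mulr1n.
Qed.

Lemma level_diag alpha x phi : level alpha x ->
  \sum_e \sum_i \sum_j (phi (t e) i - phi (s e) j) * nsq (x e i j) = tpair alpha phi.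
Proof. by move=> lx; apply: ofrealI; rewrite -wmom_diag lx tpairE. Qed.

Lemma wmom_uact u x xi : (forall v, u v \is unitarymx) ->
  wmom (uact u x) xi = wmom x (fun v => (u v)^t* *m xi v *m u v).
Proof.
move=> uu; apply: eq_bigr => e _; rewrite /uact.
by rewrite (trace_conj_left _ _ _ (uu _)) (trace_conj_right _ _ _ (uu _)).
Qed.

Lemma level_uact alpha u x : (forall v, u v \is unitarymx) ->
  level alpha x -> level alpha (uact u x).
Proof.
move=> uu lx xi; rewrite wmom_uact// lx; apply: eq_bigr => v _; congr (_ * _).
exact: trace_unitary_conj (uu v).
Qed.

Lemma uactK u x : (forall v, u v \is unitarymx) ->
  uact u (uact (fun v => (u v)^t*) x) = x.
Proof.
move=> uu; apply: functional_extensionality_dep => e.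
exact: uact_mxK.
Qed.

Section CompactMeetsNoncompact.
Context {T : Type} {F : set_system T} {UF : UltraFilter F}.

Definition cvgrep (X : T -> rep) (x : rep) := forall e, cvgmx F (fun k => X k e) (x e).

Lemma cvgrep_uact (u : T -> ggauge) u0 X x :
  (forall v, cvgmx F (fun k => u k v) (u0 v)) -> cvgrep X x ->
  cvgrep (fun k => uact (u k) (X k)) (uact u0 x).
Proof.
by move=> hu hx e; exact: (cvgmx_mul (cvgmx_mul (hu _) (hx e)) (cvgmx_adj (hu _))).
Qed.

Section DiagonalCase.
Variables (X : T -> rep) (D : T -> forall v, 'I_(d v) -> R).
Variables (x y : rep) (alpha : Vt -> R).
Hypothesis D_gt0 : forall k v (i : 'I_(d v)), 0 < D k i.
Hypothesis Xx : cvgrep X x.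
Hypothesis Yy : forall e i j,
  (fun k => ofreal (D k i / D k j) * X k e i j) @ F --> (y e i j : C).
Hypotheses (lx : level alpha x) (ly : level alpha y).

Let idx : finType := {: {v : Vt & 'I_(d v)}}.
Let Dx k (a : idx) : R := D k (tagged a).
Let phi (a : idx) : nat := #|[pred b : idx | `[< F [set k | Dx k b < Dx k a] >]]|.

Let phi_lt a b : F [set k | Dx k b < Dx k a] -> (phi b < phi a)%N.
Proof.
move=> h; apply: proper_card; apply/fintype.properP; split.
  apply/fintype.subsetP => c; rewrite !inE => hc.
  by apply: (filterS _ (filterI hc h)) => k [/= h1 h2]; exact: lt_trans h1 h2.
exists b; rewrite inE; first exact: h.
apply/negP; rewrite inE => hb; have [k /=] := filter_ex hb.
by rewrite ltxx.
Qed.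

Let phi_le a b : (phi b <= phi a)%N -> F [set k | Dx k b <= Dx k a].
Proof.
move=> h; have [ab|nab] := in_ultra_setVsetC [set k | Dx k a < Dx k b] UF.
  by move: (phi_lt ab); rewrite ltnNge h.
by apply: filterS nab => k /= /negP; rewrite -leNgt.
Qed.

Lemma ratio_limit e i j :
  F [set k | D k j <= D k i] ->
  nsq (x e i j) <= re (y e i j * (x e i j)^*).
Proof.
move=> h; apply: (ler_limits (cvg_nsq (@Xx e i j))
  (cvgC_re (cvg_mulK (@Yy e i j) (cvg_conj (@Xx e i j))))); apply: filterS h => k /= h.
rewrite -mulrA -nsq_conj -rmorphM reK ler_peMl ?nsq_ge0//.
by rewrite ler_pdivlMr// mul1r.
Qed.

Lemma ratio_limit' e i j :
  F [set k | D k i <= D k j] ->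
  nsq (y e i j) <= re (y e i j * (x e i j)^*).
Proof.
move=> h; apply: (ler_limits (cvg_nsq (@Yy e i j))
  (cvgC_re (cvg_mulK (@Yy e i j) (cvg_conj (@Xx e i j))))); apply: filterS h => k /= h.
rewrite -mulrA -nsq_conj -rmorphM reK nsqM nsq_of.
have r0 : 0 <= D k i / D k j by rewrite divr_ge0// ltW.
apply: ler_wpM2r; first exact: nsq_ge0.
by rewrite expr2; apply: ler_piMl => //; rewrite ler_pdivrMr// mul1r.
Qed.

Lemma re_le_mean (z w : C) : 2 * re (z * w^*) <= nsq z + nsq w.
Proof. by rewrite -subr_ge0 -nsqB nsq_ge0. Qed.

Lemma diag_limits_eq e i j : y e i j = x e i j.
Proof.
pose psi v (i : 'I_(d v)) : R := (phi (existT _ v i))%:R.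
pose tm e i j := (psi (t e) i - psi (s e) j) * (nsq (y e i j) - nsq (x e i j)).
have tm0 e' i' j' : 0 <= tm e' i' j'.
  rewrite /tm; set a : idx := existT _ _ i'; set b : idx := existT _ _ j'.
  have := re_le_mean (y e' i' j') (x e' i' j').
  have [ab|ba] := leqP (phi a) (phi b).
    have /= h := ratio_limit' (phi_le ab); move=> h2.
    apply: mulr_le0; last by move: h h2; lra.
    by rewrite subr_le0 ler_nat.
  have /= h := ratio_limit (phi_le (ltnW ba)); move=> h2.
  apply: mulr_ge0; last by move: h h2; lra.
  by rewrite subr_ge0 ler_nat ltnW.
have sum0 : \sum_e \sum_i \sum_j tm e i j = 0.
  rewrite -[RHS](subrr (tpair alpha psi)) -{1}(level_diag psi ly) -(level_diag psi lx).
  rewrite -sumrB; apply: eq_bigr => e' _; rewrite -sumrB; apply: eq_bigr => i' _.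
  by rewrite -sumrB; apply: eq_bigr => j' _; rewrite /tm mulrBr.
have tm_eq0 : tm e i j = 0.
  have t1 : \sum_i \sum_j tm e i j = 0.
    apply: (psumr_eq0P _ sum0) => // e' _; apply: sumr_ge0 => i' _.
    exact: sumr_ge0.
  have t2 : \sum_j tm e i j = 0.
    by apply: (psumr_eq0P _ t1) => // i' _; exact: sumr_ge0.
  exact: (psumr_eq0P _ t2).
apply/eqP; rewrite -subr_eq0 -nsq_eq0 eq_le nsq_ge0 andbT nsqB.
set a : idx := existT _ _ i; set b : idx := existT _ _ j.
have ab_eq : phi a != phi b -> nsq (y e i j) = nsq (x e i j).
  move=> ab; apply/eqP; rewrite -subr_eq0; have /eqP := tm_eq0.
  by rewrite /tm mulf_eq0 !subr_eq0 /psi eqr_nat (negPf ab).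
have [ab|ba|ab] := ltngtP (phi a) (phi b).
- by have /= := ratio_limit' (phi_le (ltnW ab)); rewrite ab_eq ?ltn_eqF//; lra.
- by have /= := ratio_limit (phi_le (ltnW ba)); rewrite ab_eq ?gtn_eqF//; lra.
have /= := ratio_limit' (phi_le (eq_leq ab)).
by have /= := ratio_limit (phi_le (eq_leq (esym ab))); lra.
Qed.
End DiagonalCase.

Lemma ultra_unitary_gauge (Y : T -> ggauge) :
  (forall k v, Y k v \is unitarymx) ->
  exists2 y0 : ggauge, (forall v, y0 v \is unitarymx) &
    forall v, cvgmx F (fun k => Y k v) (y0 v).
Proof.
move=> uY.
have h' v : exists2 x, x \is unitarymx & cvgmx F (fun k => Y k v) x.
  by apply: ultra_unitary => k; exact: uY.
have h v := cid2 (h' v).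
by exists (fun v => s2val (h v)) => v; [exact: (s2valP (h v))|exact: (s2valP' (h v))].
Qed.

Theorem unitary_orbit_of_limits (X : T -> rep) (g : T -> ggauge) x y alpha :
  (forall k v, g k v \in unitmx) -> cvgrep X x ->
  cvgrep (fun k => gact (g k) (X k)) y -> level alpha x -> level alpha y ->
  exists u, (forall v, u v \is unitarymx) /\ y = uact u x.
Proof.
move=> gu Xx Yy lx ly.
have dec k v : {p : 'M[C]_(d v) * 'M[C]_(d v) * ('I_(d v) -> R) |
    [/\ p.1.1 \is unitarymx, p.1.2 \is unitarymx, forall i, 0 < p.2 i &
        g k v = p.1.1 *m rdiag p.2 *m p.1.2]}.
  apply: cid; have [u [w [D [h1 h2 h3 h4]]]] := svd (gu k v).
  by exists (u, w, D); split; [exact: h1|exact: h2|exact: h3|exact: h4].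
pose U k v := (sval (dec k v)).1.1; pose W k v := (sval (dec k v)).1.2.
pose D k v i := (sval (dec k v)).2 i.
have UU k v : U k v \is unitarymx.
  have [h _ _ _] := svalP (dec k v); exact: h.
have WU k v : W k v \is unitarymx.
  have [_ h _ _] := svalP (dec k v); exact: h.
have D0 k v i : 0 < D k v i.
  have [_ _ h _] := svalP (dec k v); exact: h.
have gE k v : g k v = U k v *m rdiag (D k v) *m W k v.
  have [_ _ _ h] := svalP (dec k v); exact: h.
have [u0 u0u Uu0] := ultra_unitary_gauge UU.
have [w0 w0u Ww0] := ultra_unitary_gauge WU.
have u0u' v : (u0 v)^t* \is unitarymx by rewrite trmxC_unitary; exact: u0u.
have e0 : uact (fun v => (u0 v)^t*) y = uact w0 x.
  apply: functional_extensionality_dep => e; apply/matrixP => i j.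
  apply: (diag_limits_eq D0 (cvgrep_uact Ww0 Xx) _ (level_uact w0u lx)
    (level_uact u0u' ly)) => e' i' j'.
  have FF : Filter F by exact: _.
  have h := cvgrep_uact (u0 := fun v => (u0 v)^t*)
    (fun v => cvgmx_adj (FF := FF) (Uu0 v)) Yy.
  move: (h e' i' j'); apply: cvg_trans; apply: near_eq_cvg; apply: filterE => k /=.
  rewrite /gact /uact !gE svd_act; [|exact: UU..|exact: WU|exact: D0].
  by rewrite mul_rdiag rdiag_mul rmorphM /= mulrAC mulrC mulrA mulrC.
exists (fun v => u0 v *m w0 v); split.
  by move=> v; apply: mul_unitarymx; [exact: u0u|exact: w0u].
rewrite -[LHS](uactK y u0u) e0.
by apply: functional_extensionality_dep => e; exact: uact_mxM.
Qed.

End CompactMeetsNoncompact.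
End Representations.

Section Coercivity.
Variable R : realType.

Lemma abel_summation (a f : nat -> R) n :
  \sum_(k < n.+1) a k * f k = (\sum_(k < n.+1) a k) * f n
  - \sum_(k < n) (\sum_(l < k.+1) a l) * (f k.+1 - f k).
Proof.
elim: n => [|n IH]; first by rewrite !big_ord1 big_ord0 subr0.
rewrite big_ord_recr /= IH [X in _ = X * _ - _]big_ord_recr /=.
rewrite [X in _ = _ - X]big_ord_recr /=; ring.
Qed.

Lemma sorted_coercive (I : finType) (al phi : I -> R) (del Tot : R) :
  0 < del -> 0 <= Tot -> \sum_i al i = 0 ->
  (forall J : pred I, \sum_(i | J i) al i < 0 -> forall g, 0 <= g ->
     (forall i j, ~~ J i -> J j -> g <= phi i - phi j) -> del * g ^+ 2 <= Tot) ->
  \sum_i al i * phi i <=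
    Tot / 4 + (\sum_i `|al i|) ^+ 2 * #|I|%:R ^+ 2 / del.
Proof.
move=> del0 Tot0 al0 H; set a := \sum_i `|al i|.
pose le_phi := relpre phi <=%R.
pose s := sort le_phi (enum I).
have stot : total le_phi by move=> i j; exact: le_total.
have strans : transitive le_phi by move=> j i k; exact: le_trans.
have s_sorted : sorted le_phi s by exact: sort_sorted.
have s_perm : perm_eq s (enum I) by rewrite perm_sort.
have s_uniq : uniq s by rewrite (perm_uniq s_perm) enum_uniq.
have s_mem i : i \in s by rewrite (perm_mem s_perm) mem_enum.
have s_size : size s = #|I| by rewrite size_sort cardE.
have sumE (f : I -> R) : \sum_i f i = \sum_(i <- s) f i.
  by rewrite (perm_big _ s_perm) big_enum.
case EI : #|I| => [|n].
  rewrite sumE; have /size0nil -> : size s = 0%N by rewrite s_size.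
  by rewrite big_nil expr0n /= mulr0 mul0r addr0 divr_ge0.
have [x0 _] : exists x0 : I, true.
  have /card_gt0P[x0 _] : (0 < #|I|)%N by rewrite EI.
  by exists x0.
have sn : size s = n.+1 by rewrite s_size.
have -> : \sum_i al i * phi i =
    \sum_(k < n.+1) al (nth x0 s k) * phi (nth x0 s k).
  by rewrite sumE (big_nth x0) sn big_mkord.
rewrite (abel_summation (fun k => al (nth x0 s k)) (fun k => phi (nth x0 s k))).
have -> : \sum_(k < n.+1) al (nth x0 s k) = 0.
  by rewrite -[RHS]al0 sumE (big_nth x0) sn big_mkord.
rewrite mul0r sub0r -sumrN.
pose B := Tot / (4 * n.+1%:R) + a ^+ 2 * n.+1%:R / del.
have n0 : 0 < n.+1%:R :> R by rewrite ltr0n.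
have B0 : 0 <= B.
  apply: addr_ge0; first by rewrite divr_ge0// mulr_ge0// ltW.
  by rewrite divr_ge0 ?(ltW del0)// mulr_ge0 ?sqr_ge0// ltW.
apply: (@le_trans _ _ (\sum_(k < n) B)).
  apply: ler_sum => k _.
  set A := \sum_(l < k.+1) _; set gap := _ - _.
  have kn : (k.+1 < size s)%N by rewrite sn ltnS.
  have mono i j : (i <= j < size s)%N -> phi (nth x0 s i) <= phi (nth x0 s j).
    move=> /andP[ij js].
    by apply: (sorted_leq_nth strans _ x0 s_sorted) => //; rewrite ?inE ?(leq_ltn_trans ij)//;
       move=> ?; exact: lexx.
  have gap0 : 0 <= gap by rewrite subr_ge0 mono// leqnSn.
  have [A0|A0] := leP 0 A.
    by rewrite (le_trans _ B0)// oppr_le0 mulr_ge0.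
  pose J : pred I := [pred i | (index i s <= k)%N].
  have AJ : A = \sum_(i | J i) al i.
    rewrite big_mkcond sumE (big_nth x0) sn big_mkord /A.
    have kn' : (k.+1 <= n.+1)%N by rewrite ltnS ltnW.
    rewrite (big_ord_widen n.+1 (fun l => al (nth x0 s l)) kn') big_mkcond /=.
    by apply: eq_bigr => l _; rewrite /J /= index_uniq ?sn// ltnS.
  have Hg : del * gap ^+ 2 <= Tot.
    apply: (H J) => //; first by rewrite -AJ.
    move=> i j; rewrite /J /= -ltnNge => ki jk.
    rewrite /gap -(nth_index x0 (s_mem i)) -(nth_index x0 (s_mem j)).
    by apply: lerB; apply: mono; rewrite ?ki ?jk ?index_mem ?s_mem//= ltnW.
  have Aa : - A <= a.
    rewrite AJ /a (le_trans (ler_norm _))// normrN.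
    rewrite (le_trans (ler_norm_sum _ _ _))//.
    by rewrite [leRHS](bigID J)/= lerDl sumr_ge0.
  rewrite -mulNr (le_trans (ler_wpM2r gap0 Aa))// /B.
  have a0 : 0 <= a by exact: sumr_ge0.
  have sq : 0 <= (del * gap - 2 * n.+1%:R * a) ^+ 2 by exact: sqr_ge0.
  have h1 : a * gap <= del * gap ^+ 2 / (4 * n.+1%:R) + a ^+ 2 * n.+1%:R / del.
    rewrite -(ler_pM2r (_ : 0 < 4 * n.+1%:R * del)) ?mulr_gt0//.
    rewrite [leRHS](_ : _ = (del * gap) ^+ 2 + 4 * (n.+1%:R * a) ^+ 2).
      by move: sq; lra.
    by field; rewrite ?gt_eqF// nat1r ltr0n.
  apply: (le_trans h1); rewrite lerD2r ler_wpM2r// invr_ge0 mulr_ge0// ltW.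
rewrite sumr_const card_ord -[leLHS]mulr_natr /B [leLHS]mulrDl.
have nn : n%:R <= n.+1%:R :> R by rewrite ler_nat.
apply: lerD.
  have -> : Tot / 4 = Tot / (4 * n.+1%:R) * n.+1%:R.
    by field; rewrite ?gt_eqF// nat1r ltr0n.
  by rewrite ler_wpM2l// divr_ge0// mulr_ge0// ltW.
have -> : a ^+ 2 * n.+1%:R ^+ 2 / del = (a ^+ 2 * n.+1%:R / del) * n.+1%:R by ring.
by rewrite ler_wpM2l// divr_ge0 ?(ltW del0)// mulr_ge0 ?sqr_ge0// ltW.
Qed.

Lemma ler_sum1 (I : finType) (f : I -> R) i : (forall i, 0 <= f i) -> f i <= \sum_i f i.
Proof. by move=> f0; rewrite (bigD1 i)//= lerDl sumr_ge0. Qed.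

End Coercivity.

Section KempfNess.
Variables (R : realType) (Vt E : finType) (d : Vt -> nat) (s t : E -> Vt).
Local Notation C := (Cplx R).
Local Notation rep := (@rep R Vt E d s t).
Local Notation ggauge := (@ggauge R Vt d).
Local Notation idx := {v : Vt & 'I_(d v)}.

Definition idx_of v (i : 'I_(d v)) : idx := existT _ v i.

Definition coord_semistable (alpha : Vt -> R) (x : rep) : Prop :=
  \sum_v (d v)%:R * alpha v = 0 /\
  forall (w : ggauge) (J : pred idx), (forall v, w v \is unitarymx) ->
    (forall e i j, ~~ J (idx_of i) -> J (idx_of j) -> uact w x e i j = 0) ->
    0 <= \sum_(a | J a) alpha (tag a).

Definition rnorm2 (x : rep) : R := \sum_e \sum_i \sum_j nsq (x e i j).

Lemma rnorm2_ge0 x : 0 <= rnorm2 x.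
Proof. by do 3![apply: sumr_ge0 => ? _]; exact: nsq_ge0. Qed.

Lemma nsq_le_rnorm2 (x : rep) e i j : nsq (x e i j) <= rnorm2 x.
Proof.
apply: le_trans (ler_sum1 e _); last first.
  by move=> e'; do 2![apply: sumr_ge0 => ? _]; exact: nsq_ge0.
apply: le_trans (ler_sum1 i _); last by move=> i'; apply: sumr_ge0 => ? _; exact: nsq_ge0.
by apply: (ler_sum1 j) => j'; exact: nsq_ge0.
Qed.

Lemma rnorm2_tr x : ofreal (rnorm2 x) = \sum_e \tr (x e *m (x e)^t*).
Proof.
rewrite rmorph_sum; apply: eq_bigr => e _.
rewrite rmorph_sum; apply: eq_bigr => i _.
rewrite mxE rmorph_sum; apply: eq_bigr => j _.
by rewrite !mxE /= nsq_conj.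
Qed.

Lemma rnorm2_uact (u : ggauge) x : (forall v, u v \is unitarymx) ->
  rnorm2 (uact u x) = rnorm2 x.
Proof.
move=> uu; apply: ofrealI; rewrite !rnorm2_tr; apply: eq_bigr => e _.
have := trace_conj_left (u (t e)) 1%:M (x e) (uu (s e)).
rewrite mul1mx => ->; rewrite mulmx1.
by rewrite (unitary_adjK (uu _)) mul1mx.
Qed.

Definition leak (J : pred idx) (x : rep) : R :=
  \sum_e \sum_i \sum_j (if ~~ J (idx_of i) && J (idx_of j) then nsq (x e i j) else 0).

Lemma leak_ge0 J x : 0 <= leak J x.
Proof. by do 3![apply: sumr_ge0 => ? _]; case: ifP => // _; exact: nsq_ge0. Qed.

Lemma leak_gap1 alpha x (J : pred idx) : coord_semistable alpha x ->
  \sum_(a | J a) alpha (tag a) < 0 ->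
  exists2 del, 0 < del & forall w : ggauge, (forall v, w v \is unitarymx) ->
    del <= leak J (uact w x).
Proof.
move=> [_ ss] aJ; apply: contrapT => nex.
have H (n : nat) : exists w : ggauge, (forall v, w v \is unitarymx) /\
    leak J (uact w x) < n.+1%:R^-1.
  apply: contrapT => H; apply: nex; exists n.+1%:R^-1; first by rewrite invr_gt0.
  move=> w wu; rewrite leNgt; apply/negP => lw; apply: H.
  by exists w; split; [exact: wu|exact: lw].
have [W HW] := choice H.
have [G [GU infG]] := ultraFilterLemma (eventually_filter : ProperFilter \oo).
have WU k v : W k v \is unitarymx by have [h _] := HW k; exact: h.
have [w0 w0u Ww0] := @ultra_unitary_gauge R Vt d nat G GU W WU.
have FG : Filter G by exact: _.
have cx : cvgrep (F := G) (fun=> x) x by move=> e; exact: cvgmx_cst.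
have cW : cvgrep (F := G) (fun k => uact (W k) x) (uact w0 x).
  exact: (cvgrep_uact Ww0 cx).
have lk : (fun k => leak J (uact (W k) x)) @ G --> leak J (uact w0 x).
  apply: cvg_sumR => e _; apply: cvg_sumR => i _; apply: cvg_sumR => j _.
  case: (~~ J _ && J _); last exact: cvg_cstR.
  exact: (cvg_nsq (f := fun k => uact (W k) x e i j) (@cW e i j)).
have h0 : (fun k : nat => k.+1%:R^-1 : R) @ G --> (0 : R).
  by apply: cvg_trans (@cvg_harmonic R) => A; exact: infG.
have lk0 : leak J (uact w0 x) <= 0.
  apply: (ler_limits lk h0); apply: filterE => k /=.
  by have [_ /ltW] := HW k.
have lk1 : leak J (uact w0 x) = 0 by apply/eqP; rewrite eq_le lk0 leak_ge0.
have := ss w0 J w0u; rewrite leNgt aJ; case/(_ _)/negP => //.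
move=> e i j nJ Jj; apply/eqP; rewrite -nsq_eq0; apply/eqP.
pose f e i j := if ~~ J (idx_of i) && J (idx_of j) then nsq (uact w0 x e i j) else 0.
have f0 e' i' j' : 0 <= f e' i' j'.
  by rewrite /f; case: ifP => // _; exact: nsq_ge0.
have t1 : \sum_i \sum_j f e i j = 0.
  have lk2 : \sum_e \sum_i \sum_j f e i j = 0 by exact: lk1.
  apply: (psumr_eq0P _ lk2) => // e' _.
  by apply: sumr_ge0 => i' _; apply: sumr_ge0 => j' _.
have t2 : \sum_j f e i j = 0.
  by apply: (psumr_eq0P _ t1) => // i' _; apply: sumr_ge0.
have : f e i j = 0 by apply: (psumr_eq0P _ t2).
by rewrite /f nJ Jj.
Qed.

Lemma leak_gap alpha x : coord_semistable alpha x ->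
  exists2 del, 0 < del & forall (J : pred idx) (w : ggauge),
    \sum_(a | J a) alpha (tag a) < 0 -> (forall v, w v \is unitarymx) ->
    del <= leak J (uact w x).
Proof.
move=> ss.
have H (J : {ffun idx -> bool}) : exists del, 0 < del /\
    (\sum_(a | J a) alpha (tag a) < 0 -> forall w : ggauge,
      (forall v, w v \is unitarymx) -> del <= leak J (uact w x)).
  have [aJ|aJ] := ltP (\sum_(a | J a) alpha (tag a)) 0; last by exists 1.
  by have [del del0 h] := leak_gap1 ss aJ; exists del.
have [f Hf] := choice H.
exists (\big[Order.min/1]_J f J).
  by apply: lt_bigmin => // J _; case: (Hf J).
move=> J w aJ wu; pose J' : {ffun idx -> bool} := finfun J.
have JJ' : J' =1 J by move=> a; rewrite ffunE.
have -> : leak J (uact w x) = leak J' (uact w x).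
  by do 3![apply: eq_bigr => ? _]; rewrite !JJ'.
apply: (@le_trans _ _ (f J')); first exact: bigmin_le_cond.
have [_ h] := Hf J'; apply: h => //.
by rewrite (eq_bigl _ _ JJ').
Qed.
End KempfNess.

Section Determinants.
Variable R : realType.
Local Notation C := (Cplx R).

Lemma nsq_det_unitary n (u : 'M[C]_n) : u \is unitarymx -> nsq (\det u) = 1.
Proof.
move=> /unitarymxP/(congr1 determinant); rewrite det_mulmx det1 det_map_mx det_tr => h.
by apply: ofrealI; rewrite rmorph1 nsq_conj.
Qed.

Lemma ln_det_svd n (u w : 'M[C]_n) (phi : 'I_n -> R) :
  u \is unitarymx -> w \is unitarymx ->
  ln (nsq (\det (u *m rdiag (fun i => expR (phi i)) *m w))) = 2 * \sum_i phi i.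
Proof.
move=> uu wu; rewrite (det_mulmx _ w) (det_mulmx u) nsqM nsqM.
rewrite (nsq_det_unitary uu) (nsq_det_unitary wu) mul1r mulr1.
have -> : \det (rdiag (fun i => expR (phi i))) = ofreal (expR (\sum_i phi i)).
  rewrite det_diag expR_sum rmorph_prod; apply: eq_bigr => i _.
  by rewrite mxE.
by rewrite nsq_of -expRM_natl expRK.
Qed.

Lemma svd_exp n (g : 'M[C]_n) : g \in unitmx ->
  exists u w (phi : 'I_n -> R), [/\ u \is unitarymx, w \is unitarymx &
    g = u *m rdiag (fun i => expR (phi i)) *m w].
Proof.
move=> /svd[u [w [D [uu wu D0 ->]]]]; exists u, w, (fun i => ln (D i)).
split; [exact: uu|exact: wu|]; congr (_ *m _ *m _); congr rdiag.
by apply/funext => i; rewrite lnK ?posrE.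
Qed.

Lemma unitmx_det_gt0 n (g : 'M[C]_n) : g \in unitmx -> 0 < nsq (\det g).
Proof. by rewrite unitmxE unitfE nsq_gt0. Qed.

Lemma unitmx_rdiag_exp n (phi : 'I_n -> R) : rdiag (fun i => expR (phi i)) \in unitmx.
Proof. by have [] := @invmx_rdiag R n (fun i => expR (phi i)) (fun i => expR_gt0 _). Qed.

Lemma invmxM n (A B : 'M[C]_n) : A \in unitmx -> B \in unitmx ->
  invmx (A *m B) = invmx B *m invmx A.
Proof.
move=> Au Bu; apply: invmx_eq.
by rewrite mulmxA -(mulmxA A) (mulmxV Bu) mulmx1 (mulmxV Au).
Qed.

Lemma hermitian_spectral n (xi : 'M[C]_n) : xi^t* = xi ->
  exists u (phi : 'I_n -> R), u \is unitarymx /\ xi = u^t* *m rdiag phi *m u.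
Proof.
move=> hxi; have xin : xi \is normalmx by apply/normalmxP; rewrite hxi.
pose P := spectralmx xi; pose l := spectral_diag xi.
have Pu : P \is unitarymx by exact: spectral_unitarymx.
have eA : xi = P^t* *m diag_mx l *m P.
  by rewrite -invmx_unitary; [exact/orthomx_spectralP|exact: Pu].
exists P, (fun i => re (l 0 i)); split; first exact: Pu.
rewrite [LHS]eA; congr (_ *m _ *m _).
have dl : diag_mx l = P *m xi *m P^t*.
  rewrite eA -!mulmxA (unitarymxP Pu) mulmx1 !mulmxA (unitarymxP Pu) mul1mx.
  by [].
have dl' : (diag_mx l)^t* = diag_mx l.
  by rewrite dl !adj_mul trmxCK hxi mulmxA.
congr diag_mx; apply/rowP => i; rewrite mxE.
have /matrixP/(_ i i) := dl'; rewrite !mxE eqxx mulr1n => h.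
apply: conj_real; exact: h.
Qed.

End Determinants.

Section SmallReal.
Variable R : realType.

Lemma expR_le_quadratic (x : R) : x <= 1 / 2 -> expR x <= 1 + x + 2 * x ^+ 2.
Proof.
move=> x2; have h := expR_ge1Dx (- x); rewrite expRN in h.
have p : 0 < 1 - x by lra.
rewrite -(ler_pM2l p); apply: (@le_trans _ _ 1).
  by rewrite -ler_pdivlMr ?expR_gt0// mul1r.
have -> : (1 - x) * (1 + x + 2 * x ^+ 2) = 1 + x ^+ 2 * (1 - 2 * x) by ring.
by rewrite lerDl mulr_ge0 ?sqr_ge0//; lra.
Qed.

Lemma quadratic_bound_ge0 (A B t0 : R) : 0 < t0 ->
  (forall t, 0 < t -> t <= t0 -> 0 <= t * A + t ^+ 2 * B) -> 0 <= A.
Proof.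
move=> t00 H; rewrite leNgt; apply/negP => A0.
have B1 : 0 < `|B| + 1 by rewrite ltr_wpDl.
pose t := Num.min t0 (- A / (2 * (`|B| + 1))).
have t0' : 0 < t by rewrite lt_min t00 divr_gt0 ?oppr_gt0// mulr_gt0.
have h1 : t * (`|B| + 1) <= - A / 2.
  have : t <= - A / (2 * (`|B| + 1)) by rewrite ge_min lexx orbT.
  by rewrite ler_pdivlMr ?mulr_gt0// => h; rewrite ler_pdivlMr//; lra.
have h2 : t <= t0 by rewrite ge_min lexx.
have h3 : 0 <= t * (A + t * B) by have := H t t0' h2; rewrite mulrDr expr2 mulrA.
have h4 : t * B <= t * `|B| by rewrite ler_pM2l// ler_norm.
by move: h3; rewrite pmulr_rge0//; lra.
Qed.
End SmallReal.

Section Minimum.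
Variables (R : realType) (Vt E : finType) (d : Vt -> nat) (s t : E -> Vt).
Local Notation C := (Cplx R).
Local Notation rep := (@rep R Vt E d s t).
Local Notation ggauge := (@ggauge R Vt d).
Local Notation idx := {v : Vt & 'I_(d v)}.

Definition invertible (g : ggauge) := forall v, g v \in unitmx.
Definition unitary_gauge (g : ggauge) := forall v, g v \is unitarymx.
Definition mulg (h g : ggauge) : ggauge := fun v => h v *m g v.

Lemma gactM h g (x : rep) : invertible h -> invertible g ->
  gact h (gact g x) = gact (mulg h g) x.
Proof.
move=> hu gu; apply: functional_extensionality_dep => e; rewrite /gact /mulg.
by rewrite (invmxM (hu _) (gu _)) !mulmxA.
Qed.

Lemma invertible_mul h g : invertible h -> invertible g -> invertible (mulg h g).
Proof. by move=> hu gu v; rewrite unitmx_mul (hu v) (gu v). Qed.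

Definition chi (alpha : Vt -> R) (g : ggauge) : R :=
  \sum_v alpha v * ln (nsq (\det (g v))).

Lemma chiM alpha h g : invertible h -> invertible g ->
  chi alpha (mulg h g) = chi alpha h + chi alpha g.
Proof.
move=> hu gu; rewrite -big_split; apply: eq_bigr => v _ /=.
rewrite -mulrDr /mulg det_mulmx nsqM lnM// posrE unitmx_det_gt0//.
Qed.

Definition exp_gauge (u : ggauge) (phi : forall v, 'I_(d v) -> R) (w : ggauge) : ggauge :=
  fun v => u v *m rdiag (fun i => expR (phi v i)) *m w v.

Lemma exp_gaugeP (g : ggauge) : invertible g ->
  exists u phi w, [/\ unitary_gauge u, unitary_gauge w & g = exp_gauge u phi w].
Proof.
move=> gu.
have dec v : {p : 'M[C]_(d v) * 'M[C]_(d v) * ('I_(d v) -> R) |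
    [/\ p.1.1 \is unitarymx, p.1.2 \is unitarymx &
        g v = p.1.1 *m rdiag (fun i => expR (p.2 i)) *m p.1.2]}.
  apply: cid; have [u [w [D [h1 h2 h3]]]] := svd_exp (gu v).
  by exists (u, w, D); split; [exact: h1|exact: h2|exact: h3].
exists (fun v => (sval (dec v)).1.1), (fun v => (sval (dec v)).2),
  (fun v => (sval (dec v)).1.2); split=> [v|v|].
- have [h _ _] := svalP (dec v); exact: h.
- have [_ h _] := svalP (dec v); exact: h.
- apply: functional_extensionality_dep => v.
  have [_ _ h] := svalP (dec v); exact: h.
Qed.

Lemma unitary_invertible (u : ggauge) : unitary_gauge u -> invertible u.
Proof. by move=> uu v; exact: unitarymx_unit (uu v). Qed.

Lemma exp_gauge_invertible u phi w : unitary_gauge u -> unitary_gauge w ->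
  invertible (exp_gauge u phi w).
Proof.
move=> uu wu v; rewrite /exp_gauge !unitmx_mul.
rewrite (unitary_invertible uu v) (unitary_invertible wu v) andbT.
exact: unitmx_rdiag_exp.
Qed.

Lemma chi_exp alpha u phi w : unitary_gauge u -> unitary_gauge w ->
  chi alpha (exp_gauge u phi w) = 2 * tpair alpha phi.
Proof.
move=> uu wu; rewrite mulr_sumr; apply: eq_bigr => v _.
by rewrite (ln_det_svd _ (uu v) (wu v)) mulrCA; congr (2 * _); rewrite mulr_sumr.
Qed.

Lemma rnorm2_exp u phi w (x : rep) : unitary_gauge u -> unitary_gauge w ->
  rnorm2 (gact (exp_gauge u phi w) x) =
  \sum_e \sum_i \sum_j
    expR (phi (t e) i - phi (s e) j) ^+ 2 * nsq (uact w x e i j).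
Proof.
move=> uu wu.
pose y : rep := fun e => rdiag (fun i => expR (phi (t e) i)) *m uact w x e
  *m rdiag (fun j => (expR (phi (s e) j))^-1).
have -> : gact (exp_gauge u phi w) x = uact u y.
  apply: functional_extensionality_dep => e.
  have ye : y e = (u (t e))^t* *m gact (exp_gauge u phi w) x e *m ((u (s e))^t*)^t*.
    symmetry; apply: svd_act; [exact: uu|exact: uu|exact: wu|].
    by move=> i; exact: expR_gt0.
  rewrite /uact ye; symmetry; exact: uact_mxK (uu (t e)) (uu (s e)).
rewrite (rnorm2_uact _ uu); apply: eq_bigr => e _; apply: eq_bigr => i _.
apply: eq_bigr => j _; rewrite mul_rdiag rdiag_mul !nsqM !nsq_of.
by rewrite expRD expRN exprMn mulrAC.
Qed.

Lemma tpair_idx (alpha : Vt -> R) (phi : forall v, 'I_(d v) -> R) : tpair alpha phi =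
  \sum_(a : idx) alpha (tag a) * phi (tag a) (tagged a).
Proof. by rewrite /tpair sig_big_dep. Qed.

Lemma coercive alpha (x : rep) : coord_semistable alpha x ->
  exists K, forall g, invertible g ->
    chi alpha g <= rnorm2 (gact g x) / 2 + K.
Proof.
move=> ss; have [del del0 Hdel] := leak_gap ss.
exists (2 * ((\sum_(a : idx) `|alpha (tag a)|) ^+ 2 * #|{: idx}|%:R ^+ 2 / del)).
move=> g /exp_gaugeP[u [phi [w [uu wu ->]]]].
rewrite chi_exp// tpair_idx.
set N := rnorm2 _; have N0 : 0 <= N by exact: rnorm2_ge0.
suff : \sum_(a : idx) alpha (tag a) * phi (tag a) (tagged a) <=
    N / 4 + (\sum_(a : idx) `|alpha (tag a)|) ^+ 2 * #|{: idx}|%:R ^+ 2 / del by lra.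
apply: (sorted_coercive (al := fun a : idx => alpha (tag a))
  (phi := fun a : idx => phi (tag a) (tagged a)) del0 N0).
  have [a0 _] := ss; rewrite -[RHS]a0.
  transitivity (\sum_v \sum_(i < d v) alpha v); first by rewrite sig_big_dep.
  by apply: eq_bigr => v _; rewrite sumr_const card_ord mulr_natl.
move=> J aJ gap gap0 Hgap.
have h := Hdel J w aJ wu; apply: (@le_trans _ _ (leak J (uact w x) * gap ^+ 2)).
  by rewrite ler_wpM2r// sqr_ge0.
rewrite /N (rnorm2_exp _ _ uu wu) /leak mulr_suml; apply: ler_sum => e _.
rewrite mulr_suml; apply: ler_sum => i _; rewrite mulr_suml; apply: ler_sum => j _.
case: ifPn => [/andP[nJ Jj]|_]; last first.
  by rewrite mul0r mulr_ge0 ?sqr_ge0 ?nsq_ge0.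
rewrite mulrC ler_wpM2r ?nsq_ge0//.
have h1 := Hgap _ _ nJ Jj; have h2 := expR_ge1Dx (phi (t e) i - phi (s e) j).
rewrite ler_pXn2r ?nnegrE ?expR_ge0//.
by move: h1 h2 => /=; lra.
Qed.

Lemma gact_id_mul h (T : Type) (F : set_system T) (FF : Filter F)
    (X : T -> rep) z : cvgrep (F := F) X z ->
  cvgrep (F := F) (fun k => gact h (X k)) (gact h z).
Proof.
move=> Xz e; apply: cvgmx_mul; last exact: cvgmx_cst.
by apply: cvgmx_mul; [exact: cvgmx_cst|exact: Xz].
Qed.

Lemma cvg_rnorm2 (T : Type) (F : set_system T) (FF : Filter F)
    (X : T -> rep) z : cvgrep (F := F) X z ->
  (fun k => rnorm2 (X k)) @ F --> rnorm2 z.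
Proof.
move=> Xz; apply: cvg_sumR => e _; apply: cvg_sumR => i _; apply: cvg_sumR => j _.
exact: (cvg_nsq (f := fun k => X k e i j) (@Xz e i j)).
Qed.

Lemma ultra_cvgrep (T : Type) (F : set_system T) (UF : UltraFilter F)
    (X : T -> rep) M : F [set k | rnorm2 (X k) <= M] ->
  exists z, cvgrep (F := F) X z.
Proof.
move=> XM.
have h e : {z | cvgmx F (fun k => X k e) z}.
  apply: cid; apply: (ultra_cvgmx (M := M)) => i j.
  by apply: filterS XM => k /= h; apply: le_trans h; exact: nsq_le_rnorm2.
by exists (fun e => sval (h e)) => e; exact: (svalP (h e)).
Qed.

(* The Kempf-Ness functional attains its infimum on the closure of an orbit *)
Lemma minimum_in_closure alpha (x : rep) : coord_semistable alpha x ->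
  exists (z : rep) (W : nat -> ggauge) (G : set_system nat),
    [/\ UltraFilter G, forall k, invertible (W k),
      cvgrep (F := G) (fun k => gact (W k) x) z &
      forall h, invertible h -> rnorm2 z <= rnorm2 (gact h z) - chi alpha h].
Proof.
move=> ss; have [K HK] := coercive ss.
pose psi g := rnorm2 (gact g x) - chi alpha g.
pose S := [set psi g | g in [set g | invertible g]].
have psi_ge g : invertible g -> rnorm2 (gact g x) / 2 - K <= psi g.
  by move=> /HK; rewrite /psi; lra.
have S_inf : has_inf S.
  split.
    exists (psi (fun v => 1%:M)); exists (fun v => 1%:M) => // v /=.
    exact: unitmx1.
  exists (- K) => _ [g /= gu <-]; apply: le_trans (psi_ge g gu).
  by have := rnorm2_ge0 (gact g x); lra.
have H (n : nat) : exists g, invertible g /\ psi g < inf S + n.+1%:R^-1.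
  have n0 : 0 < n.+1%:R^-1 :> R by rewrite invr_gt0.
  by have [_ [g gu <-] h] := inf_adherent n0 S_inf; exists g.
have [W HW] := choice H.
have Wu k : invertible (W k) by have [h _] := HW k; exact: h.
have [G [GU infG]] := ultraFilterLemma (eventually_filter : ProperFilter \oo).
have FG : Filter G by exact: _.
have h0 : (fun k : nat => k.+1%:R^-1 : R) @ G --> (0 : R).
  by apply: cvg_trans (@cvg_harmonic R) => A; exact: infG.
have [z Wz] : exists z, cvgrep (F := G) (fun k => gact (W k) x) z.
  apply: (@ultra_cvgrep _ G GU _ (2 * (inf S + 1 + K))); apply: filterE => k /=.
  have [_ h] := HW k; have h' := psi_ge _ (Wu k).
  have h2 : k.+1%:R^-1 <= 1 :> R by rewrite invf_le1// ler1n.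
  have {}h := lt_le_trans h (lerD (lexx _) h2); have {h} := le_lt_trans h' h.
  by rewrite /=; set r := rnorm2 _; lra.
exists z, W, G; split; [exact: GU|exact: Wu|exact: Wz|move=> h hu].
have lim1 : (fun k => rnorm2 (gact h (gact (W k) x)) - chi alpha h
    - rnorm2 (gact (W k) x) + (inf S + k.+1%:R^-1)) @ G -->
    rnorm2 (gact h z) - chi alpha h - rnorm2 z + (inf S + 0).
  apply: cvgD; last by apply: cvgD => //; exact: cvg_cstR.
  apply: cvgB; last exact: cvg_rnorm2.
  apply: cvgB; last exact: cvg_cstR.
  by apply: cvg_rnorm2; exact: gact_id_mul.
suff : inf S <= rnorm2 (gact h z) - chi alpha h - rnorm2 z + (inf S + 0) by lra.
have c : (fun _ : nat => inf S) @ G --> inf S by exact: cvg_cstR.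
refine (ler_limits (F := G) c lim1 _); apply: filterE => k /=.
rewrite (gactM _ hu (Wu k)).
apply: (@le_trans _ _ (psi (mulg h (W k)))); last first.
  have [_] := HW k; rewrite /psi (chiM _ hu (Wu k)).
  by set r1 := rnorm2 _; set r2 := rnorm2 _; set i1 := _^-1 => hk; lra.
apply: inf_lbound; first by case: S_inf.
by exists (mulg h (W k)) => //; apply: invertible_mul; [exact: hu|exact: Wu].
Qed.

Lemma minimum_diag_le alpha (z : rep) (u : ggauge) (phi : forall v, 'I_(d v) -> R) :
  unitary_gauge u ->
  (forall h, invertible h -> rnorm2 z <= rnorm2 (gact h z) - chi alpha h) ->
  tpair alpha phi <=
  \sum_e \sum_i \sum_j (phi (t e) i - phi (s e) j) * nsq (uact u z e i j).
Proof.
move=> uu zmin; set c := uact u z.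
pose del e i j := 2 * (phi (t e) i - phi (s e) j).
pose M := \sum_e \sum_i \sum_j `|del e i j| + 1.
have Md e i j : `|del e i j| <= M.
  rewrite ler_wpDr//; apply: le_trans (ler_sum1 e _); last first.
    by move=> e'; do 2![apply: sumr_ge0 => ? _].
  apply: le_trans (ler_sum1 i _); last by move=> i'; apply: sumr_ge0 => ? _.
  exact: (ler_sum1 j).
have M0 : 0 < M.
  by rewrite ltr_wpDl//; do 3![apply: sumr_ge0 => ? _].
have id_u : unitary_gauge (fun v => 1%:M : 'M[C]_(d v)).
  by move=> v; apply/unitarymxP; rewrite trmx1 map_mx1 mulmx1.
pose B := \sum_e \sum_i \sum_j 2 * del e i j ^+ 2 * nsq (c e i j).
set A := \sum_e _.
have rc : rnorm2 c = rnorm2 z by exact: (rnorm2_uact z uu).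
suff : 0 <= 2 * A - 2 * tpair alpha phi by lra.
apply: (@quadratic_bound_ge0 _ _ B (1 / (2 * M))); first by rewrite divr_gt0// mulr_gt0.
move=> tau tau0 tauM.
pose h := exp_gauge (fun v => 1%:M) (fun v i => tau * phi v i) u.
have hu : invertible h by exact: exp_gauge_invertible.
have := zmin h hu; rewrite chi_exp// rnorm2_exp// -/c.
have -> : tpair alpha (fun v i => tau * phi v i) = tau * tpair alpha phi.
  rewrite mulr_sumr; apply: eq_bigr => v _; rewrite mulr_sumr; apply: eq_bigr => i _.
  by rewrite mulrCA.
set N := \sum_e _ => zN.
suff : N <= rnorm2 z + tau * (2 * A) + tau ^+ 2 * B by move: zN; lra.
rewrite -rc /rnorm2 /A /B /N !mulr_sumr -!big_split; apply: ler_sum => e _ /=.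
rewrite !mulr_sumr -!big_split; apply: ler_sum => i _ /=.
rewrite !mulr_sumr -!big_split; apply: ler_sum => j _ /=.
have -> : expR (tau * phi (t e) i - tau * phi (s e) j) ^+ 2 = expR (tau * del e i j).
  by rewrite -expRM_natl; congr expR; rewrite /del; ring.
have hb : tau * del e i j <= 1 / 2.
  apply: (@le_trans _ _ (tau * M)).
    by rewrite ler_pM2l//; apply: le_trans (Md e i j); exact: ler_norm.
  by move: tauM; rewrite ler_pdivlMr ?mulr_gt0//; lra.
apply: le_trans (ler_wpM2r (nsq_ge0 _) (expR_le_quadratic hb)) _.
by rewrite le_eqVlt; apply/orP; left; apply/eqP; rewrite /del; ring.
Qed.

Lemma wmom_linear (z : rep) (a b : C) (xi eta : ggauge) :
  wmom z (fun v => a *: xi v + b *: eta v) = a * wmom z xi + b * wmom z eta.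
Proof.
rewrite !mulr_sumr -big_split; apply: eq_bigr => e _ /=.
rewrite !mulmxDl -!scalemxAl !linearD !linearZ /=.
by rewrite !mulrDr addrACA.
Qed.

Lemma minimum_level alpha (z : rep) :
  (forall h, invertible h -> rnorm2 z <= rnorm2 (gact h z) - chi alpha h) ->
  level alpha z.
Proof.
move=> zmin.
have diag u phi : unitary_gauge u ->
  tpair alpha phi =
  \sum_e \sum_i \sum_j (phi (t e) i - phi (s e) j) * nsq (uact u z e i j).
  move=> uu; apply/eqP; rewrite eq_le minimum_diag_le//=.
  have := @minimum_diag_le alpha z u (fun v i => - phi v i) uu zmin.
  have -> : tpair alpha (fun v i => - phi v i) = - tpair alpha phi.
    rewrite -sumrN; apply: eq_bigr => v _; rewrite -sumrN.
    by apply: eq_bigr => i _; rewrite mulrN.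
  rewrite lerNl; apply: le_trans; rewrite le_eqVlt; apply/orP; left; apply/eqP.
  rewrite -sumrN.
  apply: eq_bigr => e _; rewrite -sumrN; apply: eq_bigr => i _; rewrite -sumrN.
  by apply: eq_bigr => j _; ring.
have herm (xi : ggauge) : (forall v, (xi v)^t* = xi v) ->
    wmom z xi = \sum_v ofreal (alpha v) * \tr (xi v).
  move=> hxi.
  have dec v : {p : 'M[C]_(d v) * ('I_(d v) -> R) |
      p.1 \is unitarymx /\ xi v = p.1^t* *m rdiag p.2 *m p.1}.
    apply: cid; have [u [phi [h1 h2]]] := hermitian_spectral (hxi v).
    by exists (u, phi); split; [exact: h1|exact: h2].
  pose u v := (sval (dec v)).1; pose phi v := (sval (dec v)).2.
  have uu : unitary_gauge u by move=> v; have [h _] := svalP (dec v); exact: h.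
  have -> : xi = fun v => (u v)^t* *m dgauge phi v *m u v.
    apply: functional_extensionality_dep => v; have [_ h] := svalP (dec v); exact: h.
  rewrite -(wmom_uact _ _ uu) wmom_diag -(diag u phi uu) -tpairE.
  by apply: eq_bigr => v _; rewrite (trace_unitary_conj _ (uu v)).
move=> xi.
pose h1 : ggauge := fun v => xi v + (xi v)^t*.
pose h2 : ggauge := fun v => 'i *: (xi v - (xi v)^t*).
have hh1 v : (h1 v)^t* = h1 v.
  apply/matrixP => i j; rewrite !mxE rmorphD /= conjCK addrC.
  by [].
have hh2 v : (h2 v)^t* = h2 v.
  apply/matrixP => i j; rewrite !mxE rmorphM rmorphB /= conjCK conjCi.
  by rewrite mulNr -mulrN opprB.
have xiE : xi = fun v => 2^-1 *: (h1 v) + (- 'i / 2) *: h2 v.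
  apply: functional_extensionality_dep => v; apply/matrixP => i j.
  rewrite !mxE; set x := xi v i j; set y := (_^*)%R.
  have -> : - 'i / 2 * ('i * (x - y)) = - ('i ^+ 2) / 2 * (x - y) :> C by ring.
  by rewrite sqrCi; field.
rewrite xiE wmom_linear (herm h1 hh1) (herm h2 hh2) !mulr_sumr -big_split.
apply: eq_bigr => v _; rewrite trace_linear mulrDr.
by congr (_ + _); exact: mulrCA.
Qed.

(** Kempf-Ness existence *)
Theorem level_in_closure alpha (x : rep) : coord_semistable alpha x ->
  exists (z : rep) (W : nat -> ggauge) (G : set_system nat),
    [/\ UltraFilter G, forall k, invertible (W k),
      cvgrep (F := G) (fun k => gact (W k) x) z & level alpha z].
Proof.
move=> /minimum_in_closure[z [W [G [h1 h2 h3 h4]]]].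
by exists z, W, G; split=> //; exact: minimum_level.
Qed.

End Minimum.

Section RelativelyOpen.
Variables (T : topologicalType).

Lemma rel_open_near (A Z : set T) : A `<=` Z ->
  (forall p, A p -> \forall q \near p, Z q -> A q) ->
  exists2 O : set T, open O & A = Z `&` O.
Proof.
move=> AZ H; exists (interior [set q | Z q -> A q]); first exact: open_interior.
apply/seteqP; split=> [p Ap|p [Zp]]; first by split; [exact: AZ|exact: H].
by move=> /nbhs_singleton; apply.
Qed.

Lemma near_rel_open (A Z O : set T) : open O -> A = Z `&` O ->
  forall p, A p -> \forall q \near p, Z q -> A q.
Proof.
move=> oO -> p [_ Op]; have : nbhs p O by exact: open_nbhs_nbhs.
by apply: filterS => q Oq Zq; split.
Qed.
End RelativelyOpen.

Section IdentificationCriterion.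
Variable (C : numClosedFieldType).
Variables (V V' : normedModType C) (Z L I : set V) (K KC : V -> V -> Prop).
Variables (M : Type) (pres : V' -> M -> Prop) (valid ss : set M).
Variables (orb : M -> M -> Prop) (Phi : V -> M) (sg : V' -> V).

Definition in_orbit_closure (x z : V) : Prop :=
  forall B, nbhs z B -> exists2 q, B q & KC x q.

Hypothesis KC_refl : forall x, KC x x.
Hypothesis KC_sym : forall x y, KC x y -> KC y x.
Hypothesis KC_trans : forall x y z, KC x y -> KC y z -> KC x z.
Hypothesis K_refl : forall x, K x x.
Hypothesis K_sym : forall x y, K x y -> K y x.
Hypothesis K_trans : forall x y z, K x y -> K y z -> K x z.
Hypothesis K_KC : forall x y, K x y -> KC x y.
Hypothesis KC_cont : forall x y, KC x y ->
  exists phi : V -> V, [/\ phi x = y, continuous phi & forall x', KC x' (phi x')].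
Hypothesis L_I : L `<=` I.
Hypothesis L_closed : closed L.
Hypothesis I_Z : I `<=` Z.
Hypothesis I_open : forall p, I p -> \forall q \near p, Z q -> I q.
Hypothesis I_KC : forall x y, KC x y -> I x -> I y.
Hypothesis orb_refl : forall m, orb m m.
Hypothesis orb_sym : forall m m', orb m m' -> orb m' m.
Hypothesis orb_ss : forall m m', orb m m' -> ss m -> ss m'.
Hypothesis ss_valid : ss `<=` valid.
Hypothesis Phi_valid : forall x, I x -> valid (Phi x).
Hypothesis Phi_orb : forall x y, I x -> KC x y -> orb (Phi x) (Phi y).
Hypothesis Phi_orb_inv : forall x y, I x -> I y -> orb (Phi x) (Phi y) -> KC x y.
Hypothesis pres_ex : forall m, valid m -> exists v, pres v m.
Hypothesis pres_inj : forall v m m', valid m -> valid m' ->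
  pres v m -> pres v m' -> m = m'.
Hypothesis sg_I : forall v m, pres v m -> valid m -> I (sg v) /\ Phi (sg v) = m.
Hypothesis sg_diff : forall v m, pres v m -> valid m ->
  \forall q \near v, differentiable sg q.
Hypothesis frame : forall p v, I p -> pres v (Phi p) ->
  exists tau : V -> V', [/\ tau p = v, \forall q \near p, differentiable tau q &
    \forall q \near p, I q -> pres (tau q) (Phi q)].
Hypothesis L_ss : forall x, L x -> ss (Phi x).
Hypothesis ss_open : forall p, I p -> ss (Phi p) ->
  \forall q \near p, I q -> ss (Phi q).
Hypothesis kempf_ness : forall x, I x -> ss (Phi x) ->
  exists2 z, L z & in_orbit_closure x z.
Hypothesis separation : forall x y, L x -> L y ->
  (forall A B, nbhs x A -> nbhs y B -> exists x' y', [/\ A x', B y' & KC x' y']) ->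
  K x y.
Hypothesis properness : forall x0, I x0 -> exists2 B : set V, compact B &
  \forall x \near x0, forall z, L z -> in_orbit_closure x z -> B z.

Let Y := git_quotient pres valid ss orb.

Lemma sg_cont v m : pres v m -> valid m -> {for v, continuous sg}.
Proof.
by move=> pv vm; apply: differentiable_continuous; exact: nbhs_singleton (sg_diff pv vm).
Qed.

Lemma frame_cont p v : I p -> pres v (Phi p) ->
  exists tau : V -> V', [/\ tau p = v, {for p, continuous tau} &
    \forall q \near p, I q -> pres (tau q) (Phi q)].
Proof.
move=> Ip pv; have [tau [t1 t2 t3]] := frame Ip pv; exists tau; split=> //.
by apply: differentiable_continuous; exact: nbhs_singleton t2.
Qed.

Lemma lift m : valid m -> exists2 x, I x & Phi x = m.
Proof. by move=> vm; have [v pv] := pres_ex vm; have [] := sg_I pv vm; exists (sg v). Qed.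

Lemma closure_self x : in_orbit_closure x x.
Proof. by move=> B /nbhs_singleton Bx; exists x. Qed.

Lemma closure_trans x y z :
  in_orbit_closure x y -> in_orbit_closure y z -> in_orbit_closure x z.
Proof.
move=> xy yz B zB; have [oB [oO Oz] OB] : exists2 O, open_nbhs z O & O `<=` B.
  by have := zB; rewrite nbhsE.
have [q Oq yq] := yz oB (open_nbhs_nbhs (conj oO Oz)).
have [phi [py cphi Kphi]] := KC_cont yq.
have : nbhs y (phi @^-1` oB).
  by apply: cphi; rewrite py; apply: open_nbhs_nbhs.
move=> /xy[x' /= x'B xx']; exists (phi x'); first exact: OB.
exact: KC_trans xx' (Kphi _).
Qed.

Lemma closure_KC x y z : KC x y -> in_orbit_closure x z -> in_orbit_closure y z.
Proof.
by move=> xy xz B /xz[q Bq xq]; exists q => //; exact: KC_trans (KC_sym xy) xq.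
Qed.

Lemma closure_KC_r x y : KC x y -> in_orbit_closure x y.
Proof. by move=> xy B /nbhs_singleton By; exists y. Qed.

Lemma separation_closure x y z : L y -> L z ->
  in_orbit_closure x y -> in_orbit_closure x z -> K y z.
Proof.
move=> Ly Lz xy xz; apply: separation => // A B /xy[a Aa xa] /xz[b Bb xb].
by exists a, b; split=> //; exact: KC_trans (KC_sym xa) xb.
Qed.

Lemma presented_frame S U p tau : S `<=` valid -> rel_open pres S U -> I p -> U (Phi p) ->
  pres (tau p) (Phi p) -> {for p, continuous tau} ->
  (\forall q \near p, I q -> pres (tau q) (Phi q)) ->
  \forall q \near p, I q -> S (Phi q) -> U (Phi q).
Proof.
move=> Sv [US [ O oO UO]] Ip Up ptau ctau ntau.
have Ov : nbhs (tau p) O.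
  apply: open_nbhs_nbhs; split=> //.
  have : presented pres U (tau p) by exists (Phi p).
  by rewrite UO => -[].
have := ctau _ Ov; apply: filterS2 ntau => q h Oq Iq Sq.
have : presented pres U (tau q).
  by rewrite UO; split=> //; exists (Phi q) => //; exact: h.
move=> [m Um pm]; suff -> : Phi q = m by [].
by apply: (@pres_inj (tau q)); [exact: Sv|exact/Sv/US|exact: h|].
Qed.

Lemma near_Phi S U p : S `<=` valid -> rel_open pres S U -> I p -> U (Phi p) ->
  \forall q \near p, I q -> S (Phi q) -> U (Phi q).
Proof.
move=> Sv US Ip Up; have [v pv] := pres_ex (Phi_valid Ip).
have [tau [tp tc tn]] := frame_cont Ip pv.
by apply: (presented_frame Sv US Ip Up) tc tn; rewrite tp.
Qed.

Lemma orbit_closure_Phi x z : I x -> I z -> in_orbit_closure x z ->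
  orbit_closure pres valid orb (Phi x) (Phi z).
Proof.
move=> Ix Iz xz; split; first exact: Phi_valid.
move=> U oU Uz; have := near_Phi (fun _ h => h) oU Iz Uz.
move=> /xz[q qU xq]; have Iq := I_KC xq Ix.
by exists (Phi q); [exact: qU (Phi_valid _)|exact: Phi_orb].
Qed.

Lemma rel_open_presented (O : set V') : open O ->
  rel_open pres valid [set m | valid m /\ exists2 v, O v & pres v m].
Proof.
move=> oO; set U := [set m | _]; split; first by move=> m [].
apply: rel_open_near => [v [m [vm _] pm]|v' [m [vm [v Ov pv]] pm]]; first by exists m.
have [Ip pE] := sg_I pm vm.
have pv' : pres v (Phi (sg v')) by rewrite pE.
have [tau [tp tc tn]] := frame_cont Ip pv'.
have nO : nbhs (sg v') (tau @^-1` O).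
  by apply: tc; rewrite tp; exact: open_nbhs_nbhs.
have n1 : nbhs v' (sg @^-1` (tau @^-1` O)) by exact: (sg_cont pm vm nO).
have n2 : nbhs v' (sg @^-1` [set q | I q -> pres (tau q) (Phi q)]).
  exact: (sg_cont pm vm tn).
apply: filterS2 n1 n2 => q Oq hq [m'' vm'' pm''].
have [Iq qE] := sg_I pm'' vm''.
exists m'' => //; split=> //; exists (tau (sg q)) => //.
by rewrite -qE; exact: hq.
Qed.

Lemma in_closure_of_Phi x z : I x -> I z ->
  orbit_closure pres valid orb (Phi x) (Phi z) -> in_orbit_closure x z.
Proof.
move=> Ix Iz [_ H] B zB; have vz := Phi_valid Iz.
have [v0 pv0] := pres_ex vz; have [I1 E1] := sg_I pv0 vz.
have [phi [pz cphi Kphi]] : exists phi : V -> V,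
    [/\ phi (sg v0) = z, continuous phi & forall x', KC x' (phi x')].
  by apply: KC_cont; apply: Phi_orb_inv => //; rewrite E1.
have nB : nbhs v0 (sg @^-1` (phi @^-1` B)).
  by apply: (sg_cont pv0 vz); apply: cphi; rewrite pz.
have [ O [oO Ov0] OB] : exists2 O, open_nbhs v0 O & O `<=` sg @^-1` (phi @^-1` B).
  by have := nB; rewrite nbhsE.
have [y [vy [v Ov pv]] xy] := H _ (rel_open_presented oO)
  (conj vz (ex_intro2 _ _ v0 Ov0 pv0)).
have [Iv vE] := sg_I pv vy; exists (phi (sg v)); first exact: OB.
by apply: KC_trans (Kphi _); apply: Phi_orb_inv => //; rewrite vE.
Qed.

Lemma orb_eqv m m' : ss m -> orb m m' -> @eqv C Y m m'.
Proof.
move=> sm mm'; exists m; split=> //; split; try exact: ss_valid.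
  by move=> U _ Um; exists m.
by move=> U _ Um; exists m => //; exact: orb_sym.
Qed.

Lemma closure_eqv x z : I x -> L z -> in_orbit_closure x z ->
  @eqv C Y (Phi x) (Phi z).
Proof.
move=> Ix Lz xz; have Iz := L_I Lz; exists (Phi z); split; first exact: L_ss.
  exact: orbit_closure_Phi.
by apply: orbit_closure_Phi => //; exact: closure_self.
Qed.

Lemma eqv_level x y : I x -> I y -> @eqv C Y (Phi x) (Phi y) ->
  exists z, [/\ L z, in_orbit_closure x z & in_orbit_closure y z].
Proof.
move=> Ix Iy [m [sm xm ym]]; have [z Iz zm] := lift (ss_valid sm).
rewrite -zm in sm xm ym; have [z0 Lz0 zz0] := kempf_ness Iz sm.
exists z0; split=> //; apply: closure_trans zz0.
  exact: in_closure_of_Phi.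
exact: in_closure_of_Phi.
Qed.

Lemma level_eqv x y z : I x -> I y -> L z ->
  in_orbit_closure x z -> in_orbit_closure y z -> @eqv C Y (Phi x) (Phi y).
Proof.
move=> Ix Iy Lz xz yz; exists (Phi z); split; first exact: L_ss.
  by apply: orbit_closure_Phi => //; exact: L_I.
by apply: orbit_closure_Phi => //; exact: L_I.
Qed.

Lemma eqv_sym m m' : @eqv C Y m m' -> @eqv C Y m' m.
Proof. by move=> [z [a b c]]; exists z. Qed.

Lemma git_eqv_on : eqv_on Y.
Proof.
split.
- by move=> m sm; exact: orb_eqv.
- by move=> m m' _ _; exact: eqv_sym.
move=> m1 m2 m3 /ss_valid/lift[x Ix <-] /ss_valid/lift[y Iy <-] /ss_valid/lift[w Iw <-].
move=> /eqv_level[]// z [Lz xz yz] /eqv_level[]// z' [Lz' yz' wz'].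
apply: (level_eqv Ix Iw Lz xz).
apply: closure_trans wz' (closure_KC_r _); apply: K_KC.
exact: (separation_closure Lz' Lz yz' yz).
Qed.

Section Saturated.
Variable U : set M.
Hypothesis satU : @saturated C Y U.

Let pull : set V := L `&` Phi @^-1` U.

Let U_ss : U `<=` ss. Proof. exact: (proj1 satU). Qed.
Let U_eqv m m' : ss m' -> @eqv C Y m m' -> U m -> U m'.
Proof. by move=> sm' e Um; apply: ((proj2 satU) m) => //; exact: U_ss. Qed.

Lemma open_pull : rel_open pres ss U -> exists2 O : set V, open O & pull = L `&` O.
Proof.
move=> oU; apply: rel_open_near => [x []//|p [Lp Up]].
have := near_Phi ss_valid oU (L_I Lp) Up; apply: filterS => q h Lq.
by split=> //; apply: h; [exact: L_I|exact: L_ss].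
Qed.

Lemma pull_open : (exists2 O : set V, open O & pull = L `&` O) -> rel_open pres ss U.
Proof.
move=> [ O oO pO]; split=> //.
apply: rel_open_near => [v [m Um pm]|v0 [m0 Um0 pm0]].
  by exists m => //; exact: U_ss.
have sm0 := U_ss Um0; have vm0 := ss_valid sm0.
have [I0 E0] := sg_I pm0 vm0.
apply: contrapT => bad.
pose D := [set v | presented pres ss v /\ ~ presented pres U v].
pose F := within D (nbhs v0).
have PF : ProperFilter F.
  apply: Build_ProperFilter; rewrite /F /within /= => nD; apply: bad.
  apply: filterS nD => v hv sv; apply: contrapT => nUv.
  by apply: (hv) ; split.
have lim v : exists z, D v -> L z /\ in_orbit_closure (sg v) z.
  have [Dv|nD] := pselect (D v); last by exists 0.
  have [[m sm pm] _] := Dv; have [Iv vE] := sg_I pm (ss_valid sm).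
  have [z Lz vz] : exists2 z, L z & in_orbit_closure (sg v) z.
    by apply: kempf_ness => //; rewrite vE.
  by exists z.
have [zz zzP] := choice lim.
have nU v : D v -> ~ U (Phi (zz v)).
  move=> Dv; have [Lz vz] := zzP v Dv; have [[m sm pm] nUv] := Dv.
  have [Iv vE] := sg_I pm (ss_valid sm) => Uz; apply: nUv; exists m => //.
  rewrite -vE; apply: U_eqv Uz; first by rewrite vE.
  by apply: eqv_sym; exact: closure_eqv.
have [B cB nB] := properness I0.
have FB : F (zz @^-1` B).
  have : nbhs v0 (sg @^-1` [set x | forall z, L z -> in_orbit_closure x z -> B z]).
    exact: (sg_cont pm0 vm0 nB).
  rewrite /F /within; apply: filterS => v hB Dv.
  by have [Lz vz] := zzP v Dv; exact: hB.
have [y [By cly]] := cB (zz @ F) _ FB.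
have FD : F D by rewrite /F /within /=; apply: filterE.
have Ly : L y.
  apply: L_closed => N yN; apply: cly yN; rewrite /fmap /=.
  by apply: filterS FD => v Dv; have [] := zzP v Dv.
have nOy : ~ O y.
  move=> Oy; have yO : nbhs y O by exact: open_nbhs_nbhs.
  have : (zz @ F) (L `&` ~` O).
    apply: filterS FD => v Dv; have [Lz vz] := zzP v Dv; split=> // Oz.
    have : (L `&` O) (zz v) by [].
    by rewrite -pO => -[_]; exact: nU.
  by move=> /cly/(_ yO)[z [[_ ]]].
have [x Lx v0x] : exists2 z, L z & in_orbit_closure (sg v0) z.
  by apply: kempf_ness => //; rewrite E0.
have Kxy : K x y.
  apply: separation => // A B' nA nB'.
  have [q Aq v0q] : exists2 q, interior A q & KC (sg v0) q.
    by apply: v0x; exact: nbhs_interior.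
  have [phi [pq cphi Kphi]] := KC_cont v0q.
  have nv : nbhs v0 (sg @^-1` (phi @^-1` A)).
    by apply: (sg_cont pm0 vm0); apply: cphi; rewrite pq.
  have Fv : (zz @ F) (zz @` (D `&` sg @^-1` (phi @^-1` A))).
    rewrite /fmap /F /within /=; apply: filterS nv => v Av Dv.
    by exists v.
  have [z [[v [Dv Av] <-] B'z]] := cly _ _ Fv (nbhs_interior nB').
  have [Lz vz] := zzP v Dv; have [q' Bq' vq'] := vz _ B'z.
  exists (phi (sg v)), q'; split=> //.
  exact: KC_trans (KC_sym (Kphi _)) vq'.
have Lx' := L_ss Lx; have Ux : U (Phi x).
  apply: (U_eqv Lx' _ Um0); rewrite -E0; exact: closure_eqv.
apply: nOy; suff : pull y by rewrite pO => -[].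
split=> //; apply: (U_eqv (L_ss Ly) _ Ux); apply: orb_eqv => //.
by apply: Phi_orb; [exact: L_I|exact: K_KC].
Qed.

Hypothesis openU : rel_open pres ss U.
Variable f : M -> C.
Hypothesis invf : @invariant_on C Y U f.

Lemma hol_git_level :
  @hol C Y U f -> @hol C (level_quotient Z L K KC) pull (f \o Phi).
Proof.
move=> [F [Ff holF]]; pose W : set V := I `&` Phi @^-1` U.
exists W, (f \o Phi); split.
- apply: rel_open_near => [x [/I_Z]//|p [Ip Up]].
  have h1 := near_Phi ss_valid openU Ip Up.
  have h2 := ss_open Ip (U_ss Up).
  apply: filterS (filterI (I_open Ip) (filterI h1 h2)) => q [hI [hU hs]] Zq.
  have Iq := hI Zq; split=> //; apply: hU => //; exact: hs.
- move=> x y [Ix Ux] xy; have Iy := I_KC xy Ix.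
  have o := Phi_orb Ix xy; have e := orb_eqv (U_ss Ux) o.
  have Uy : U (Phi y) by apply: (U_eqv _ e Ux); exact: orb_ss o (U_ss Ux).
  by split=> //=; rewrite (invf Ux Uy e).
- apply/seteqP; split=> [x [[Ix Ux] Lx]//|x [Lx Ux]].
  by split=> //; split=> //; exact: L_I.
- move=> p [Ip Up]; have [v pv] := pres_ex (Phi_valid Ip).
  have [tau [tp td tn]] := frame Ip pv.
  have ctau : {for p, continuous tau}.
    by apply: differentiable_continuous; exact: nbhs_singleton td.
  have [G [dG FG]] : exists G : V' -> C, (\forall q \near v, differentiable G q) /\
      (\forall q \near v, presented pres U q -> F q = G q).
    by apply: holF; exists (Phi p).
  exists (G \o tau); split.
    have n1 : nbhs p (tau @^-1` [set q | differentiable G q]).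
      by apply: ctau; rewrite tp.
    apply: filterS2 td n1 => q dt dg; exact: differentiable_comp.
  have n1 : nbhs p (tau @^-1` [set q | presented pres U q -> F q = G q]).
    by apply: ctau; rewrite tp.
  apply: filterS2 tn n1 => q pq hq [Iq Uq] /=.
  rewrite -hq; last by exists (Phi q) => //; exact: pq.
  by rewrite (Ff _ (Phi q))//; exact: pq.
- by [].
Qed.

Lemma hol_level_git :
  @hol C (level_quotient Z L K KC) pull (f \o Phi) -> @hol C Y U f.
Proof.
move=> [W [F [[ O oO WO] KF WL holF Ff]]].
have key x : I x -> U (Phi x) -> W x /\ F x = f (Phi x).
  move=> Ix Ux; have [z Lz xz] := kempf_ness Ix (U_ss Ux).
  have e := closure_eqv Ix Lz xz; have Uz := U_eqv (L_ss Lz) e Ux.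
  have pz : pull z by [].
  have [Wz _] : (W `&` L) z by rewrite WL.
  have [G [dG FG]] := holF z Wz.
  have Oz : nbhs z O.
    by apply: open_nbhs_nbhs; split=> //; move: Wz; rewrite WO => -[].
  have KO q : KC x q -> O q -> [/\ W x, W q & F q = F x].
    move=> xq Oq; have Iq := I_KC xq Ix.
    have Wq : W q by rewrite WO; split=> //; exact: I_Z.
    by have [Wx ->] := KF _ _ Wq (KC_sym xq).
  have [q0 Oq0 xq0] := xz _ Oz; have [Wx _ _] := KO _ xq0 Oq0.
  split=> //; rewrite (invf Ux Uz e) -[RHS]Ff//.
  have Gz : F z = G z by have := nbhs_singleton FG; exact.
  rewrite Gz; have cG : {for z, continuous G}.
    by apply: differentiable_continuous; exact: nbhs_singleton dG.
  apply/eqP; rewrite -subr_eq0 -normr_eq0; apply: contraT => n0.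
  have e0 : 0 < `|F x - G z| by rewrite lt0r n0 normr_ge0.
  have nG : nbhs z [set q | `|G z - G q| < `|F x - G z|].
    by have /cvgrPdist_lt/(_ _ e0) := cG.
  have [q [[hq Gq] Oq] xq] := xz _ (filterI (filterI FG nG) Oz).
  have [_ Wq Fq] := KO _ xq Oq.
  by move: Gq; rewrite /= -(hq Wq) Fq distrC ltxx.
exists (F \o sg); split=> [v m Um pm|v [m Um pm]] /=.
  have [Iv vE] := sg_I pm (ss_valid (U_ss Um)).
  have Uv : U (Phi (sg v)) by rewrite vE.
  by have [_ ->] := key _ Iv Uv; rewrite vE.
have [Iv vE] := sg_I pm (ss_valid (U_ss Um)).
have Uv : U (Phi (sg v)) by rewrite vE.
have [Wv _] := key _ Iv Uv; have [G [dG FG]] := holF _ Wv.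
have vm := ss_valid (U_ss Um); have cs := sg_cont pm vm.
exists (G \o sg); split.
  have n1 : nbhs v (sg @^-1` [set q | differentiable G q]) by exact: (cs _ dG).
  by apply: filterS2 (sg_diff pm vm) n1 => q ds dg; exact: differentiable_comp.
have n1 : nbhs v (sg @^-1` [set q | W q -> F q = G q]) by exact: (cs _ FG).
apply: filterS n1 => q hq [m' Um' pm'] /=; apply: hq.
have [Iq qE] := sg_I pm' (ss_valid (U_ss Um')).
have Uq : U (Phi (sg q)) by rewrite qE.
by have [] := key _ Iq Uq.
Qed.

End Saturated.

Theorem identification_criterion : identifies (X := level_quotient Z L K KC) (Y := Y) Phi.
Proof.
split.
- split; last exact: git_eqv_on.
  by split=> [x _|x y _ _|x y z _ _ _]; [exact: K_refl|exact: K_sym|exact: K_trans].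
- by move=> x; exact: L_ss.
- move=> x x' Lx Lx'; split=> [xx'|/eqv_level[]]; try exact: L_I.
    by apply: orb_eqv; [exact: L_ss|apply: Phi_orb; [exact: L_I|exact: K_KC]].
  move=> z [Lz xz x'z]; apply: (@K_trans _ z).
    exact (separation_closure Lx Lz (@closure_self x) xz).
  apply: K_sym; exact (separation_closure Lx' Lz (@closure_self x') x'z).
- move=> m sm; have [x Ix xE] := lift (ss_valid sm); rewrite -xE in sm *.
  have [z Lz xz] := kempf_ness Ix sm; exists z => //.
  by apply: eqv_sym; exact: closure_eqv.
move=> U satU; split; first by split; [exact: open_pull|exact: pull_open].
by move=> oU f invf; split; [exact: hol_git_level|exact: hol_level_git].
Qed.
End IdentificationCriterion.

Section RealIntegral.
Variable R : realType.

Lemma antiderivative_right (f : R -> R) (a : R) : continuous f ->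
  exists F : R -> R, forall x : R, a < x -> is_derive x 1 F (f x).
Proof.
move=> cf; exists (fun x => (\int[@lebesgue_measure R]_(t in `[a, x]) f t)%R) => x ax.
have xx : x < x + 1 by rewrite ltrDl.
have [|d1 d2] := @continuous_FTC1_closed R f a x (x + 1) xx _ ax (cf x).
  apply: continuous_compact_integrable; first exact: segment_compact.
  exact: continuous_subspaceT.
apply: DeriveDef; first exact: d1.
by rewrite -derive1E.
Qed.

Lemma antiderivative (f : R -> R) : continuous f ->
  exists F : R -> R, forall x : R, is_derive x 1 F (f x).
Proof.
move=> cf; have [G HG] := antiderivative_right (-1) cf.
have cf' : continuous (fun x => f (- x)).
  by move=> x; apply: continuous_comp; [exact: opp_continuous|exact: cf].
have [H HH] := antiderivative_right (-1) cf'.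
pose H' x := - H (- x).
have dH' (x : R) : x < 1 -> is_derive x 1 H' (f x).
  move=> x1; have dH : is_derive (- x) 1 H (f (- - x)) by apply: HH; rewrite ltrN2.
  rewrite opprK in dH.
  have dn : is_derive x 1 (fun y : R => - y) (- 1) by exact: is_deriveNid.
  have := @is_derive1_comp R H (fun y => - y) x (f x) (-1) dH dn.
  by move=> /is_deriveN; rewrite mulrN1 opprK.
pose c := G 0 - H' 0.
have dK (x : R) : -1 < x -> x < 1 -> is_derive x 1 (fun y => G y - H' y) (0 : R).
  move=> x0 x1; rewrite -(subrr (f x)); apply: is_deriveB; [exact: HG|exact: dH'].
have eqGH (x y : R) : -1 < x -> y < 1 -> x <= y -> G x - H' x = G y - H' y.
  move=> x0 y1 xy; apply/esym/eqP; rewrite -subr_eq0; apply/eqP.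
  have [||z _ ->] := @MVT_segment R (fun y => G y - H' y) (fun=> 0) x y xy; last by rewrite mul0r.
    move=> z; rewrite in_itv /= => /andP[xz zy].
    by apply: dK; [exact: lt_trans xz|exact: lt_trans y1].
  apply: derivable_within_continuous => z; rewrite in_itv /= => /andP[xz zy].
  by have [] := dK z (lt_le_trans x0 xz) (le_lt_trans zy y1).
have eqc (x : R) : -1 < x -> x < 1 -> H' x + c = G x.
  move=> x0 x1; suff : G x - H' x = c by move=> <-; rewrite addrC subrK.
  have [x0'|x0'] := leP x 0; first exact: eqGH.
  by apply/esym; apply: eqGH => //; exact: ltW.
exists (fun x => if x < 0 then H' x + c else G x) => x.
have [x0|x0] := ltP x 0.
  have d1 : is_derive x 1 (fun y => H' y + c) (f x).
    rewrite -[f x]addr0; apply: is_deriveD; first by apply: dH'; lra.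
  apply: near_eq_is_derive d1 => //.
  near=> y; suff -> : y < 0 by [].
  by near: y; exact: lt_nbhsl.
have d1 : is_derive x 1 G (f x) by apply: HG; lra.
apply: near_eq_is_derive d1 => //; near=> y; case: ifPn => // y0.
apply/esym; apply: eqc; last by lra.
by near: y; apply: lt_nbhsr; lra.
Unshelve. all: by end_near.
Qed.

Definition prim (f : R -> R) : R -> R :=
  if pselect (continuous f) is left cf then sval (cid (antiderivative cf)) else f.

Lemma primP (f : R -> R) : continuous f -> forall x : R, is_derive x 1 (prim f) (f x).
Proof. by rewrite /prim; case: pselect => // cf _; case: cid. Qed.

Definition rint (f : R -> R) (a b : R) : R := prim f b - prim f a.

Lemma rint_prim (f F : R -> R) a b : continuous f ->
  (forall x : R, is_derive x 1 F (f x)) -> rint f a b = F b - F a.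
Proof.
move=> cf dF; pose h x := prim f x - F x.
have : h b = h a.
  apply: (@is_derive_0_is_cst R h b a) => x; rewrite -(subrr (f x)).
  by have d1 := primP cf x; have d2 := dF x; exact: is_deriveB.
by rewrite /rint /h; lra.
Qed.

Lemma rint_split (f : R -> R) a b c : rint f a c = rint f a b + rint f b c.
Proof. by rewrite /rint; lra. Qed.

Lemma rint_same (f : R -> R) a : rint f a a = 0.
Proof. by rewrite /rint subrr. Qed.

Lemma rint_mean (f : R -> R) a b : continuous f -> a <= b ->
  exists2 c, a <= c <= b & rint f a b = f c * (b - a).
Proof.
move=> cf ab; have [|c] := @MVT_segment R (prim f) f a b ab (fun x _ => primP cf x).
  by apply: derivable_within_continuous => z _; have [] := primP cf z.
by rewrite in_itv /= => cab e; exists c.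
Qed.

Lemma rint_linear (k l : R) (f g : R -> R) a b : continuous f -> continuous g ->
  rint (fun x => k * f x + l * g x) a b = k * rint f a b + l * rint g a b.
Proof.
move=> cf cg; have cfg : continuous (fun x => k * f x + l * g x).
  by move=> x; apply: cvgD; apply: cvgM; try exact: cvg_cst; [exact: cf|exact: cg].
have d (x : R) : is_derive x 1 (fun x => k * prim f x + l * prim g x) (k * f x + l * g x).
  have d1 := primP cf x; have d2 := primP cg x.
  exact: (@is_deriveD _ _ _ (k \*: prim f) (l \*: prim g)).
by rewrite (rint_prim a b cfg d) /rint; lra.
Qed.

End RealIntegral.

Section ComplexIntegral.
Variable R : realType.
Local Notation C := (Cplx R).

Definition ccont (phi : R -> C) :=
  continuous (fun t => re (phi t)) /\ continuous (fun t => im (phi t)).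

Definition cint (phi : R -> C) (a b : R) : C :=
  mkc (rint (fun t => re (phi t)) a b) (rint (fun t => im (phi t)) a b).

Lemma cint_split phi a b c : cint phi a c = cint phi a b + cint phi b c.
Proof.
by apply: ceq; rewrite ?raddfD /= ?re_mkc ?im_mkc; exact: rint_split.
Qed.

Lemma cint_same phi a : cint phi a a = 0.
Proof. by rewrite /cint !rint_same; apply: ceq; rewrite ?re_mkc ?im_mkc ?raddf0. Qed.

Lemma rint_ext (f g : R -> R) a b : (forall x, f x = g x) -> rint f a b = rint g a b.
Proof. by move=> fg; have -> : f = g by apply/funext. Qed.

Lemma cont_lin (k l : R) (f g : R -> R) : continuous f -> continuous g ->
  continuous (fun x => k * f x + l * g x).
Proof.
by move=> cf cg x; apply: cvgD; apply: cvgM; try exact: cvg_cst; [exact: cf|exact: cg].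
Qed.

Lemma re_lin (c e z w : C) : re (c * z + e * w) =
  1 * (re c * re z + (- im c) * im z) + 1 * (re e * re w + (- im e) * im w).
Proof. by rewrite raddfD /= !reM; ring. Qed.

Lemma im_lin (c e z w : C) : im (c * z + e * w) =
  1 * (re c * im z + im c * re z) + 1 * (re e * im w + im e * re w).
Proof. by rewrite raddfD /= !imM; ring. Qed.

Lemma ccont_lin c e phi psi : ccont phi -> ccont psi ->
  ccont (fun t => c * phi t + e * psi t).
Proof.
move=> [h1 h2] [h3 h4]; split.
  have h := @cont_lin 1 1 _ _ (@cont_lin (re c) (- im c) _ _ h1 h2)
    (@cont_lin (re e) (- im e) _ _ h3 h4).
  have eq : (fun t => re (c * phi t + e * psi t)) = _ := funext (fun t => re_lin c e _ _).
  by rewrite eq; exact: h.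
have h := @cont_lin 1 1 _ _ (@cont_lin (re c) (im c) _ _ h2 h1)
  (@cont_lin (re e) (im e) _ _ h4 h3).
have eq : (fun t => im (c * phi t + e * psi t)) = _ := funext (fun t => im_lin c e _ _).
  by rewrite eq; exact: h.
Qed.

Lemma cint_lin c e phi psi a b : ccont phi -> ccont psi ->
  cint (fun t => c * phi t + e * psi t) a b = c * cint phi a b + e * cint psi a b.
Proof.
move=> [h1 h2] [h3 h4]; apply: ceq; rewrite ?re_lin ?im_lin ?re_mkc ?im_mkc.
  rewrite (rint_ext _ _ (fun t => re_lin _ _ _ _)).
  by rewrite !rint_linear//; exact: cont_lin.
rewrite (rint_ext _ _ (fun t => im_lin _ _ _ _)).
by rewrite !rint_linear//; exact: cont_lin.
Qed.

Lemma rint_affine (k l a b : R) :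
  rint (fun t => k + l * t) a b = k * (b - a) + l * (b ^+ 2 - a ^+ 2) / 2.
Proof.
have c : continuous (fun t : R => k + l * t).
  by move=> t; apply: cvgD; [exact: cvg_cst|apply: cvgM; [exact: cvg_cst|exact: cvg_id]].
have d (x : R) : is_derive x 1 (fun t => k * t + (l / 2) * (t * t)) (k + l * x).
  have d2 : is_derive x 1 (fun t : R => t * t) (x *: (1 : R) + x *: (1 : R)).
    exact: (@is_deriveM _ _ id id).
  have d3 : is_derive x 1 ((l / 2) \*: (fun t : R => t * t)) ((l / 2) *: (x *: (1 : R) + x *: (1 : R))).
    exact: is_deriveZ.
  have d1 : is_derive x 1 (k \*: @id R) (k *: (1 : R)) by exact: is_deriveZ.
  have e : k + l * x = k *: (1 : R) + (l / 2) *: (x *: (1 : R) + x *: (1 : R)).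
    by rewrite /GRing.scale /= !mulr1; field.
  by rewrite e; exact: (is_deriveD d1 d3).
by rewrite (rint_prim a b c d); field.
Qed.

Definition bnd (M : R) (z : C) := `|re z| <= M /\ `|im z| <= M.

Lemma bndD M N z w : bnd M z -> bnd N w -> bnd (M + N) (z + w).
Proof.
by move=> [h1 h2] [h3 h4]; split; rewrite raddfD /= (le_trans (ler_normD _ _))// lerD.
Qed.
Lemma bndN M z : bnd M z -> bnd M (- z).
Proof. by move=> [h1 h2]; split; rewrite raddfN /= normrN. Qed.
Lemma bndM M N z w : bnd M z -> bnd N w -> bnd (2 * (M * N)) (z * w).
Proof.
move=> [h1 h2] [h3 h4]; have -> : 2 * (M * N) = M * N + M * N by ring.
by split; rewrite ?reM ?imM; [apply: le_trans (ler_normB _ _) _|apply: le_trans (ler_normD _ _) _];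
  rewrite !normrM lerD// ler_pM.
Qed.
Lemma bnd_norm z : bnd (Num.sqrt (nsq z)) z.
Proof. by split; [exact: re_le|exact: im_le]. Qed.
Lemma bnd_le M N z : M <= N -> bnd M z -> bnd N z.
Proof. by move=> MN [h1 h2]; split; apply: le_trans MN. Qed.
Lemma bnd_iC M z : bnd M z -> bnd M (mkc 0 1 * z).
Proof.
move=> [h1 h2]; split; rewrite ?reM ?imM re_mkc im_mkc !mul0r mul1r.
  by rewrite sub0r normrN.
by rewrite add0r.
Qed.

Lemma cint_bnd phi a b M : ccont phi -> a <= b ->
  (forall t, a <= t <= b -> bnd M (phi t)) -> bnd (M * (b - a)) (cint phi a b).
Proof.
move=> [h1 h2] ab H; have ba : 0 <= b - a by rewrite subr_ge0.
split; rewrite ?re_mkc ?im_mkc.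
  have [c /H[hc _] ->] := rint_mean h1 ab.
  by rewrite normrM (ger0_norm ba) ler_wpM2r.
have [c /H[_ hc] ->] := rint_mean h2 ab.
by rewrite normrM (ger0_norm ba) ler_wpM2r.
Qed.

Definition RI (f : C -> C) (x0 x1 y0 y1 : R) : C :=
  cint (fun t => f (mkc t y0)) x0 x1 + mkc 0 1 * cint (fun t => f (mkc x1 t)) y0 y1
  - cint (fun t => f (mkc t y1)) x0 x1 - mkc 0 1 * cint (fun t => f (mkc x0 t)) y0 y1.

Lemma RI_splitx f x0 xm x1 y0 y1 :
  RI f x0 x1 y0 y1 = RI f x0 xm y0 y1 + RI f xm x1 y0 y1.
Proof. by rewrite /RI !(cint_split _ x0 xm x1); ring. Qed.
Lemma RI_splity f x0 x1 y0 ym y1 :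
  RI f x0 x1 y0 y1 = RI f x0 x1 y0 ym + RI f x0 x1 ym y1.
Proof. by rewrite /RI !(cint_split _ y0 ym y1); ring. Qed.
Lemma RI_flatx f x y0 y1 : RI f x x y0 y1 = 0.
Proof. by rewrite /RI !cint_same; ring. Qed.
Lemma RI_flaty f x0 x1 y : RI f x0 x1 y y = 0.
Proof. by rewrite /RI !cint_same; ring. Qed.

Lemma ccont_h (f : C -> C) y : continuous f -> ccont (fun t => f (mkc t y)).
Proof.
move=> cf; have c t : (fun t => f (mkc t y)) @ t --> f (mkc t y).
  apply: continuous_cvg; first exact: cf.
  apply: cvgC_reim; last by rewrite im_mkc; exact: cvg_cst.
  by rewrite re_mkc; exact: cvg_id.
by split=> t; [exact: cvgC_re (c t)|exact: cvgC_im (c t)].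
Qed.
Lemma ccont_v (f : C -> C) x : continuous f -> ccont (fun t => f (mkc x t)).
Proof.
move=> cf; have c t : (fun t => f (mkc x t)) @ t --> f (mkc x t).
  apply: continuous_cvg; first exact: cf.
  apply: cvgC_reim; first by rewrite re_mkc; exact: cvg_cst.
  by rewrite im_mkc; exact: cvg_id.
by split=> t; [exact: cvgC_re (c t)|exact: cvgC_im (c t)].
Qed.

Definition ccont_sides (f : C -> C) x0 x1 y0 y1 :=
  [/\ ccont (fun t => f (mkc t y0)), ccont (fun t => f (mkc x1 t)),
      ccont (fun t => f (mkc t y1)) & ccont (fun t => f (mkc x0 t))].

Lemma ccont_sidesW (f : C -> C) x0 x1 y0 y1 : continuous f -> ccont_sides f x0 x1 y0 y1.
Proof. by move=> cf; split; first [exact: ccont_h|exact: ccont_v]. Qed.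

Lemma RI_lin c e (f g : C -> C) x0 x1 y0 y1 :
  ccont_sides f x0 x1 y0 y1 -> ccont_sides g x0 x1 y0 y1 ->
  RI (fun z => c * f z + e * g z) x0 x1 y0 y1 = c * RI f x0 x1 y0 y1 + e * RI g x0 x1 y0 y1.
Proof.
move=> [f1 f2 f3 f4] [g1 g2 g3 g4]; rewrite /RI.
rewrite (cint_lin c e _ _ f1 g1) (cint_lin c e _ _ f2 g2).
rewrite (cint_lin c e _ _ f3 g3) (cint_lin c e _ _ f4 g4); ring.
Qed.

Lemma RI_affine c0 c1 x0 x1 y0 y1 : RI (fun z => c0 + c1 * z) x0 x1 y0 y1 = 0.
Proof.
have h y : cint (fun t => c0 + c1 * mkc t y) x0 x1 =
  mkc ((re c0 - im c1 * y) * (x1 - x0) + re c1 * (x1 ^+ 2 - x0 ^+ 2) / 2)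
      ((im c0 + re c1 * y) * (x1 - x0) + im c1 * (x1 ^+ 2 - x0 ^+ 2) / 2).
  by apply: ceq; rewrite ?re_mkc ?im_mkc -rint_affine; apply: rint_ext => t;
    rewrite raddfD /= ?reM ?imM re_mkc im_mkc; ring.
have v x : cint (fun t => c0 + c1 * mkc x t) y0 y1 =
  mkc ((re c0 + re c1 * x) * (y1 - y0) + (- im c1) * (y1 ^+ 2 - y0 ^+ 2) / 2)
      ((im c0 + im c1 * x) * (y1 - y0) + re c1 * (y1 ^+ 2 - y0 ^+ 2) / 2).
  by apply: ceq; rewrite ?re_mkc ?im_mkc -rint_affine; apply: rint_ext => t;
    rewrite raddfD /= ?reM ?imM re_mkc im_mkc; ring.
rewrite /RI !h !v; apply: ceq; rewrite [RHS]raddf0 !(raddfB, raddfD) /= ?(reM, imM) !(re_mkc, im_mkc); ring.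
Qed.

Lemma RI_bnd (f : C -> C) x0 x1 y0 y1 M : ccont_sides f x0 x1 y0 y1 ->
  x0 <= x1 -> y0 <= y1 ->
  (forall t, x0 <= t <= x1 -> bnd M (f (mkc t y0)) /\ bnd M (f (mkc t y1))) ->
  (forall t, y0 <= t <= y1 -> bnd M (f (mkc x0 t)) /\ bnd M (f (mkc x1 t))) ->
  bnd (2 * M * ((x1 - x0) + (y1 - y0))) (RI f x0 x1 y0 y1).
Proof.
move=> [f1 f2 f3 f4] x01 y01 H H'.
have -> : 2 * M * ((x1 - x0) + (y1 - y0)) = M * (x1 - x0) + M * (y1 - y0) +
  M * (x1 - x0) + M * (y1 - y0) by ring.
apply: bndD; last apply: bndN; [apply: bndD; last apply: bndN; [apply: bndD|]|];
  rewrite ?/RI; try apply: bnd_iC; apply: cint_bnd => // t ht;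
  by [have [] := H t ht|have [] := H' t ht].
Qed.

End ComplexIntegral.

Section Goursat.
Variable R : realType.
Local Notation C := (Cplx R).

Lemma small_half_power (w del : R) : 0 <= w -> 0 < del -> exists k, w * (1 / 2) ^+ k < del.
Proof.
move=> w0 del0; pose k := Num.bound (w / del); exists k.
have h : w / del < k%:R by apply: archi_boundP; rewrite divr_ge0// ltW.
have h2 : (k%:R : R) <= 2 ^+ k by rewrite -natrX ler_nat ltnW// ltn_expl.
have h3 : w < del * 2 ^+ k.
  by rewrite mulrC -ltr_pdivrMr//; apply: lt_le_trans h h2.
by rewrite expr_div_n expr1n mulrA mulr1 ltr_pdivrMr// exprn_gt0.
Qed.

Record rect := Rect { rx0 : R; rx1 : R; ry0 : R; ry1 : R }.

Definition subrect (q q' : rect) :=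
  [/\ rx0 q' <= rx0 q, rx1 q <= rx1 q', ry0 q' <= ry0 q & ry1 q <= ry1 q'].
Definition nonneg_rect q := rx0 q <= rx1 q /\ ry0 q <= ry1 q.

Definition halves (q q' : rect) :=
  [/\ nonneg_rect q', subrect q' q,
    rx1 q' - rx0 q' = (rx1 q - rx0 q) * (1 / 2) &
    ry1 q' - ry0 q' = (ry1 q - ry0 q) * (1 / 2)].

Lemma bisection (P : rect -> Prop) :
  (forall x0 x1 y0 y1, x0 <= x1 -> y0 <= y1 ->
    let xm := (x0 + x1) / 2 in let ym := (y0 + y1) / 2 in
    P (Rect x0 xm y0 ym) -> P (Rect xm x1 y0 ym) ->
    P (Rect x0 xm ym y1) -> P (Rect xm x1 ym y1) -> P (Rect x0 x1 y0 y1)) ->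
  forall Q, nonneg_rect Q ->
  (forall px py, rx0 Q <= px <= rx1 Q -> ry0 Q <= py <= ry1 Q ->
    exists2 del, 0 < del & forall q, nonneg_rect q -> rx0 q <= px <= rx1 q ->
      ry0 q <= py <= ry1 q -> rx1 q - rx0 q < del -> ry1 q - ry0 q < del -> P q) ->
  P Q.
Proof.
move=> comb Q nQ loc; apply: contrapT => nPQ.
have step q : exists q', nonneg_rect q -> ~ P q -> ~ P q' /\ halves q q'.
  have [[nq nP]|nn] := pselect (nonneg_rect q /\ ~ P q); last by exists q => h1 h2; case: nn.
  apply: contrapT => H; apply: nP; case: q nq H => x0 x1 y0 y1 [/= hx hy] H.
  by apply: comb => //=; apply: contrapT => h; apply: H; eexists => _ _;
    (split; first exact: h); rewrite /halves /nonneg_rect /subrect /=;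
    (split; try split); lra.
have [f Hf] := choice step; pose q k := iter k f Q.
have inv k : nonneg_rect (q k) /\ ~ P (q k).
  by elim: k => [//|k [h1 h2]]; have [h3 [h4 _ _ _]] := Hf _ h1 h2.
have qS k := Hf _ (proj1 (inv k)) (proj2 (inv k)).
have wx k : rx1 (q k) - rx0 (q k) = (rx1 Q - rx0 Q) * (1 / 2) ^+ k.
  elim: k => [|k IH]; first by rewrite expr0 mulr1.
  have [_ [_ _ e _]] := qS k; rewrite -[q k.+1]/(f (q k)).
  by rewrite e IH -mulrA -exprSr.
have wy k : ry1 (q k) - ry0 (q k) = (ry1 Q - ry0 Q) * (1 / 2) ^+ k.
  elim: k => [|k IH]; first by rewrite expr0 mulr1.
  have [_ [_ _ _ e]] := qS k; rewrite -[q k.+1]/(f (q k)).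
  by rewrite e IH -mulrA -exprSr.
have mono j k : (j <= k)%N -> subrect (q k) (q j).
  elim: k => [|k IH]; first by rewrite leqn0 => /eqP ->; split; exact: lexx.
  rewrite leq_eqVlt => /orP[/eqP ->|]; first by split; exact: lexx.
  rewrite ltnS => /IH[a b c e]; have [_ [_ [a' b' c' e'] _ _]] := qS k.
  by split; [exact: le_trans a a'|exact: le_trans b' b|exact: le_trans c c'|exact: le_trans e' e].
have point (u v : rect -> R) : (forall k, u (q k) <= v (q k)) ->
    (forall j k, (j <= k)%N -> u (q j) <= u (q k) /\ v (q k) <= v (q j)) ->
    exists p, forall k, u (q k) <= p <= v (q k).
  move=> uv mon; have uvjk j k : u (q j) <= v (q k).
    have [jk|kj] := leqP j k; first by apply: le_trans (uv k); have [] := mon _ _ jk.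
    by apply: le_trans (uv j) _; have [] := mon _ _ (ltnW kj).
  exists (sup (range (fun k => u (q k)))) => k.
  apply/andP; split.
    by apply: ub_le_sup; [exists (v (q 0%N)) => _ [j _ <-]|exists k].
  by apply: ge_sup; [exists (u (q 0%N)), 0%N|move=> _ [j _ <-]].
have [px hx] : exists p, forall k, rx0 (q k) <= p <= rx1 (q k).
  by apply: point => [k|j k /mono[]//]; have [[]] := inv k.
have [py hy] : exists p, forall k, ry0 (q k) <= p <= ry1 (q k).
  by apply: point => [k|j k /mono[]//]; have [[]] := inv k.
have [del del0 H] := loc px py (hx 0%N) (hy 0%N).
have w0 : 0 <= (rx1 Q - rx0 Q) + (ry1 Q - ry0 Q) by move: nQ => [a b]; lra.
have [k hk] := small_half_power w0 del0.
have e0 : 0 <= (1 / 2 : R) ^+ k by rewrite exprn_ge0//; lra.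
apply: (proj2 (inv k)); apply: H => //; first by case: (inv k).
  rewrite wx; apply: le_lt_trans hk; rewrite ler_wpM2r//; move: nQ => [a b]; lra.
rewrite wy; apply: le_lt_trans hk; rewrite ler_wpM2r//; move: nQ => [a b]; lra.
Qed.


Lemma bnd_norm_le D (w : C) : bnd D w -> `|w| <= ofreal (2 * D).
Proof.
move=> [h1 h2]; apply: le_trans (norm_le _) _; rewrite ler_of.
by apply: le_trans (lerD h1 h2) _; rewrite mulr_natl mulr2n.
Qed.

Lemma norm_le_bnd D (w : C) : `|w| <= ofreal D -> bnd D w.
Proof.
by rewrite normE ler_of => h; split; apply: le_trans h; [exact: re_le|exact: im_le].
Qed.

Lemma near_bnd (p : C) (A : set C) : nbhs p A ->
  exists2 del : R, 0 < del & forall z, bnd del (z - p) -> A z.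
Proof.
move=> /nbhs_ballP[e /= e0 eA]; have [e' ee] : exists e', e = ofreal e'.
  by exists (re e); exact/ofreal_ge0P/ltW.
rewrite ee ltr_of in e0; exists (e' / 4); first by rewrite divr_gt0.
move=> z /bnd_norm_le h; apply: eA; rewrite -ball_normE /= distrC.
by apply: le_lt_trans h _; rewrite ee ltr_of; lra.
Qed.

Lemma bnd_near (p : C) (del : R) : 0 < del -> \forall z \near p, bnd del (z - p).
Proof.
move=> d0; have d0' : 0 < ofreal del by rewrite ltr_of.
have := nbhsx_ballx p _ d0'; apply: filterS => z; rewrite -ball_normE /= distrC => /ltW.
exact: norm_le_bnd.
Qed.

Lemma continuous_affine (K : numFieldType) (a b : K) : continuous (fun z => a + b * z).
Proof.
move=> z.
apply: (@continuousD K K^o K (fun=> a) (fun z => b * z) z).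
  exact: cst_continuous.
apply: (@continuousM K K (fun=> b) id z).
  exact: cst_continuous.
exact: cvg_id.
Qed.
Lemma continuous_lin (K : numFieldType) (a b : K) (f g : K -> K) :
  continuous f -> continuous g -> continuous (fun z => a * f z + b * g z).
Proof.
move=> cf cg z.
apply: (@continuousD K K^o K (fun z => a * f z) (fun z => b * g z) z).
apply: (@continuousM K K (fun=> a) f z).
  exact: cst_continuous.
exact: cf.
apply: (@continuousM K K (fun=> b) g z).
  exact: cst_continuous.
exact: cg.
Qed.

Lemma derivable_approx (K : numFieldType) (f : K -> K) (p eps : K) :
  derivable f p 1 -> 0 < eps ->
  \forall z \near p, `|f z - f p - 'D_1 f p * (z - p)| <= eps * `|z - p|.
Proof.
move=> df eps0.
have : (fun h => h^-1 *: ((f \o shift p) (h *: 1) - f p)) @ 0^' --> 'D_1 f p by exact: df.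
move=> /cvgrPdist_le/(_ _ eps0); rewrite near_withinE => /nbhs_ballP[e /= e0 H].
apply/nbhs_ballP; exists e => //= z; rewrite -ball_normE /= => pz.
have [->|zp] := eqVneq z p; first by rewrite !subrr mulr0 subr0 normr0 mulr0.
have zp0 : z - p != 0 by rewrite subr_eq0.
have := H (z - p); rewrite -ball_normE /= sub0r normrN distrC => /(_ pz zp0).
rewrite /GRing.scale /= mulr1 subrK => h.
have -> : f z - f p - 'D_1 f p * (z - p) =
    - (('D_1 f p - (z - p)^-1 * (f z - f p)) * (z - p)).
  by field.
by rewrite normrN normrM (distrC p z) ler_wpM2r.
Qed.

Lemma goursat (f : C -> C) (Q : rect) : continuous f -> nonneg_rect Q ->
  (forall x y, rx0 Q <= x <= rx1 Q -> ry0 Q <= y <= ry1 Q -> derivable f (mkc x y) 1) ->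
  RI f (rx0 Q) (rx1 Q) (ry0 Q) (ry1 Q) = 0.
Proof.
move=> cf nQ df.
pose sz (q : rect) := (rx1 q - rx0 q) + (ry1 q - ry0 q).
have key (eps : R) : 0 < eps ->
    bnd (eps * sz Q ^+ 2) (RI f (rx0 Q) (rx1 Q) (ry0 Q) (ry1 Q)).
  move=> eps0.
  apply: (@bisection (fun q => bnd (eps * sz q ^+ 2) (RI f (rx0 q) (rx1 q) (ry0 q) (ry1 q)))) nQ _.
    move=> x0 x1 y0 y1 hx hy xm ym; rewrite /sz /= => h1 h2 h3 h4.
    rewrite (RI_splity f x0 x1 y0 ym y1) !(RI_splitx f x0 xm x1).
    have := bndD (bndD h1 h2) (bndD h3 h4); apply: bnd_le.
    by rewrite le_eqVlt; apply/orP; left; apply/eqP; rewrite /xm /ym; field.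
  move=> px py hx hy; have d := df _ _ hx hy; set p := mkc px py in d.
  have e0 : 0 < ofreal (eps / 4) :> C by rewrite ltr_of divr_gt0.
  have [del del0 H] := near_bnd (derivable_approx d e0).
  exists del => // q [qx qy] pxq pyq wq hq /=.
  set c := 'D_1 f p in H; pose aff z := (f p - c * p) + c * z.
  pose r z := 1 * f z + (- 1) * aff z.
  have caff : continuous aff by exact: (@continuous_affine C (f p - c * p) c).
  have cr : continuous r by exact: (@continuous_lin C 1 (-1) f aff cf caff).
  have -> : RI f (rx0 q) (rx1 q) (ry0 q) (ry1 q) = RI r (rx0 q) (rx1 q) (ry0 q) (ry1 q).
    have e1 := RI_lin 1 (-1)
      (ccont_sidesW (rx0 q) (rx1 q) (ry0 q) (ry1 q) cf) (ccont_sidesW _ _ _ _ caff).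
    have e2 := RI_affine (f p - c * p) c (rx0 q) (rx1 q) (ry0 q) (ry1 q).
    by rewrite [RHS]e1 e2 mulr0 addr0 mul1r.
  have szq : 0 <= sz q by rewrite /sz; lra.
  have ptwise x y : rx0 q <= x <= rx1 q -> ry0 q <= y <= ry1 q ->
      bnd (eps / 2 * sz q) (r (mkc x y)).
    move=> hx' hy'.
    have D : bnd (sz q) (mkc x y - p).
      by split; rewrite raddfB /= ?re_mkc ?im_mkc /sz; apply/ler_normlP; split; lra.
    have D' : bnd del (mkc x y - p).
      by split; rewrite raddfB /= ?re_mkc ?im_mkc; apply/ler_normlP; split; lra.
    apply: norm_le_bnd; have -> : r (mkc x y) = f (mkc x y) - f p - c * (mkc x y - p).
      by rewrite /r /aff; ring.
    apply: le_trans (H _ D') _.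
    have -> : eps / 2 * sz q = eps / 4 * (2 * sz q) by field.
    rewrite [leRHS]rmorphM; apply: ler_wpM2l; first exact: ltW e0.
    exact: bnd_norm_le.
  apply: bnd_le (RI_bnd (M := eps / 2 * sz q) (ccont_sidesW _ _ _ _ cr) qx qy _ _).
  - by rewrite le_eqVlt; apply/orP; left; apply/eqP; rewrite /sz; field.
  - by move=> t ht; split; apply: ptwise => //; rewrite lexx ?qx ?qy.
  - by move=> t ht; split; apply: ptwise => //; rewrite lexx ?qx ?qy.
have z0 (a K : R) : 0 <= K -> (forall eps, 0 < eps -> `|a| <= eps * K) -> a = 0.
  move=> K0 H; apply/eqP; rewrite -normr_eq0 eq_le normr_ge0 andbT.
  apply/ler_addgt0Pr => e e_gt0; rewrite add0r.
  have K1 : 0 < K + 1 by lra.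
  have := H (e / (K + 1)) (divr_gt0 e_gt0 K1) => /le_trans; apply.
  by rewrite mulrAC ler_pdivrMr// ler_wpM2l ?ltW//; lra.
by apply: ceq; rewrite raddf0; apply: (z0 _ (sz Q ^+ 2)); rewrite ?sqr_ge0// => eps /key[].
Qed.

Lemma goursat_except (f : C -> C) (E : seq C) : continuous f ->
  forall Q, nonneg_rect Q ->
  (forall x y, rx0 Q <= x <= rx1 Q -> ry0 Q <= y <= ry1 Q -> mkc x y \notin E ->
     derivable f (mkc x y) 1) ->
  RI f (rx0 Q) (rx1 Q) (ry0 Q) (ry1 Q) = 0.
Proof.
move=> cf; elim: E => [|p E IH] Q nQ df; first by apply: goursat => // x y hx hy; exact: df.
have out x0 x1 y0 y1 : rx0 Q <= x0 -> x1 <= rx1 Q -> ry0 Q <= y0 -> y1 <= ry1 Q ->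
    x0 <= x1 -> y0 <= y1 -> ~~ ((x0 <= re p <= x1) && (y0 <= im p <= y1)) ->
    RI f x0 x1 y0 y1 = 0.
  move=> a b c d x01 y01 pn; apply: (IH (Rect x0 x1 y0 y1)) => //= x y /andP[hx hx'] /andP[hy hy'] hE.
  apply: df; rewrite ?(le_trans a hx) ?(le_trans hx' b) ?(le_trans c hy) ?(le_trans hy' d)//.
  rewrite inE negb_or hE andbT; apply: contra pn => /eqP <-.
  by rewrite re_mkc im_mkc hx hx' hy hy'.
have [pQ|pnQ] := boolP ((rx0 Q <= re p <= rx1 Q) && (ry0 Q <= im p <= ry1 Q)); last first.
  by apply: out => //; case: nQ.
have [qx qy] := nQ; move/andP: pQ => [/andP[px0 px1] /andP[py0 py1]].
pose M0 := Num.sqrt (nsq (f p)) + 1.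
have M00 : 0 <= M0 by rewrite addr_ge0// sqrtr_ge0.
have [del del0 Hdel] : exists2 del : R, 0 < del & forall z, bnd del (z - p) -> bnd M0 (f z).
  apply: near_bnd; have /cvgrPdist_le/(_ 1 ltr01) := cf p.
  apply: filterS => z /= h; rewrite -[f z](addrNK (f p)) addrC; apply: bndD.
    exact: bnd_norm.
  by apply: norm_le_bnd; rewrite rmorph1 distrC.
have key sig : 0 < sig -> sig <= del ->
    bnd (2 * M0 * (4 * sig)) (RI f (rx0 Q) (rx1 Q) (ry0 Q) (ry1 Q)).
  move=> s0 sd.
  pose xl := Num.max (rx0 Q) (re p - sig); pose xr := Num.min (rx1 Q) (re p + sig).
  pose yl := Num.max (ry0 Q) (im p - sig); pose yr := Num.min (ry1 Q) (im p + sig).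
  have [a1 a2 a3] : [/\ rx0 Q <= xl, re p - sig <= xl & xl <= re p].
    by rewrite /xl; split; rewrite ?le_max ?ge_max ?lexx ?orbT ?px0//=; lra.
  have [b1 b2 b3] : [/\ xr <= rx1 Q, xr <= re p + sig & re p <= xr].
    by rewrite /xr; split; rewrite ?ge_min ?le_min ?lexx ?orbT ?px1//=; lra.
  have [c1 c2 c3] : [/\ ry0 Q <= yl, im p - sig <= yl & yl <= im p].
    by rewrite /yl; split; rewrite ?le_max ?ge_max ?lexx ?orbT ?py0//=; lra.
  have [d1 d2 d3] : [/\ yr <= ry1 Q, yr <= im p + sig & im p <= yr].
    by rewrite /yr; split; rewrite ?ge_min ?le_min ?lexx ?orbT ?py1//=; lra.
  rewrite (RI_splitx f _ xl) (RI_splitx f xl xr).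
  have -> : RI f (rx0 Q) xl (ry0 Q) (ry1 Q) = 0.
    have [e|e] := eqVneq xl (rx0 Q); first by rewrite e RI_flatx.
    apply: out => //; first by lra.
    apply/negP => /andP[/andP[_ h] _]; move: e h; rewrite /xl.
    by case: (leP (rx0 Q) (re p - sig)) => _; rewrite ?eqxx// => _; lra.
  have -> : RI f xr (rx1 Q) (ry0 Q) (ry1 Q) = 0.
    have [e|e] := eqVneq xr (rx1 Q); first by rewrite e RI_flatx.
    apply: out => //; first by lra.
    apply/negP => /andP[/andP[h _] _]; move: e h; rewrite /xr.
    by case: (leP (rx1 Q) (re p + sig)) => _; rewrite ?eqxx// => _; lra.
  rewrite add0r addr0 (RI_splity f _ _ _ yl) (RI_splity f _ _ yl yr).
  have -> : RI f xl xr (ry0 Q) yl = 0.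
    have [e|e] := eqVneq yl (ry0 Q); first by rewrite e RI_flaty.
    apply: out => //; try lra.
    apply/negP => /andP[_ /andP[_ h]]; move: e h; rewrite /yl.
    by case: (leP (ry0 Q) (im p - sig)) => _; rewrite ?eqxx// => _; lra.
  have -> : RI f xl xr yr (ry1 Q) = 0.
    have [e|e] := eqVneq yr (ry1 Q); first by rewrite e RI_flaty.
    apply: out => //; try lra.
    apply/negP => /andP[_ /andP[h _]]; move: e h; rewrite /yr.
    by case: (leP (ry1 Q) (im p + sig)) => _; rewrite ?eqxx// => _; lra.
  have ptwise x y : xl <= x <= xr -> yl <= y <= yr -> bnd M0 (f (mkc x y)).
    move=> hx hy; apply: Hdel.
    by split; rewrite raddfB /= ?re_mkc ?im_mkc; apply/ler_normlP; split; lra.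
  rewrite add0r addr0; apply: bnd_le (RI_bnd (M := M0) (ccont_sidesW _ _ _ _ cf) _ _ _ _); try lra.
      by rewrite ler_wpM2l ?mulr_ge0//; lra.
    by move=> t ht; split; apply: ptwise => //; apply/andP; split; lra.
  by move=> t ht; split; apply: ptwise => //; apply/andP; split; lra.
have z0 (a : R) : (forall sig, 0 < sig -> sig <= del -> `|a| <= 2 * M0 * (4 * sig)) -> a = 0.
  move=> H; apply/eqP; rewrite -normr_eq0 eq_le normr_ge0 andbT.
  apply/ler_addgt0Pr => e e_gt0; rewrite add0r.
  have K1 : 0 < 8 * M0 + 1 by lra.
  pose sig := Num.min del (e / (8 * M0 + 1)).
  have s0 : 0 < sig by rewrite lt_min del0 divr_gt0.
  have s1 : sig <= del by rewrite ge_min lexx.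
  have s2 : sig * (8 * M0 + 1) <= e by rewrite -ler_pdivlMr// ge_min lexx orbT.
  by apply: le_trans (H sig s0 s1) _; lra.
by apply: ceq; rewrite raddf0; apply: z0 => sig s0 sd; have [] := key sig s0 sd.
Qed.
End Goursat.

Section Slope.
Variable K : numFieldType.

Definition slope (f : K -> K) (p z : K) : K :=
  if z == p then 'D_1 f p else (f z - f p) / (z - p).

Lemma slopeE f p z : f z - f p = (z - p) * slope f p z.
Proof.
rewrite /slope; have [->|zp] := eqVneq z p; first by rewrite !subrr mul0r.
by rewrite mulrC divfK// subr_eq0.
Qed.

Lemma near_neq (p z : K) : z != p -> \forall y \near z, y != p.
Proof.
move=> zp; have e0 : 0 < `|z - p| by rewrite normr_gt0 subr_eq0.
have := nbhsx_ballx z _ e0; apply: filterS => y; rewrite -ball_normE /=.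
by apply: contraTneq => ->; rewrite ltxx.
Qed.

Lemma continuous_near (f g : K -> K) z : (\forall y \near z, f y = g y) ->
  {for z, continuous f} -> {for z, continuous g}.
Proof.
move=> fg cf; have fz : f z = g z by exact: nbhs_singleton fg.
move=> A; rewrite -fz => /cf Af.
by apply: filterS2 fg Af => y /= ->.
Qed.

Lemma continuous_inv_sub (p z : K) : z != p -> {for z, continuous (fun y => (y - p)^-1)}.
Proof.
move=> zp; apply: (@continuousV K K (fun y => y - p) z); first by rewrite subr_eq0.
by apply: (@continuousB K K^o K id (fun=> p) z); [exact: cvg_id|exact: cst_continuous].
Qed.

Lemma slope_continuous (f : K -> K) (p : K) : continuous f -> derivable f p 1 -> continuous (slope f p).
Proof.
move=> cf df z; have [->|zp] := eqVneq z p.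
  apply/(@cvgrPdist_le K K^o K (nbhs p) _ (slope f p)) => eps eps0.
  have := derivable_approx df eps0; apply: filterS => y /=.
  rewrite /slope eqxx; have [->|yp] := eqVneq y p; first by move=> _; rewrite subrr normr0 ltW.
  have yp0 : y - p != 0 by rewrite subr_eq0.
  have e : (f y - f p) / (y - p) - 'D_1 f p = (f y - f p - 'D_1 f p * (y - p)) / (y - p).
    by rewrite [RHS]mulrBl mulfK.
  by move=> h; rewrite distrC e normrM normfV ler_pdivrMr ?normr_gt0.
have : {for z, continuous (fun y => (f y - f p) * (y - p)^-1)}.
  apply: (@continuousM K K (fun y => f y - f p) (fun y => (y - p)^-1) z).
    by apply: (@continuousB K K^o K f (fun=> f p) z); [exact: cf|exact: cst_continuous].
  exact: continuous_inv_sub.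
apply: continuous_near; have := near_neq zp; apply: filterS => y yp.
by rewrite /slope (negPf yp).
Qed.

Lemma slope_derivable (f : K -> K) (p z : K) : z != p -> derivable f z 1 -> derivable (slope f p) z 1.
Proof.
move=> zp df.
apply: (@near_eq_derivable K K K (fun y => (f y - f p) * (y - p)^-1)).
  have := near_neq zp; apply: filterS => y yp.
  by rewrite /slope (negPf yp).
apply: (@derivableM K K (fun y => f y - f p) (fun y => (y - p)^-1) z 1).
  by apply: (@derivableB K K K f (fun=> f p) z 1 df); exact: derivable_cst.
apply: (@derivableV K K (fun y => y - p) z 1); first by rewrite subr_eq0.
by apply: (@derivableB K K K id (fun=> p) z 1); [exact: derivable_id|exact: derivable_cst].
Qed.
End Slope.

Section Liouville.
Variable R : realType.
Local Notation C := (Cplx R).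

Lemma mkc_continuous_h (y t : R) : (fun t => mkc t y : C) @ t --> (mkc t y : C).
Proof.
apply: cvgC_reim; last by rewrite im_mkc; exact: cvg_cst.
by rewrite re_mkc; exact: cvg_id.
Qed.
Lemma mkc_continuous_v (x t : R) : (fun t => mkc x t : C) @ t --> (mkc x t : C).
Proof.
apply: cvgC_reim; first by rewrite re_mkc; exact: cvg_cst.
by rewrite im_mkc; exact: cvg_id.
Qed.

Lemma ccont_h_off (f : C -> C) y : (forall t, {for mkc t y, continuous f}) ->
  ccont (fun t => f (mkc t y)).
Proof.
move=> cf; have c t : (fun t => f (mkc t y)) @ t --> f (mkc t y).
  by apply: continuous_cvg; [exact: cf|exact: mkc_continuous_h].
by split=> t; [exact: cvgC_re (c t)|exact: cvgC_im (c t)].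
Qed.
Lemma ccont_v_off (f : C -> C) x : (forall t, {for mkc x t, continuous f}) ->
  ccont (fun t => f (mkc x t)).
Proof.
move=> cf; have c t : (fun t => f (mkc x t)) @ t --> f (mkc x t).
  by apply: continuous_cvg; [exact: cf|exact: mkc_continuous_v].
by split=> t; [exact: cvgC_re (c t)|exact: cvgC_im (c t)].
Qed.

Lemma ccont_sides_square (f : C -> C) (p : C) rho : 0 < rho ->
  (forall z, z != p -> {for z, continuous f}) ->
  ccont_sides f (re p - rho) (re p + rho) (im p - rho) (im p + rho).
Proof.
move=> r0 cf; have neq x y : (x != re p) || (y != im p) -> mkc x y != p.
  by apply: contraTneq => <-; rewrite re_mkc im_mkc !eqxx.
split; first [apply: ccont_h_off => t|apply: ccont_v_off => t]; apply: cf; apply: neq.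
- by rewrite [X in _ || X](_ : _ = true) ?orbT//; apply/eqP; lra.
- by rewrite [X in X || _](_ : _ = true)//; apply/eqP; lra.
- by rewrite [X in _ || X](_ : _ = true) ?orbT//; apply/eqP; lra.
- by rewrite [X in X || _](_ : _ = true)//; apply/eqP; lra.
Qed.

Lemma rint_lower (phi : R -> R) a b m : continuous phi -> a <= b ->
  (forall t, a <= t <= b -> m <= phi t) -> m * (b - a) <= rint phi a b.
Proof.
move=> cphi ab H; have [c /H hc ->] := rint_mean cphi ab.
by rewrite ler_wpM2r// subr_ge0.
Qed.

Lemma rint_upper (phi : R -> R) a b m : continuous phi -> a <= b ->
  (forall t, a <= t <= b -> phi t <= m) -> rint phi a b <= m * (b - a).
Proof.
move=> cphi ab H; have [c /H hc ->] := rint_mean cphi ab.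
by rewrite ler_wpM2r// subr_ge0.
Qed.

(* The winding number of a square around its centre is not 0 *)
Lemma square_winding (p : C) rho : 0 < rho ->
  4 <= im (RI (fun z => (z - p)^-1) (re p - rho) (re p + rho) (im p - rho) (im p + rho)).
Proof.
move=> r0; set k := fun z => _.
have [[b1 b2] [r1 r2] [t1 t2] [l1 l2]] :=
  ccont_sides_square r0 (fun z zp => @continuous_inv_sub C p z zp).
rewrite /RI !(raddfB, raddfD) /= !imM !re_mkc !im_mkc !mul0r !add0r !mul1r.
have q (s : R) : `|s| <= rho -> (2 * rho)^-1 <= rho / (s ^+ 2 + rho ^+ 2).
  move=> hs; have s2 : s ^+ 2 <= rho ^+ 2.
    by rewrite -real_normK ?num_real// ler_pXn2r ?nnegrE// ltW.
  have d0 : 0 < s ^+ 2 + rho ^+ 2 by rewrite ltr_wpDl ?sqr_ge0// exprn_gt0.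
  rewrite ler_pdivlMr// ler_pdivrMl ?mulr_gt0//.
  by rewrite -mulrA -expr2; lra.
have w : (2 * rho)^-1 * (2 * rho) = 1 by rewrite mulVf// gt_eqF// mulr_gt0.
have le2 (a : R) : a - rho <= a + rho by lra.
have ww (a : R) : (a + rho) - (a - rho) = 2 * rho by ring.
have h1 : 1 <= rint (fun t => im (k (mkc t (im p - rho)))) (re p - rho) (re p + rho).
  have := rint_lower (m := (2 * rho)^-1) b2 (le2 (re p)); rewrite ww w; apply=> t ht.
  have e1 : im (mkc t (im p - rho) - p) = - rho by rewrite raddfB /= ?im_mkc; ring.
  have e2 : re (mkc t (im p - rho) - p) = t - re p by rewrite raddfB.
  rewrite /k im_inv /nsq e1 e2.
  by rewrite sqrrN opprK; apply: q; apply/ler_normlP; split; lra.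
have h2 : 1 <= rint (fun t => re (k (mkc (re p + rho) t))) (im p - rho) (im p + rho).
  have := rint_lower (m := (2 * rho)^-1) r1 (le2 (im p)); rewrite ww w; apply=> t ht.
  have e1 : re (mkc (re p + rho) t - p) = rho by rewrite raddfB /= ?re_mkc; ring.
  have e2 : im (mkc (re p + rho) t - p) = t - im p by rewrite raddfB.
  rewrite /k re_inv /nsq e1 e2.
  by rewrite addrC; apply: q; apply/ler_normlP; split; lra.
have h3 : rint (fun t => im (k (mkc t (im p + rho)))) (re p - rho) (re p + rho) <= -1.
  have := rint_upper (m := - (2 * rho)^-1) t2 (le2 (re p)); rewrite ww mulNr w; apply=> t ht.
  have e1 : im (mkc t (im p + rho) - p) = rho by rewrite raddfB /= ?im_mkc; ring.
  have e2 : re (mkc t (im p + rho) - p) = t - re p by rewrite raddfB.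
  rewrite /k im_inv /nsq e1 e2.
  by rewrite mulNr lerN2; apply: q; apply/ler_normlP; split; lra.
have h4 : rint (fun t => re (k (mkc (re p - rho) t))) (im p - rho) (im p + rho) <= -1.
  have := rint_upper (m := - (2 * rho)^-1) l1 (le2 (im p)); rewrite ww mulNr w; apply=> t ht.
  have e1 : re (mkc (re p - rho) t - p) = - rho by rewrite raddfB /= ?re_mkc; ring.
  have e2 : im (mkc (re p - rho) t - p) = t - im p by rewrite raddfB.
  rewrite /k re_inv /nsq e1 e2.
  by rewrite mulNr lerN2 sqrrN addrC; apply: q; apply/ler_normlP; split; lra.
by move: h1 h2 h3 h4; rewrite /k /rint oppr0; lra.
Qed.

Lemma RI_ext (f g : C -> C) x0 x1 y0 y1 :
  (forall z, (re z == x0) || (re z == x1) || (im z == y0) || (im z == y1) -> f z = g z) ->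
  RI f x0 x1 y0 y1 = RI g x0 x1 y0 y1.
Proof.
move=> fg; have ext phi psi a b : (forall t, phi t = psi t) ->
    cint phi a b = cint psi a b :> C by move=> h; have -> : phi = psi by apply/funext.
rewrite /RI; congr (_ + _ * _ - _ - _ * _); apply: ext => t; apply: fg;
  by rewrite ?re_mkc ?im_mkc eqxx ?orbT.
Qed.

(* Cauchy's formula on large squares *)
Lemma liouville (f : C -> C) (E : seq C) : continuous f ->
  (forall z, z \notin E -> derivable f z 1) ->
  (forall eps : R, 0 < eps -> exists rho : R, forall z : C, ofreal rho <= `|z| ->
     `|f z| <= ofreal eps) ->
  forall p, p \notin E -> f p = 0.
Proof.
move=> cf df decay p pE.
have dp := df p pE; pose g := slope f p.
have cg : continuous g by exact: slope_continuous.
have bound eps : 0 < eps -> `|f p| <= ofreal (8 * eps).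
  move=> eps0; have [rho0 H] := decay eps eps0.
  pose rho := `|rho0| + Num.sqrt (nsq p) + 1.
  have sp0 : 0 <= Num.sqrt (nsq p) by exact: sqrtr_ge0.
  have r0 : 0 < rho by rewrite /rho; have := normr_ge0 rho0; lra.
  set x0 := re p - rho; set x1 := re p + rho; set y0 := im p - rho; set y1 := im p + rho.
  have RIg : RI g x0 x1 y0 y1 = 0.
    apply: (@goursat_except R g (p :: E) cg (Rect x0 x1 y0 y1)) => /=.
      by rewrite /nonneg_rect /= /x0 /x1 /y0 /y1; lra.
    move=> x y _ _; rewrite inE negb_or => /andP[zp zE].
    exact: slope_derivable zp (df _ zE).
  pose k (z : C) := (z - p)^-1; pose h z := f z * k z.
  have ck z : z != p -> {for z, continuous k} by exact: continuous_inv_sub.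
  have ch z : z != p -> {for z, continuous h}.
    by move=> zp; apply: (@continuousM C C f k z (cf z) (ck z zp)).
  have sk : ccont_sides k x0 x1 y0 y1 by exact: ccont_sides_square.
  have sh : ccont_sides h x0 x1 y0 y1 by exact: ccont_sides_square.
  have onside z : (re z == x0) || (re z == x1) || (im z == y0) || (im z == y1) ->
      rho <= Num.sqrt (nsq (z - p)).
    have nz (a : R) (w : C) : `|a| = rho -> `|a| <= Num.sqrt (nsq w) -> rho <= Num.sqrt (nsq w).
      by move=> ->.
    have l1 : `|- rho| = rho by rewrite normrN ger0_norm// ltW.
    have l2 : `|rho| = rho by rewrite ger0_norm// ltW.
    case/orP => [/orP[/orP[]|]|] /eqP e.
    - by apply: (nz (- rho)) => //; have := re_le (z - p); rewrite raddfB /= e /x0 addrAC subrr add0r.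
    - by apply: (nz rho) => //; have := re_le (z - p); rewrite raddfB /= e /x1 addrAC subrr add0r.
    - by apply: (nz (- rho)) => //; have := im_le (z - p); rewrite raddfB /= e /y0 addrAC subrr add0r.
    - by apply: (nz rho) => //; have := im_le (z - p); rewrite raddfB /= e /y1 addrAC subrr add0r.
  have side_neq z : rho <= Num.sqrt (nsq (z - p)) -> z != p.
    by apply: contraTneq => ->; rewrite subrr nsq0 sqrtr0 -ltNge.
  have side_h z : rho <= Num.sqrt (nsq (z - p)) -> bnd (2 * (eps * rho^-1)) (h z).
    move=> hz; apply: bndM; apply: norm_le_bnd.
      apply: H; apply: (@le_trans _ _ (`|z - p| - `|p|)); last first.
        by rewrite lerBlDr; exact: ler_normB.
      rewrite !normE -rmorphB ler_of; apply: le_trans (lerB hz (lexx _)).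
      by rewrite /rho; have := ler_norm rho0; lra.
    rewrite /k normfV normE -fmorphV ler_of lef_pV2 ?posrE//.
    exact: lt_le_trans r0 hz.
  have RIh : bnd (2 * (2 * (eps * rho^-1)) * ((x1 - x0) + (y1 - y0))) (RI h x0 x1 y0 y1).
    have le01 (a : R) : a - rho <= a + rho by lra.
    apply: (RI_bnd sh (le01 _) (le01 _)) => t _; split; apply/side_h/onside;
      by rewrite ?re_mkc ?im_mkc eqxx ?orbT.
  have e : RI h x0 x1 y0 y1 = f p * RI k x0 x1 y0 y1.
    have e1 := RI_lin 1 (- f p) sh sk.
    suff e2 : RI (fun z => 1 * h z + - f p * k z) x0 x1 y0 y1 = RI g x0 x1 y0 y1.
      by move: e1; rewrite e2 RIg mul1r mulNr => /esym/subr0_eq.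
    apply: RI_ext => z /onside/side_neq zp.
    by rewrite /g /slope (negPf zp) /h /k; ring.
  have := square_winding p r0; rewrite -/k -/x0 -/x1 -/y0 -/y1 => wn.
  have wn' : ofreal 4 <= `|RI k x0 x1 y0 y1|.
    rewrite normE ler_of; apply: le_trans wn (le_trans (ler_norm _) (im_le _)).
  have fin : ofreal 4 * `|f p| <= ofreal (32 * eps).
    rewrite mulrC; apply: le_trans (ler_wpM2l (normr_ge0 _) wn') _.
    rewrite -normrM -e; apply: le_trans (bnd_norm_le RIh) _.
    rewrite ler_of /x0 /x1 /y0 /y1.
    rewrite (_ : re p + rho - (re p - rho) + (im p + rho - (im p - rho)) = 4 * rho); last by ring.
    have -> : 2 * (2 * (2 * (eps * rho^-1)) * (4 * rho)) = 32 * eps * (rho^-1 * rho) by ring.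
    by rewrite mulVf ?mulr1// gt_eqF.
  have -> : 8 * eps = 4^-1 * (32 * eps) by field.
  rewrite rmorphM /= -[leLHS](mulKf (_ : ofreal 4 != 0 :> C)).
    by rewrite fmorphV ler_wpM2l// invr_ge0 -(rmorph0 (@ofreal R)) ler_of.
  by rewrite -(rmorph0 (@ofreal R)) (inj_eq (@ofrealI R)).
apply/eqP; rewrite -normr_eq0; apply: contraT => n0.
have x0 : 0 < Num.sqrt (nsq (f p)).
  by rewrite sqrtr_gt0 nsq_gt0 -normr_eq0.
have := bound (Num.sqrt (nsq (f p)) / 16) (divr_gt0 x0 (ltr0n _ 16)).
by rewrite normE ler_of; lra.
Qed.
End Liouville.


Section BigDerivable.
Variable K : numFieldType.

Lemma derivable_bigsum (I : Type) (l : seq I) (P : pred I) (f : I -> K -> K) (z : K) :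
  (forall i, derivable (f i) z 1) -> derivable (fun y => \sum_(i <- l | P i) f i y) z 1.
Proof.
move=> h; elim: l => [|i l IH].
  by under eq_fun do rewrite big_nil; exact: derivable_cst.
under eq_fun do rewrite big_cons.
case: (P i); last exact: IH.
exact: (@derivableD K K K (f i) _ z 1 (h i) IH).
Qed.

Lemma derivable_bigprod (I : Type) (l : seq I) (P : pred I) (f : I -> K -> K) (z : K) :
  (forall i, derivable (f i) z 1) -> derivable (fun y => \prod_(i <- l | P i) f i y) z 1.
Proof.
move=> h; elim: l => [|i l IH].
  by under eq_fun do rewrite big_nil; exact: derivable_cst.
under eq_fun do rewrite big_cons.
case: (P i); last exact: IH.
exact: (@derivableM K K (f i) _ z 1 (h i) IH).
Qed.

Lemma derivable_sub (b z : K) : derivable (fun y => y - b) z 1.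
Proof.
by apply: (@derivableB K K K id (fun=> b) z 1); [exact: derivable_id|exact: derivable_cst].
Qed.

Lemma derivable_continuous (f : K -> K) (z : K) : derivable f z 1 -> {for z, continuous f}.
Proof. by move=> df; apply: differentiable_continuous; exact/derivable1_diffP. Qed.

Lemma differentiable_mx (V : normedModType K) m n (f : V -> 'M[K]_(m, n)) (v : V) :
  (forall i j, differentiable (fun u => f u i j) v) -> differentiable f v.
Proof.
move=> h.
have -> : f = \sum_(i < m) \sum_(j < n) (fun u => f u i j *: delta_mx i j).
  apply/funext => u; rewrite [LHS]matrix_sum_delta fct_sumE.
  by apply: eq_bigr => i _; rewrite fct_sumE.
apply: differentiable_sum => i; apply: differentiable_sum => j.
exact: differentiableZl.
Qed.

Lemma differentiable_entry (V : normedModType K) m n (f : V -> 'M[K]_(m, n)) (v : V) i j :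
  differentiable f v -> differentiable (fun u => f u i j) v.
Proof.
move=> df; apply: (@differentiable_comp K V 'M[K]_(m, n) K f (fun M => M i j)) => //.
exact: differentiable_coord.
Qed.

Lemma big_pmap_option (V : Type) (op : V -> V -> V) (idx : V) (I T : Type)
    (c : I -> option T) (F : T -> V) (l : seq I) :
  left_id idx op ->
  \big[op/idx]_(i <- l) (if c i is Some b then F b else idx) =
  \big[op/idx]_(b <- pmap c l) F b.
Proof.
move=> idl; elim: l => [|i l IH]; first by rewrite !big_nil.
by rewrite big_cons IH /=; case: (c i) => [b|] /=; rewrite ?big_cons ?idl.
Qed.

Lemma divide_zeros (E bs : seq K) (N : K -> K) :
  uniq bs -> (forall b, b \in bs -> b \notin E) -> continuous N ->
  (forall z, z \notin E -> derivable N z 1) ->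
  (forall b, b \in bs -> N b = 0) ->
  exists f : K -> K, [/\ continuous f, forall z, z \notin bs ++ E -> derivable f z 1 &
    forall z, N z = \prod_(b <- bs) (z - b) * f z].
Proof.
elim: bs E N => [|b bs IH] E N /=.
  move=> _ _ cN dN _; exists N; split=> // z; by rewrite big_nil mul1r.
move=> /andP[bbs ubs] disj cN dN N0.
have bE : b \notin E by apply: disj; rewrite mem_head.
have cf1 : continuous (slope N b) by apply: slope_continuous => //; exact: dN.
have NE z : N z = (z - b) * slope N b z.
  by rewrite -slopeE (N0 b) ?mem_head// subr0.
have disj' b' : b' \in bs -> b' \notin b :: E.
  move=> b'bs; rewrite inE negb_or disj ?inE ?b'bs ?orbT// andbT.
  by apply: contraNneq bbs => <-.
have [z|b' b'bs|f [cf df fE]] := IH (b :: E) (slope N b) ubs disj' cf1.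
- by rewrite inE negb_or => /andP[zb zE]; apply: slope_derivable => //; exact: dN.
- have b'b : b' != b by apply: contraNneq bbs => <-.
  have := NE b'; rewrite N0 ?inE ?b'bs ?orbT// => /esym/eqP.
  by rewrite mulf_eq0 subr_eq0 (negPf b'b) => /eqP.
exists f; split=> // z.
  move=> zn; apply: df; apply: contra zn; rewrite !inE !mem_cat !inE.
  by case/or3P => [->|->|->]; rewrite ?orbT.
by rewrite NE fE big_cons mulrA.
Qed.

Lemma near_notin (E : seq K) (z : K) : \forall y \near z, y != z -> y \notin E.
Proof.
elim: E => [|b E IH]; first by apply: filterE.
have h : \forall y \near z, y != z -> y != b.
  have [->|bz] := eqVneq b z; first by apply: filterE.
  by have := near_neq (p := b) (z := z); rewrite eq_sym bz => /(_ isT); apply: filterS => y ->.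
apply: filterS2 IH h => y h1 h2 yz; rewrite inE negb_or h2//=; exact: h1.
Qed.

Lemma punctured_eq (f g : K -> K) (z : K) : {for z, continuous f} -> {for z, continuous g} ->
  (\forall y \near z, y != z -> f y = g y) -> f z = g z.
Proof.
move=> cf cg fg.
have cf' : f @ z^' --> f z by apply: cvg_trans cf; apply: cvg_app; exact: cvg_within.
have cg' : g @ z^' --> g z by apply: cvg_trans cg; apply: cvg_app; exact: cvg_within.
have cg2 : f @ z^' --> g z.
  by apply: cvg_trans cg'; apply: near_eq_cvg; rewrite near_withinE; apply: filterS fg => y h /h ->.
exact: (cvg_unique _ cf' cg2).
Qed.

End BigDerivable.

Section ChartFields.
Variables (R : realType) (n r : nat).
Local Notation C := (Cplx R).

Definition chart_inj (c : 'I_n -> option C) :=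
  forall i j b, c i = Some b -> c j = Some b -> i = j.

Lemma chart_prodD1 (c : 'I_n -> option C) i b t : c i = Some b ->
  chart_prod c predT t = (t - b) * chart_prod c (predC1 i) t.
Proof. by move=> ci; rewrite /chart_prod (bigD1 i)//= ci. Qed.

Lemma chart_prod_neq0 (c : 'I_n -> option C) (P : pred 'I_n) t :
  (forall j, P j -> c j <> Some t) -> chart_prod c P t != 0.
Proof.
move=> H; apply/prodf_neq0 => j /H; case: (c j) => [b|_]; last exact: oner_neq0.
by move=> nb; rewrite subr_eq0; apply/eqP => e; apply: nb; rewrite e.
Qed.

Lemma chart_prod_eq0 (c : 'I_n -> option C) (P : pred 'I_n) j t :
  P j -> c j = Some t -> chart_prod c P t = 0.
Proof. by move=> Pj cj; rewrite /chart_prod (bigD1 j)//= cj subrr mul0r. Qed.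

Lemma chart_field_at (c : 'I_n -> option C) (A : 'I_n -> 'M[C]_r) i b :
  c i = Some b -> chart_field c A b = chart_prod c (predC1 i) b *: A i.
Proof.
move=> ci; rewrite /chart_field (bigD1 i)//= ci big1 ?addr0// => j ji.
case cj : (c j) => [b'|]//; rewrite (chart_prod_eq0 (j := i)) ?scale0r//=.
by rewrite eq_sym.
Qed.

Lemma chart_prod_off (c : 'I_n -> option C) i b : chart_inj c -> c i = Some b ->
  chart_prod c (predC1 i) b != 0.
Proof.
move=> cinj ci; apply: chart_prod_neq0 => j /= ji cj.
by move: ji; rewrite (cinj _ _ _ ci cj) eqxx.
Qed.

Lemma chart_residueK (c : 'I_n -> option C) (A : 'I_n -> 'M[C]_r) i b :
  chart_inj c -> c i = Some b -> chart_residue c (chart_field c A) i = A i.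
Proof.
move=> cinj ci; rewrite /chart_residue ci (chart_field_at _ ci) scalerA mulVf ?scale1r//.
exact: chart_prod_off.
Qed.

Lemma derivable_chart_prod (c : 'I_n -> option C) P (z : C) :
  derivable (chart_prod c P) z 1.
Proof.
apply: derivable_bigprod => i; case: (c i) => [b|]; first exact: derivable_sub.
exact: derivable_cst.
Qed.

Lemma chart_field_entry (c : 'I_n -> option C) (A : 'I_n -> 'M[C]_r) t k l :
  chart_field c A t k l =
  \sum_i (if c i is Some _ then chart_prod c (predC1 i) t * A i k l else 0).
Proof.
by rewrite /chart_field summxE; apply: eq_bigr => i _; case: (c i) => [_|]; rewrite !mxE.
Qed.

Lemma derivable_chart_field (c : 'I_n -> option C) (A : 'I_n -> 'M[C]_r) k l (z : C) :
  derivable (fun t => chart_field c A t k l) z 1.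
Proof.
under eq_fun do rewrite chart_field_entry.
apply: derivable_bigsum => i; case: (c i) => [b|]; last exact: derivable_cst.
apply: (@derivableM C C (chart_prod c (predC1 i)) (fun=> A i k l) z 1).
  exact: derivable_chart_prod.
exact: derivable_cst.
Qed.

Lemma chart_field_div (c : 'I_n -> option C) (A : 'I_n -> 'M[C]_r) t :
  (forall i, c i <> Some t) ->
  (chart_prod c predT t)^-1 *: chart_field c A t =
  \sum_i (if c i is Some b then (t - b)^-1 *: A i else 0).
Proof.
move=> ct; rewrite /chart_field scaler_sumr; apply: eq_bigr => i _.
case ci : (c i) => [b|]; last by rewrite scaler0.
rewrite scalerA (chart_prodD1 t ci) invfM mulfVK//.
by apply: chart_prod_neq0 => j _; exact: ct.
Qed.

Variable a : 'I_n -> P1 R.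
Hypothesis ha : injective a.

Let cz : 'I_n -> option C := @coord_z R \o a.
Let cw : 'I_n -> option C := @coord_w R \o a.

Lemma cz_inj : chart_inj cz.
Proof. by move=> i j b; rewrite /cz /= /coord_z => hi hj; apply: ha; rewrite hi hj. Qed.

Lemma cw_inj : chart_inj cw.
Proof.
move=> i j b; rewrite /cw /= /coord_w => hi hj; apply: ha; move: hi hj.
case: (a i) => [z|]; case: (a j) => [z'|] //.
- case: eqVneq => // z0 [<-]; case: eqVneq => // z0' [].
  by move/(congr1 (@GRing.inv _)); rewrite !invrK => ->.
- case: eqVneq => // z0 [<-] [] /esym/eqP; rewrite invr_eq0 (negPf z0).
  by [].
- move=> [<-]; case: eqVneq => // z0 [] /eqP; rewrite invr_eq0 (negPf z0).
  by [].
Qed.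

Lemma residue_field_of_residues (A : 'I_n -> 'M[C]_r) i :
  residue a (field_of_residues a A) i = A i.
Proof.
rewrite /residue; case ai : (a i) => [b|].
  by apply: (@chart_residueK cz A i b); [exact: cz_inj|rewrite /cz /cw /= ai].
by apply: (@chart_residueK cw A i 0); [exact: cw_inj|rewrite /cz /cw /= ai].
Qed.

Lemma cw_off z : z != 0 -> (forall i, a i <> Some z) -> forall i, cw i <> Some z^-1.
Proof.
move=> z0 H i; rewrite /cw /= /coord_w; case ai : (a i) => [b|].
  case: eqVneq => // b0 [] /(congr1 (@GRing.inv _)); rewrite !invrK => e.
  by apply: (H i); rewrite ai e.
by move=> [] /esym/eqP; rewrite invr_eq0 (negPf z0).
Qed.

Lemma gluing_residues (A : 'I_n -> 'M[C]_r) z : \sum_i A i = 0 ->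
  z != 0 -> (forall i, a i <> Some z) ->
  (chart_prod cz predT z)^-1 *: chart_field cz A z =
  (- z ^- 2 * (chart_prod cw predT z^-1)^-1) *: chart_field cw A z^-1.
Proof.
move=> A0 z0 H; rewrite -scalerA (chart_field_div _ (cw_off z0 H)) (chart_field_div _ H).
apply/eqP; rewrite -subr_eq0; apply/eqP; rewrite scaler_sumr -sumrB.
have e : 0 = z^-1 *: \sum_i A i by rewrite A0 scaler0.
rewrite [RHS]e scaler_sumr; apply: eq_bigr => i _.
have := H i; rewrite /cz /cw /= /coord_z /coord_w; case: (a i) => [b|] bz /=.
  have zb : z - b != 0 by rewrite subr_eq0; apply/eqP => zE; apply: bz; rewrite zE.
  case: (eqVneq b 0) => [->|b0]; first by rewrite scaler0 !subr0.
  rewrite scalerA -scalerBl; congr (_ *: _).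
  have bz0 : b - z != 0 by rewrite -opprB oppr_eq0.
  by field; rewrite z0 b0 mulN1r bz0 zb.
rewrite sub0r scalerA -scaleNr; congr (_ *: _).
by rewrite subr0 invrK; field.
Qed.

Lemma is_field_of_residues (A : 'I_n -> 'M[C]_r) : \sum_i A i = 0 ->
  is_field a (field_of_residues a A).
Proof.
move=> A0; split.
- move=> z; apply/derivable1_diffP/differentiable_mx => k l.
  by apply/derivable1_diffP; exact: derivable_chart_field.
- move=> z; apply/derivable1_diffP/differentiable_mx => k l.
  by apply/derivable1_diffP; exact: derivable_chart_field.
by move=> z z0 H; exact: gluing_residues.
Qed.


Lemma uniq_pmap_inj (I T : eqType) (c : I -> option T) (l : seq I) :
  (forall i j b, c i = Some b -> c j = Some b -> i = j) -> uniq l -> uniq (pmap c l).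
Proof.
move=> cinj; elim: l => //= i l IH /andP[il ul].
case ci : (c i) => [b|] /=; last exact: IH.
rewrite IH// andbT mem_pmap; apply: contra il => /mapP[j jl cj].
by rewrite (cinj i j b)//.
Qed.

Section FieldDetermined.
Variable s : field R r.
Hypothesis fs : is_field a s.
Let A := residue a s.
Let bs : seq C := pmap a (index_enum 'I_n).

Lemma mem_marks b : (b \in bs) <-> exists i, a i = Some b.
Proof.
rewrite mem_pmap; split=> [/mapP[i _ e]|[i ai]]; first by exists i.
by apply/mapP; exists i; rewrite ?mem_index_enum.
Qed.

Lemma chart_prod_marks z : chart_prod cz predT z = \prod_(b <- bs) (z - b).
Proof.
by rewrite -(big_pmap_option (op := *%R) (idx := 1) a (fun b => z - b))//; exact: mul1r.
Qed.

Section Entry.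
Variables k l : 'I_r.
Let F1 z := s.1 z k l.
Let F2 w := s.2 w k l.

Lemma derivable_F1 z : derivable F1 z 1.
Proof.
have [h _ _] := fs; apply/derivable1_diffP/differentiable_entry.
by apply/derivable1_diffP; exact: h.
Qed.
Lemma derivable_F2 z : derivable F2 z 1.
Proof.
have [_ h _] := fs; apply/derivable1_diffP/differentiable_entry.
by apply/derivable1_diffP; exact: h.
Qed.

(* w / Q(w) near w = 0, with its value at w = 0 *)
Let m (w : C) : C := if [pick i | a i == None] is Some i
  then (chart_prod cw (predC1 i) w)^-1 else w * (chart_prod cw predT w)^-1.

Lemma derivable_m : derivable m 0 1.
Proof.
rewrite /m; case: pickP => [i /eqP ai|none].
  apply: (@derivableV C C (chart_prod cw (predC1 i)) 0 1).
    by apply: chart_prod_off; [exact: cw_inj|rewrite /cw /= ai].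
  exact: derivable_chart_prod.
apply: (@derivableM C C id (fun w => (chart_prod cw predT w)^-1) 0 1).
  exact: derivable_id.
apply: (@derivableV C C (chart_prod cw predT) 0 1); last exact: derivable_chart_prod.
apply: chart_prod_neq0 => j _; rewrite /cw /= /coord_w.
have := none j; case: (a j) => [b|] //= _.
by case: eqVneq => // b0 [] /eqP; rewrite invr_eq0 (negPf b0).
Qed.

Lemma mE w : w != 0 -> w * (chart_prod cw predT w)^-1 = m w.
Proof.
move=> w0; rewrite /m; case: pickP => [i /eqP ai|//].
have ci : cw i = Some 0 by rewrite /cw /= ai.
by rewrite (chart_prodD1 w ci) subr0 invfM mulrA divff// mul1r.
Qed.

Lemma m0E : m 0 * F2 0 = \sum_(i | a i == None) A i k l.
Proof.
rewrite /m; case: pickP => [i /eqP ai|none].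
  rewrite (big_pred1 i) => [|j].
    by rewrite /A /residue ai /chart_residue /= ai mxE.
  apply/eqP/eqP => [aj|->//]; apply: ha; rewrite aj ai.
  by [].
by rewrite !mul0r big_pred0.
Qed.

Lemma finite_part z : (forall i, a i <> Some z) ->
  (chart_prod cz predT z)^-1 * chart_field cz A z k l =
  \sum_i (if a i is Some b then (z - b)^-1 * A i k l else 0).
Proof.
move=> H; have := @chart_field_div cz A z H => /(congr1 (fun M : 'M[C]_r => M k l)).
rewrite mxE => ->; rewrite summxE; apply: eq_bigr => i _; rewrite /cz /= /coord_z.
by case: (a i) => [b|]; rewrite mxE.
Qed.

Lemma gluing_entry w : w != 0 -> (forall i, a i <> Some w^-1) ->
  (chart_prod cz predT w^-1)^-1 * F1 w^-1 = - (w * (m w * F2 w)).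
Proof.
move=> w0 H; have [_ _ g] := fs.
have := g w^-1; rewrite invr_eq0 => /(_ w0 H)/(congr1 (fun M : 'M[C]_r => M k l)).
rewrite mxE => ->; rewrite mxE invrK exprVn invrK -(mE w0) /F2; ring.
Qed.

Lemma near0_unmarked : \forall w \near (0 : C), w != 0 -> forall i, a i <> Some w^-1.
Proof.
have := near_notin (map (@GRing.inv _) bs) 0; apply: filterS => w h w0 i ai.
have /negP := h w0; apply; apply/mapP; exists w^-1; last by rewrite invrK.
by apply/mem_marks; exists i.
Qed.

Let tail (w : C) : C := \sum_i (if a i is Some b then (1 - b * w)^-1 * A i k l else 0).

Lemma derivable_tail : derivable tail 0 1.
Proof.
apply: derivable_bigsum => i; case: (a i) => [b|]; last exact: derivable_cst.
apply: (@derivableM C C (fun w => (1 - b * w)^-1) (fun=> A i k l) 0 1); last exact: derivable_cst.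
apply: (@derivableV C C (fun w => 1 - b * w) 0 1).
  by rewrite mulr0 subr0 oner_neq0.
apply: (@derivableB C C C (fun=> 1) (fun w => b * w) 0 1); first exact: derivable_cst.
apply: (@derivableM C C (fun=> b) id 0 1); first exact: derivable_cst.
exact: derivable_id.
Qed.

Lemma tailE w : w != 0 -> (forall i, a i <> Some w^-1) ->
  \sum_i (if a i is Some b then (w^-1 - b)^-1 * A i k l else 0) = w * tail w.
Proof.
move=> w0 H; rewrite mulr_sumr; apply: eq_bigr => i _.
have := H i; case: (a i) => [b|_]; last by rewrite mulr0.
move=> bw; rewrite mulrA; congr (_ * _).
have e : 1 - b * w != 0.
  rewrite subr_eq0; apply/eqP => e; apply: bw; congr Some.
  by rewrite -[b](mulfK w0) -e mul1r.
have e2 : w^-1 - b = (1 - b * w) / w by rewrite mulrBl mul1r mulfK.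
by rewrite e2 invfM invrK mulrC.
Qed.

Lemma field_entry z : F1 z = chart_field cz A z k l.
Proof.
pose N z := F1 z - chart_field cz A z k l.
have dN y : derivable N y 1.
  by apply: (@derivableB C C C F1 (fun y => chart_field cz A y k l) y 1);
    [exact: derivable_F1|exact: derivable_chart_field].
have N0 b : b \in bs -> N b = 0.
  move=> /mem_marks[i ai]; have ci : cz i = Some b by rewrite /cz /= ai.
  have Ai : A i = (chart_prod cz (predC1 i) b)^-1 *: s.1 b.
    by rewrite /A /residue ai /chart_residue /= ai.
  rewrite /N (chart_field_at _ ci) Ai !mxE.
  by rewrite mulVKf ?subrr//; apply: chart_prod_off => //; exact: cz_inj.
have ubs : uniq bs.
  by apply: uniq_pmap_inj; [move=> i j b hi hj; apply: ha; rewrite hi hj|exact: index_enum_uniq].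
have cN : continuous N by move=> y; exact: derivable_continuous.
have [//|y _|f [cf df fE]] := divide_zeros (E := [::]) ubs _ cN _ N0; first exact: dN.
have fPhi w : w != 0 -> (forall i, a i <> Some w^-1) -> f w^-1 = w * (- (m w * F2 w) - tail w).
  move=> w0 H; have P0 : chart_prod cz predT w^-1 != 0.
    by apply: chart_prod_neq0 => j _; exact: H.
  rewrite -[LHS](mulKf P0) chart_prod_marks -fE -chart_prod_marks mulrBr.
  by rewrite (gluing_entry w0 H) (finite_part H) (tailE w0 H); ring.
pose Phi w := w * (- (m w * F2 w) - tail w).
have dPhi : derivable Phi 0 1.
  apply: (@derivableM C C id (fun w => - (m w * F2 w) - tail w) 0 1); first exact: derivable_id.
  apply: (@derivableB C C C (fun w => - (m w * F2 w)) tail 0 1); last exact: derivable_tail.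
  apply: (@derivableN C C C (fun w => m w * F2 w) 0 1).
  by apply: (@derivableM C C m F2 0 1); [exact: derivable_m|exact: derivable_F2].
have decay (eps : R) : 0 < eps -> exists rho : R, forall z : C, ofreal rho <= `|z| ->
    `|f z| <= ofreal eps.
  move=> eps0; have e0 : 0 < ofreal eps by rewrite -(rmorph0 (@ofreal R)) ltr_of.
  have := derivable_continuous dPhi => /cvgrPdist_le/(_ _ e0) nPhi.
  have [del del0 H] := near_bnd (filterI nPhi near0_unmarked).
  exists (del^-1) => y hy; have y0 : y != 0.
    rewrite -normr_gt0; apply: lt_le_trans hy.
    by rewrite -(rmorph0 (@ofreal R)) ltr_of invr_gt0.
  have yi0 : y^-1 != 0 by rewrite invr_eq0.
  have [h1 h2] : (`|Phi 0 - Phi y^-1| <= ofreal eps) /\ (y^-1 != 0 -> forall i, a i <> Some (y^-1)^-1).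
    apply: H; rewrite subr0; apply: norm_le_bnd; rewrite normfV.
    rewrite -[ofreal del]invrK lef_pV2 ?posrE ?normr_gt0//; first by rewrite -fmorphV.
    by rewrite -fmorphV -(rmorph0 (@ofreal R)) ltr_of invr_gt0.
  rewrite -[y]invrK (fPhi _ yi0 (h2 yi0)).
  by move: h1; rewrite /Phi mul0r sub0r normrN.
have f0 := liouville cf df decay.
apply/eqP; rewrite -subr_eq0 -[_ - _]/(N z); apply/eqP.
have [/N0//|zn] := boolP (z \in bs).
by rewrite fE f0 ?mulr0// cats0.
Qed.

Lemma residue_theorem : \sum_i A i k l = 0.
Proof.
have e : tail 0 = - (m 0 * F2 0).
  apply: (@punctured_eq C tail (fun w => - (m w * F2 w)) 0).
  - exact: derivable_continuous derivable_tail.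
  - apply: derivable_continuous; apply: (@derivableN C C C (fun w => m w * F2 w) 0 1).
    by apply: (@derivableM C C m F2 0 1); [exact: derivable_m|exact: derivable_F2].
  have := near0_unmarked; apply: filterS => w h w0.
  have g := gluing_entry w0 (h w0).
  move: g; rewrite field_entry (finite_part (h w0)) (tailE w0 (h w0)) -mulrN.
  exact: (mulfI w0).
rewrite (bigID (fun i => a i == None)) /= -m0E.
have -> : \sum_(i | a i != None) A i k l = tail 0.
  rewrite big_mkcond; apply: eq_bigr => i _.
  by case: (a i) => [b|] //=; rewrite mulr0 subr0 invr1 mul1r.
by rewrite e subrr.
Qed.
End Entry.

Theorem field_determined : \sum_i A i = 0 /\ s = field_of_residues a A.
Proof.
have A0 : \sum_i A i = 0.
  by apply/matrixP => k l; rewrite summxE mxE; exact: residue_theorem.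
split=> //; rewrite (surjective_pairing s); congr pair; apply/funext => z.
  by apply/matrixP => k l; exact: field_entry.
apply/matrixP => k l.
apply: (@punctured_eq C (fun z => s.2 z k l) (fun z => chart_field cw A z k l) z).
- by apply: derivable_continuous; exact: derivable_F2.
- by apply: derivable_continuous; exact: derivable_chart_field.
have := near_notin (0 :: map (@GRing.inv _) bs) z; apply: filterS => w h /h.
rewrite inE negb_or => /andP[w0 wn].
have H i : a i <> Some w^-1.
  move=> ai; move/negP: wn; apply; apply/mapP; exists w^-1; last by rewrite invrK.
  by apply/mem_marks; exists i.
have wi0 : w^-1 != 0 by rewrite invr_eq0.
have [_ _ g] := fs.
have g1 := g _ wi0 H; have g2 := gluing_residues A0 wi0 H.
have e1 : s.1 w^-1 = chart_field cz A w^-1.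
  by apply/matrixP => k' l'; exact: field_entry.
move: g1; rewrite e1 [LHS]g2 invrK => /(congr1 (fun M : 'M[C]_r => M k l)); rewrite !mxE.
move=> /mulfI -> //; rewrite mulf_neq0// ?oppr_eq0 ?invr_eq0 ?expf_neq0//.
by rewrite -[w]invrK; apply: chart_prod_neq0 => j _; exact: (cw_off wi0 H).
Qed.
End FieldDetermined.
End ChartFields.

Lemma cvg_subK (K : numFieldType) (T : Type) (F : set_system T) (FF : Filter F)
  (f g : T -> K) (a b : K) : f @ F --> a -> g @ F --> b ->
  (fun t => f t - g t) @ F --> a - b.
Proof. exact: cvgB. Qed.

Section RepLimits.
Variables (R : realType) (Vt E : finType) (d : Vt -> nat) (s t : E -> Vt).
Local Notation C := (Cplx R).
Local Notation rep := (@rep R Vt E d s t).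
Local Notation ggauge := (@ggauge R Vt d).
Local Notation idx := {v : Vt & 'I_(d v)}.

Definition zero_rep : rep := fun e => 0.
Definition scale_rep (c : R) (x : rep) : rep := fun e => ofreal c *: x e.
Definition sub_rep (x y : rep) : rep := fun e => x e - y e.

Lemma cvg_trace (T : Type) (F : set_system T) (FF : Filter F) n
  (X : T -> 'M[C]_n) x : cvgmx F X x -> (fun k => \tr (X k)) @ F --> \tr x.
Proof. by move=> h; apply: cvg_sumK => i _; exact: h. Qed.

Lemma cvg_wmom (T : Type) (F : set_system T) (FF : Filter F)
  (X : T -> rep) x xi : cvgrep (F := F) X x ->
  (fun k => wmom (X k) xi) @ F --> wmom x xi.
Proof.
move=> h; apply: cvg_sumK => e _.
have h1 : cvgmx F (fun k => xi (t e) *m (X k e *m (X k e)^t*)) (xi (t e) *m (x e *m (x e)^t*)).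
  exact: (cvgmx_mul (FF := FF) (cvgmx_cst (FF := FF) (x := _)) (cvgmx_mul (FF := FF) (h e) (cvgmx_adj (FF := FF) (h e)))).
have h2 : cvgmx F (fun k => xi (s e) *m ((X k e)^t* *m X k e)) (xi (s e) *m ((x e)^t* *m x e)).
  exact: (cvgmx_mul (FF := FF) (cvgmx_cst (FF := FF) (x := _)) (cvgmx_mul (FF := FF) (cvgmx_adj (FF := FF) (h e)) (h e))).
exact: (cvg_subK FF (cvg_trace FF h1) (cvg_trace FF h2)).
Qed.

Lemma wmom_scale c (x : rep) xi : wmom (scale_rep c x) xi = ofreal (c ^+ 2) * wmom x xi.
Proof.
rewrite mulr_sumr; apply: eq_bigr => e _; rewrite /scale_rep.
have -> : (ofreal c *: x e)^t* = ofreal c *: (x e)^t*.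
  by apply/matrixP => i j; rewrite !mxE rmorphM; congr (_ * _); exact: conj_ofreal.
rewrite -!(scalemxAl, scalemxAr) !mxtraceZ !mulrA -!rmorphM -expr2 -mulrBr.
by [].
Qed.

Lemma rnorm2_scale c (x : rep) : rnorm2 (scale_rep c x) = c ^+ 2 * rnorm2 x.
Proof.
rewrite /rnorm2 !mulr_sumr; apply: eq_bigr => e _; rewrite mulr_sumr.
apply: eq_bigr => i _; rewrite mulr_sumr; apply: eq_bigr => j _.
by rewrite mxE nsqM nsq_of.
Qed.

Lemma gact_scale g c (x : rep) : gact g (scale_rep c x) = scale_rep c (gact g x).
Proof.
apply: functional_extensionality_dep => e; rewrite /gact /scale_rep.
by rewrite -scalemxAr -scalemxAl.
Qed.

Lemma cvgrep_rnorm2_0 (T : Type) (F : set_system T) (FF : Filter F) (X : T -> rep) (x : rep) :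
  (fun k => rnorm2 (sub_rep (X k) x)) @ F --> (0 : R) -> cvgrep (F := F) X x.
Proof.
move=> /cvgrPdist_lt h e i j; apply/cvgrPdist_lt => eps eps0.
have ee : eps = ofreal (re eps) by exact/ofreal_ge0P/ltW.
have e0 : 0 < re eps by rewrite -ltr_of -ee.
have e20 : 0 < re eps ^+ 2 by rewrite exprn_gt0.
apply: filterS (h _ e20) => k /=; rewrite sub0r normrN ger0_norm ?rnorm2_ge0// => hk.
rewrite ee distrC normE ltr_of -[ltRHS](ger0_norm (ltW e0)) -sqrtr_sqr ltr_sqrt//.
apply: le_lt_trans hk; have := nsq_le_rnorm2 (sub_rep (X k) x) i j.
by rewrite /sub_rep !mxE.
Qed.

Lemma nsq_add_le (z w : C) : nsq (z + w) <= 2 * nsq z + 2 * nsq w.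
Proof.
have := nsq_ge0 (z - w); rewrite nsqB => h1.
have := nsqB z (- w); rewrite opprK nsqN rmorphN mulrN raddfN /= => ->.
by lra.
Qed.

Lemma rnorm2_add_le (x y : rep) : rnorm2 x <= 2 * rnorm2 (sub_rep x y) + 2 * rnorm2 y.
Proof.
rewrite /rnorm2 !mulr_sumr -big_split; apply: ler_sum => e _ /=.
rewrite !mulr_sumr -big_split; apply: ler_sum => i _ /=.
rewrite !mulr_sumr -big_split; apply: ler_sum => j _ /=.
rewrite /sub_rep !mxE; apply: le_trans (nsq_add_le _ _).
by rewrite subrK.
Qed.

(* Level sets are proper over the space of closed orbits *)
Lemma bounded_levels (alpha : Vt -> R) (M1 : R) : exists M, forall (x z : rep) g,
  rnorm2 x <= M1 -> level alpha z -> invertible g ->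
  rnorm2 (sub_rep (gact g x) z) <= 1 -> rnorm2 z <= M.
Proof.
apply: contrapT => nM.
have H (k : nat) : exists p : rep * rep * ggauge, [/\ rnorm2 p.1.1 <= M1,
    level alpha p.1.2, invertible p.2, rnorm2 (sub_rep (gact p.2 p.1.1) p.1.2) <= 1 &
    k.+1%:R < rnorm2 p.1.2].
  apply: contrapT => h; apply: nM; exists k.+1%:R => x z g h1 h2 h3 h4.
  rewrite leNgt; apply/negP => h5; apply: h; exists (x, z, g).
  by split; [exact: h1|exact: h2|exact: h3|exact: h4|exact: h5].
have [p Hp] := choice H.
pose x k := (p k).1.1; pose z k := (p k).1.2; pose g k := (p k).2.
have Nz k : k.+1%:R < rnorm2 (z k) by have [_ _ _ _ h] := Hp k; exact: h.
have Nz0 k : 0 < rnorm2 (z k) by apply: lt_trans (Nz k); rewrite ltr0n.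
pose tau k := (Num.sqrt (rnorm2 (z k)))^-1.
have tau2 k : tau k ^+ 2 = (rnorm2 (z k))^-1.
  by rewrite /tau exprVn sqr_sqrtr// ltW.
have [G [GU infG]] := ultraFilterLemma (eventually_filter : ProperFilter \oo).
have FG : Filter G by exact: _.
have t0 : (fun k => tau k ^+ 2) @ G --> (0 : R).
  have h0 : (fun k : nat => k.+1%:R^-1 : R) @ G --> (0 : R).
    by apply: cvg_trans (@cvg_harmonic R) => A; exact: infG.
  move/cvgrPdist_lt: h0 => h0; apply/cvgrPdist_lt => eps /h0; apply: filterS => k /=.
  rewrite !sub0r !normrN !ger0_norm ?sqr_ge0 ?invr_ge0//; apply: le_lt_trans.
  by rewrite tau2 lef_pV2 ?posrE ?ltr0n//; exact: ltW.
pose zh k := scale_rep (tau k) (z k).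
have Nzh k : rnorm2 (zh k) = 1.
  by rewrite rnorm2_scale tau2 mulVf// gt_eqF.
have [y Gy] : exists y, cvgrep (F := G) zh y.
  by apply: (@ultra_cvgrep R Vt E d s t _ G GU zh 1); apply: filterE => k /=; rewrite Nzh.
have Ny : rnorm2 y = 1.
  have h1 := cvg_rnorm2 FG Gy; have h2 : (fun k => rnorm2 (zh k)) @ G --> (1 : R).
    by under eq_fun do rewrite Nzh; exact: cvg_cstR.
  exact: (cvg_unique _ h1 h2).
have ly : level (fun=> 0) y.
  move=> xi; have h1 : (fun k => wmom (zh k) xi) @ G --> wmom y xi by exact: cvg_wmom.
  have h2 : (fun k => wmom (zh k) xi) @ G --> (0 : C).
    have h3 : (fun k => ofreal (tau k ^+ 2) * \sum_v ofreal (alpha v) * \tr (xi v)) @ G -->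
        (ofreal 0 * \sum_v ofreal (alpha v) * \tr (xi v) : C).
      by apply: cvg_mulK; [exact: cvg_ofreal|exact: cvg_cst].
    rewrite rmorph0 mul0r in h3; apply: cvg_trans h3; apply: near_eq_cvg; apply: filterE => k.
    by rewrite wmom_scale; have [_ h _ _ _] := Hp k; rewrite (h xi).
  rewrite (cvg_uniqueC h1 h2) big1// => v _; by rewrite rmorph0 mul0r.
have l0 : level (fun=> 0) zero_rep.
  move=> xi; rewrite [LHS]big1 => [|e _]; first by rewrite big1// => v _; rewrite rmorph0 mul0r.
  by rewrite /zero_rep !mul0mx !mulmx0 !mxtrace0 subr0.
have cx : cvgrep (F := G) (fun k => scale_rep (tau k) (x k)) zero_rep.
  apply: cvgrep_rnorm2_0.
  have h : (fun k => tau k ^+ 2 * M1) @ G --> (0 : R).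
    by rewrite -[X in _ --> X](mul0r M1); apply: cvgM => //; exact: cvg_cstR.
  move/cvgrPdist_lt: h => h; apply/cvgrPdist_lt => eps /h; apply: filterS => k /=.
  rewrite !sub0r !normrN; apply: le_lt_trans.
  have -> : sub_rep (scale_rep (tau k) (x k)) zero_rep = scale_rep (tau k) (x k).
    by apply: functional_extensionality_dep => e; rewrite /sub_rep subr0.
  rewrite rnorm2_scale ger0_norm; last by apply: mulr_ge0; [exact: sqr_ge0|exact: rnorm2_ge0].
  apply: le_trans (ler_norm _); rewrite ler_wpM2l ?sqr_ge0//.
  by have [h1 _ _ _ _] := Hp k.
have cgx : cvgrep (F := G) (fun k => gact (g k) (scale_rep (tau k) (x k))) y.
  have h1 : cvgrep (F := G) (fun k => sub_rep (gact (g k) (scale_rep (tau k) (x k))) (zh k)) zero_rep.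
    apply: cvgrep_rnorm2_0; move/cvgrPdist_lt: (t0) => ht0.
    apply/cvgrPdist_lt => eps /ht0; apply: filterS => k /=.
    rewrite !sub0r !normrN; apply: le_lt_trans.
    have -> : sub_rep (sub_rep (gact (g k) (scale_rep (tau k) (x k))) (zh k)) zero_rep =
        scale_rep (tau k) (sub_rep (gact (g k) (x k)) (z k)).
      apply: functional_extensionality_dep => e.
      by rewrite gact_scale /sub_rep /zh /scale_rep subr0 scalerBr.
    rewrite rnorm2_scale !ger0_norm; last 2 first.
    - by apply: sqr_ge0.
    - by apply: mulr_ge0; [exact: sqr_ge0|exact: rnorm2_ge0].
    by rewrite ler_piMr ?sqr_ge0//; have [_ _ _ h1 _] := Hp k.
  move=> e i j; have h2 := cvg_addK (h1 e i j) (Gy e i j).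
  rewrite /zero_rep mxE add0r in h2.
  have E1 : (fun k => gact (g k) (scale_rep (tau k) (x k)) e i j) =
      (fun k => sub_rep (gact (g k) (scale_rep (tau k) (x k))) (zh k) e i j + zh k e i j).
    by apply: funext => k; rewrite /sub_rep [X in _ = X + _]mxE [X in _ = _ + X + _]mxE subrK.
  have h3 : (fun k => gact (g k) (scale_rep (tau k) (x k)) e i j) @ G --> (y e i j : C).
    by rewrite E1; exact: h2.
  exact: h3.
have gu k v : g k v \in unitmx by have [_ _ h _ _] := Hp k; exact: h.
have [u [_ yu]] := unitary_orbit_of_limits gu cx cgx l0 ly.
have : rnorm2 y = 0.
  rewrite yu /rnorm2 big1// => e _; rewrite big1// => i _; rewrite big1// => j _.
  by rewrite /uact /zero_rep mulmx0 mul0mx mxE nsq0.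
by rewrite Ny => /eqP; rewrite oner_eq0.
Qed.

Lemma ultra_const (T : Type) (F : set_system T) (UF : UltraFilter F) (I : finType) (f : T -> I) :
  exists c, F [set k | f k = c].
Proof.
apply: contrapT => H.
have h c : F [set k | f k <> c].
  by have [h|//] := in_ultra_setVsetC [set k | f k = c] UF; case: H; exists c.
have : F [set k | forall c, f k <> c] by apply: filter_forall.
by move=> /filter_ex[k /(_ (f k))].
Qed.

Lemma level_semistable alpha (x : rep) : \sum_v (d v)%:R * alpha v = 0 ->
  level alpha x -> coord_semistable alpha x.
Proof.
move=> a0 lx; split=> // w J wu vanish.
pose phi v (i : 'I_(d v)) : R := (J (idx_of i))%:R.
have <- : tpair alpha phi = \sum_(a | J a) alpha (tag a).
  rewrite tpair_idx [RHS]big_mkcond; apply: eq_bigr => -[v i] _ /=.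
  by rewrite /phi /idx_of; case: (J _); rewrite ?mulr1 ?mulr0.
rewrite -(level_diag phi (level_uact wu lx)).
apply: sumr_ge0 => e _; apply: sumr_ge0 => i _; apply: sumr_ge0 => j _.
rewrite /phi; case Ji : (J (idx_of i)); case Jj : (J (idx_of j)).
- by rewrite subrr mul0r.
- by rewrite subr0 mul1r nsq_ge0.
- by rewrite vanish ?Ji// nsq0 mulr0.
- by rewrite subrr mul0r.
Qed.

Lemma semistable_limit (T : Type) (F : set_system T) (UF : UltraFilter F) alpha
  (X : T -> rep) x : cvgrep (F := F) X x -> coord_semistable alpha x ->
  ~ F [set k | ~ coord_semistable alpha (X k)].
Proof.
move=> Xx [a0 ss] bad.
have H k : exists p : ggauge * {ffun idx -> bool}, ~ coord_semistable alpha (X k) ->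
    [/\ forall v, p.1 v \is unitarymx,
    (forall e i j, ~~ p.2 (idx_of i) -> p.2 (idx_of j) -> uact p.1 (X k) e i j = 0) &
    \sum_(a | p.2 a) alpha (tag a) < 0].
  apply: contrapT => h; apply: (h); exists (fun v => 1%:M, [ffun=> true]) => nss.
  exfalso; apply: nss; split=> // w J wu vanish.
  rewrite leNgt; apply/negP => aJ; apply: h; exists (w, [ffun a => J a]) => _; split.
  - exact: wu.
  - by move=> e i j; rewrite !ffunE; exact: vanish.
  - by under eq_bigl do rewrite ffunE.
have [p Hp] := choice H.
pose T' := {k | ~ coord_semistable alpha (X k)}.
have [J FJ] := ultra_const UF (fun k => (p k).2).
pose w k : ggauge := if pselect (~ coord_semistable alpha (X k)) then (p k).1 else fun v => 1%:M.
have wu k v : w k v \is unitarymx.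
  rewrite /w; case E0 : (pselect _) => [nss|nn].
    by have [h _ _] := Hp k nss; exact: h.
  by apply/unitarymxP; rewrite trmx1 map_mx1 mulmx1.
have [w0 w0u ww0] := ultra_unitary_gauge (F := F) wu.
have FF : Filter F by exact: _.
have lim : cvgrep (F := F) (fun k => uact (w k) (X k)) (uact w0 x).
  exact: (cvgrep_uact ww0 Xx).
have [k [/= nss pJ]] := filter_ex (filterI bad FJ).
have aJ : \sum_(a | J a) alpha (tag a) < 0 by have [_ _] := Hp k nss; rewrite pJ.
have := ss w0 J w0u; rewrite leNgt aJ => /(_ _)/negP; apply => // e i j nJ Jj.
have lim0 : (fun k => uact (w k) (X k) e i j) @ F --> (0 : C).
  have c0 : (fun _ : T => 0 : C) @ F --> (0 : C) by exact: cvg_cst.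
  apply: cvg_trans c0; apply: near_eq_cvg; apply: filterS (filterI bad FJ) => k' [/= nss' pJ'].
  have [_ h _] := Hp k' nss'; rewrite pJ' in h.
  by rewrite /w; case E0 : (pselect _) => [nn|nn] //=; rewrite h.
have lim1 := lim e i j.
exact: (@cvg_uniqueC R T F _ _ _ _ lim1 lim0).
Qed.
End RepLimits.

Section Coordinates.
Variables (R : realType) (Vt E : finType) (d : Vt -> nat) (s t : E -> Vt).
Local Notation C := (Cplx R).
Local Notation rep := (@rep R Vt E d s t).
Local Notation ggauge := (@ggauge R Vt d).
Variables (V : normedModType C) (coord : V -> rep) (mk : rep -> V).
Hypothesis coordK : cancel coord mk.
Hypothesis mkK : cancel mk coord.
Hypothesis coord_cvg : forall (T : Type) (F : set_system T), Filter F ->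
  forall (X : T -> V) v, X @ F --> v <-> cvgrep (F := F) (fun k => coord (X k)) (coord v).
Variables (alpha : Vt -> R) (Z : set V).

Definition orbK (x y : V) : Prop :=
  exists u : ggauge, (forall v, u v \is unitarymx) /\ y = mk (gact u (coord x)).
Definition orbKC (x y : V) : Prop :=
  exists g : ggauge, (forall v, g v \in unitmx) /\ y = mk (gact g (coord x)).
Definition levelset : set V := [set v | level alpha (coord v) /\ Z v].

Hypothesis Z_closed : closed Z.
Hypothesis Z_KC : forall x y, orbKC x y -> Z x -> Z y.

Lemma gact1 (x : rep) : gact (fun v => 1%:M) x = x.
Proof.
by apply: functional_extensionality_dep => e; rewrite /gact mul1mx invmx1 mulmx1.
Qed.

Lemma invmx_unitary n (u : 'M[C]_n) : u \is unitarymx -> invmx u = u^t*.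
Proof. by move=> /unitarymxP; exact: invmx_eq. Qed.

Lemma gact_unitary (u : ggauge) (x : rep) : (forall v, u v \is unitarymx) ->
  gact u x = uact u x.
Proof.
move=> uu; apply: functional_extensionality_dep => e.
by rewrite /gact invmx_unitary; [|exact: uu].
Qed.

Lemma unitary1 n : (1%:M : 'M[C]_n) \is unitarymx.
Proof. by apply/unitarymxP; rewrite trmx1 map_mx1 mulmx1. Qed.

Lemma orbKC_refl x : orbKC x x.
Proof.
exists (fun v => 1%:M); split; first by move=> v; exact: unitmx1.
by rewrite gact1 coordK.
Qed.

Lemma gact_mk (g : ggauge) (x : rep) (y : V) :
  (forall v, g v \in unitmx) -> y = mk (gact g x) ->
  x = gact (fun v => invmx (g v)) (coord y).
Proof.
move=> gu ->; rewrite mkK; apply: functional_extensionality_dep => e.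
rewrite /gact invmxK !mulmxA mulVmx; last exact: gu.
rewrite mul1mx -mulmxA mulVmx; last exact: gu.
by rewrite mulmx1.
Qed.

Lemma orbKC_sym x y : orbKC x y -> orbKC y x.
Proof.
move=> [g [gu yE]]; exists (fun v => invmx (g v)); split.
  by move=> v; rewrite unitmx_inv; exact: gu.
by rewrite -(gact_mk gu yE) coordK.
Qed.

Lemma orbKC_trans x y z : orbKC x y -> orbKC y z -> orbKC x z.
Proof.
move=> [g [gu ->]] [h [hu ->]]; exists (mulg h g); split.
  by move=> v; rewrite unitmx_mul; apply/andP; split; [exact: hu|exact: gu].
by rewrite mkK gactM.
Qed.

Lemma orbK_KC x y : orbK x y -> orbKC x y.
Proof.
move=> [u [uu yE]]; exists u; split=> [v|]; last exact: yE.
exact: (unitary_invertible uu).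
Qed.

Lemma orbK_refl x : orbK x x.
Proof.
exists (fun v => 1%:M); split; first by move=> v; exact: unitary1.
by rewrite gact1 coordK.
Qed.

Lemma orbK_sym x y : orbK x y -> orbK y x.
Proof.
move=> [u [uu yE]]; have gu := unitary_invertible uu.
exists (fun v => invmx (u v)); split.
  by move=> v; rewrite invmx_unitary; [rewrite trmxC_unitary; exact: uu|exact: uu].
by rewrite -(gact_mk gu yE) coordK.
Qed.

Lemma orbK_trans x y z : orbK x y -> orbK y z -> orbK x z.
Proof.
move=> [g [gu ->]] [h [hu ->]]; exists (mulg h g); split.
  by move=> v; apply: mul_unitarymx; [exact: hu|exact: gu].
by rewrite mkK (gactM _ (unitary_invertible hu) (unitary_invertible gu)).
Qed.

Lemma cvgrep_gact (T : Type) (F : set_system T) (FF : Filter F) (g : ggauge)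
  (X : T -> rep) x : cvgrep (F := F) X x ->
  cvgrep (F := F) (fun k => gact g (X k)) (gact g x).
Proof.
move=> h e; exact: (cvgmx_mul (FF := FF) (cvgmx_mul (FF := FF)
  (cvgmx_cst (FF := FF) (x := _)) (h e)) (cvgmx_cst (FF := FF) (x := _))).
Qed.

Lemma orbKC_cont x y : orbKC x y -> exists phi : V -> V,
  [/\ phi x = y, continuous phi & forall x', orbKC x' (phi x')].
Proof.
move=> [g [gu yE]]; exists (fun v => mk (gact g (coord v))).
split; [exact: (esym yE)|move=> v|by move=> x'; exists g; split; [exact: gu|]].
have FF : Filter (nbhs v) by exact: _.
have h : cvgrep (F := nbhs v) coord (coord v).
  by apply/(coord_cvg FF (fun q => q) v); exact: cvg_id.
apply/(coord_cvg FF); rewrite mkK.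
under [X in cvgrep X _]funext do rewrite mkK.
exact: cvgrep_gact.
Qed.

Lemma coord_cont v : cvgrep (F := nbhs v) coord (coord v).
Proof.
have FF : Filter (nbhs v) by exact: _.
by apply/(coord_cvg FF (fun q => q) v); exact: cvg_id.
Qed.

Lemma closed_of_limits (A : set V) :
  (forall (F : set_system V) p, ProperFilter F -> F A -> F --> p -> A p) -> closed A.
Proof.
move=> H p cAp; have PF : ProperFilter (within A (nbhs p)).
  apply: Build_ProperFilter; rewrite /within /= => nA.
  by have [q [Aq hq]] := cAp _ nA; exact: hq Aq.
apply: (H (within A (nbhs p)) p PF).
- by rewrite /within /=; apply: filterE.
- by move=> B nB; rewrite /within /=; apply: filterS nB => q Bq _.
Qed.

Lemma levelset_closed : closed levelset.
Proof.
apply: closed_of_limits => F p PF FL Fp; split; last first.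
  apply: Z_closed => B nB.
  by have [q [[_ Zq] Bq]] := filter_ex (filterI FL (Fp _ nB)); exists q.
have FF : Filter F by exact: _.
have h : cvgrep (F := F) coord (coord p) by apply/(coord_cvg FF (fun q => q) p).
move=> xi; have h1 : (fun k => wmom (coord k) xi) @ F --> wmom (coord p) xi by exact: cvg_wmom.
have h2 : (fun k => wmom (coord k) xi) @ F --> (\sum_v ofreal (alpha v) * \tr (xi v) : C).
  have c0 : (fun _ : V => \sum_v ofreal (alpha v) * \tr (xi v) : C) @ F -->
    (\sum_v ofreal (alpha v) * \tr (xi v) : C) by exact: cvg_cst.
  apply: cvg_trans c0; apply: near_eq_cvg; apply: filterS FL => q [lq _].
  by rewrite lq.
exact: (cvg_uniqueC h1 h2).
Qed.

Lemma levelset_separation x y : levelset x -> levelset y ->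
  (forall A B, nbhs x A -> nbhs y B -> exists x' y', [/\ A x', B y' & orbKC x' y']) ->
  orbK x y.
Proof.
move=> [lx _] [ly _] H.
pose T := (V * {g : ggauge | forall v, g v \in unitmx})%type.
pose tr_ (p : T) : V := mk (gact (sval p.2) (coord p.1)).
pose F : set_system T := [set S | exists A B, [/\ nbhs x A, nbhs y B &
   forall p : T, A p.1 -> B (tr_ p) -> S p]].
have PF : ProperFilter F.
  apply: Build_ProperFilter_ex.
    move=> S [A [B [nA nB AB]]]; have [x' [y' [Ax' By' [g [gu y'E]]]]] := H A B nA nB.
    exists (x', exist _ g gu); apply: AB; first exact: Ax'.
    by rewrite /tr_ /= -y'E.
  split.
  - by exists setT, setT; split=> //; exact: filterT.
  - move=> P S [A [B [nA nB AB]]] [A' [B' [nA' nB' AB']]].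
    exists (A `&` A'), (B `&` B'); split; [exact: filterI|exact: filterI|].
    by move=> p [a a'] [b b']; split; [exact: AB|exact: AB'].
  - move=> P S PS [A [B [nA nB AB]]]; exists A, B; split; [exact: nA|exact: nB|].
    by move=> p a b; apply: PS; exact: AB.
have [G [GU infG]] := ultraFilterLemma PF.
have FG : Filter G by exact: _.
have c1 : cvgrep (F := G) (fun p : T => coord p.1) (coord x).
  apply/(coord_cvg FG (fun p : T => p.1)) => A nA; apply: infG.
  by exists A, setT; split=> //; exact: filterT.
have c2 : cvgrep (F := G) (fun p : T => gact (sval p.2) (coord p.1)) (coord y).
  have : tr_ @ G --> y.
    move=> B nB; apply: infG.
    by exists setT, B; split=> //; exact: filterT.
  move/(coord_cvg FG); rewrite /tr_.
  by under [X in cvgrep X _]funext do rewrite mkK.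
have gu (p : T) v : sval p.2 v \in unitmx by exact: (svalP p.2).
have [u [uu yu]] := unitary_orbit_of_limits gu c1 c2 lx ly.
exists u; split; first exact: uu.
by rewrite gact_unitary; [rewrite -yu coordK|exact: uu].
Qed.

Lemma levelset_kempf_ness x : Z x -> coord_semistable alpha (coord x) ->
  exists2 z, levelset z & in_orbit_closure orbKC x z.
Proof.
move=> Zx /level_in_closure[z [W [G [GU Wu Wz lz]]]].
have FG : Filter G by exact: _.
have lim : (fun k => mk (gact (W k) (coord x))) @ G --> mk z.
  apply/(coord_cvg FG); rewrite mkK.
  by under [X in cvgrep X _]funext do rewrite mkK.
have cl : in_orbit_closure orbKC x (mk z).
  move=> B nB; have GB : G [set k | B (mk (gact (W k) (coord x)))] by exact: (lim _ nB).
  have [k /= Bk] := filter_ex GB.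
  exists (mk (gact (W k) (coord x))); first exact: Bk.
  by exists (W k); split; first exact: (Wu k).
exists (mk z); last exact: cl.
split; first by rewrite mkK.
by apply: Z_closed => B /cl[q Bq xq]; exists q; split=> //; exact: Z_KC Zx.
Qed.

Lemma cvg_rnorm2_coord (v : V) : (fun q => rnorm2 (coord q)) @ v --> rnorm2 (coord v).
Proof. by apply: cvg_rnorm2; exact: coord_cont. Qed.

Lemma levelset_proper (x0 : V) : exists2 B : set V, compact B &
  \forall x \near x0, forall z, levelset z -> in_orbit_closure orbKC x z -> B z.
Proof.
have [M HM] := bounded_levels d s t alpha (rnorm2 (coord x0) + 1).
exists [set v | rnorm2 (coord v) <= M].
  rewrite compact_ultra => F UF FM.
  have FF : Filter F by exact: _.
  have [z Fz] := ultra_cvgrep UF FM.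
  have Fmz : F --> mk z.
    by apply/(coord_cvg FF (fun q => q)); rewrite mkK.
  exists (mk z); split=> //=; rewrite mkK.
  apply: (ler_limits (cvg_rnorm2 FF Fz) (cvg_cstR (a := M))).
  exact: FM.
have near1 : \forall x \near x0, rnorm2 (coord x) <= rnorm2 (coord x0) + 1.
  have /cvgrPdist_lt/(_ 1 ltr01) := @cvg_rnorm2_coord x0.
  by apply: filterS => q /=; rewrite distrC => /(le_lt_trans (ler_norm _)); lra.
apply: filterS near1 => x xM z [lz _] xz.
have nz : nbhs z [set q | rnorm2 (sub_rep (coord q) (coord z)) <= 1].
  have FF : Filter (nbhs z) by exact: _.
  have c0 : cvgrep (F := nbhs z) (fun q => sub_rep (coord q) (coord z)) (@zero_rep R Vt E d s t).
    move=> e i j; rewrite /zero_rep mxE -(subrr (coord z e i j)).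
    have h : (fun q => coord q e i j - coord z e i j) @ z --> (coord z e i j - coord z e i j : C).
      have c1 : (fun q => coord q e i j) @ z --> (coord z e i j : C).
        by have := @coord_cont z; exact.
      have c2 : (fun _ : V => coord z e i j) @ z --> (coord z e i j : C) by exact: cvg_cst.
      exact: (cvg_subK FF c1 c2).
    apply: cvg_trans h; apply: near_eq_cvg; apply: filterE => q.
    by rewrite /sub_rep [RHS]mxE [X in _ = _ + X]mxE.
  have := cvg_rnorm2 FF c0.
  have -> : rnorm2 (@zero_rep R Vt E d s t) = 0.
    by rewrite /rnorm2 big1// => e _; rewrite big1// => i _; rewrite big1// => j _; rewrite mxE nsq0.
  move=> /cvgrPdist_lt/(_ 1 ltr01); apply: filterS => q /=.
  by rewrite distrC subr0 => /(le_lt_trans (ler_norm _))/ltW.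
have [q hq [g [gu qE]]] := xz _ nz.
apply: (HM (coord x) (coord z) g xM lz gu).
by move: hq; rewrite /= qE mkK.
Qed.

Lemma semistable_open (p : V) : coord_semistable alpha (coord p) ->
  \forall q \near p, coord_semistable alpha (coord q).
Proof.
move=> sp; apply: contrapT => bad.
pose D := [set q | ~ coord_semistable alpha (coord q)].
have PF : ProperFilter (within D (nbhs p)).
  apply: Build_ProperFilter; rewrite /within /= => nD; apply: bad.
  by apply: filterS nD => v hv; apply: contrapT => /hv.
have [G [GU infG]] := ultraFilterLemma PF.
have FG : Filter G by exact: _.
have Gp : cvgrep (F := G) coord (coord p).
  apply/(coord_cvg FG (fun q => q)) => A nA; apply: infG; rewrite /within /=.
  by apply: filterS nA => q Aq _.
apply: (semistable_limit GU Gp sp); apply: infG; rewrite /within /=.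
exact: filterE.
Qed.

End Coordinates.

Section Families.
Variables (R : realType) (A : finType) (m n : A -> nat).
Local Notation C := (Cplx R).
Local Notation fam := (mxfam C m n).

Lemma fam_mxE (x : fam) a i j : fam_mx x a i j =
  x 0 (enum_rank (existT (fun b => ('I_(m b) * 'I_(n b))%type) a (i, j))).
Proof. by rewrite mxE. Qed.

Lemma mx_famK (X : forall a, 'M[C]_(m a, n a)) : fam_mx (mx_fam X) = X.
Proof.
apply: functional_extensionality_dep => a; apply/matrixP => i j.
by rewrite fam_mxE mxE enum_rankK.
Qed.

Lemma fam_mxK (x : fam) : mx_fam (fam_mx x) = x.
Proof.
apply/rowP => k; rewrite mxE; case E : (enum_val k) => [a [i j]] /=.
by rewrite fam_mxE -E enum_valK.
Qed.

Lemma cvg_row (T : Type) (F : set_system T) (FF : Filter F) N (X : T -> 'rV[C]_N) (v : 'rV[C]_N) :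
  X @ F --> v <-> forall k, (fun t => X t 0 k) @ F --> (v 0 k : C).
Proof.
split=> [h k|h].
  have c := @coord_continuous C 1 N 0 k v.
  exact: (cvg_comp _ _ h c).
apply/cvg_ballP => e e0.
have H k : F [set t | ball (v 0 k) e (X t 0 k)] by exact: (cvg_ball (h k) e0).
have : F [set t | forall k, ball (v 0 k) e (X t 0 k)] by exact: filter_forall.
by apply: filterS => t ht; split=> // i k; rewrite (ord1 i).
Qed.

Lemma fam_cvg (T : Type) (F : set_system T) (FF : Filter F) (X : T -> fam) (v : fam) :
  X @ F --> v <-> forall a, cvgmx F (fun k => fam_mx (X k) a) (fam_mx v a).
Proof.
split=> [/(cvg_row FF) h a i j|h].
  by under eq_fun do rewrite fam_mxE; rewrite fam_mxE; exact: h.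
apply/(cvg_row FF) => k; rewrite -(enum_valK k); case: (enum_val k) => [a [i j]].
by under eq_fun do rewrite -fam_mxE; rewrite -fam_mxE; exact: h.
Qed.
End Families.

Section Transport.
Variables (C : numClosedFieldType) (Vt E : finType) (d : Vt -> nat) (s t : E -> Vt).

Lemma trace_conform (f : E -> Vt) (xi : forall v, 'M[C]_(d v)) (N : forall e, 'M[C]_(d (f e))) :
  \sum_v \tr (xi v *m \sum_(e | f e == v) conform_mx 0 (N e)) =
  \sum_e \tr (xi (f e) *m N e).
Proof.
under eq_bigr do rewrite mulmx_sumr raddf_sum.
rewrite (exchange_big_dep predT) //=; apply: eq_bigr => e _.
by rewrite (big_pred1 (f e)) ?conform_mx_id // => v; rewrite eq_sym.
Qed.

Lemma trace_moment (xi : forall v, 'M[C]_(d v))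
    (N : forall e, 'M[C]_(d (t e))) (N' : forall e, 'M[C]_(d (s e))) :
  \sum_v \tr (xi v *m (\sum_(e | t e == v) conform_mx 0 (N e) -
                       \sum_(e | s e == v) conform_mx 0 (N' e))) =
  \sum_e (\tr (xi (t e) *m N e) - \tr (xi (s e) *m N' e)).
Proof.
under eq_bigr do rewrite mulmxBr raddfB /=.
by rewrite !sumrB /= !trace_conform.
Qed.

Lemma trace_moment_double (xi : forall v, 'M[C]_(d v))
    (N1 N2 : forall e, 'M[C]_(d (t e))) (N1' N2' : forall e, 'M[C]_(d (s e))) :
  \sum_v \tr (xi v *m (\sum_(e | t e == v) conform_mx 0 (N1 e - N2 e) +
                       \sum_(e | s e == v) conform_mx 0 (N1' e - N2' e))) =
  \sum_e (\tr (xi (t e) *m N1 e) - \tr (xi (s e) *m N2' e)) +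
  \sum_e (\tr (xi (s e) *m N1' e) - \tr (xi (t e) *m N2 e)).
Proof.
under eq_bigr do rewrite mulmxDr raddfD /=.
rewrite [LHS]big_split /= !trace_conform -!big_split /=; apply: eq_bigr => e _.
by rewrite !mulmxBr !raddfB /=; ring.
Qed.

Lemma conform_mxB p q p' q' (X Y : 'M[C]_(p, q)) :
  conform_mx (0 : 'M[C]_(p', q')) (X - Y) = conform_mx 0 X - conform_mx 0 Y.
Proof.
have [e1|n1] := eqVneq p p'; last by rewrite !nonconform_mx ?n1 // subr0.
have [e2|n2] := eqVneq q q'; last by rewrite !nonconform_mx ?n2 ?orbT // subr0.
by subst p' q'; rewrite !conform_mx_id.
Qed.

(* the trace form detects zero *)
Lemma trace_form_eq0 (M : forall v, 'M[C]_(d v)) :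
  \sum_v \tr ((M v)^t* *m M v) = 0 -> forall v, M v = 0.
Proof.
have tE n (B : 'M[C]_n) : \tr (B^t* *m B) = \sum_i \sum_j `|B j i| ^+ 2.
  apply: eq_bigr => i _; rewrite mxE; apply: eq_bigr => j _.
  by rewrite !mxE normCKC.
have t0 n (B : 'M[C]_n) : 0 <= \tr (B^t* *m B).
  by rewrite tE; apply: sumr_ge0 => i _; apply: sumr_ge0 => j _; rewrite exprn_ge0.
move=> H v; have /= := psumr_eq0P (fun v _ => t0 _ (M v)) H => /(_ v isT).
rewrite tE => H1; apply/matrixP => j i; rewrite mxE.
have H2 : \sum_j `|M v j i| ^+ 2 = 0.
  apply: (psumr_eq0P _ H1) => [k _|//].
  by apply: sumr_ge0 => l _; rewrite exprn_ge0.
have := psumr_eq0P _ H2 => /(_ _ j isT) h.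
apply/eqP; rewrite -normr_eq0 -sqrf_eq0; apply/eqP; apply: h => k _.
by rewrite exprn_ge0.
Qed.

Lemma trace_form_ext (M N : forall v, 'M[C]_(d v)) :
  (forall xi : forall v, 'M[C]_(d v),
    \sum_v \tr (xi v *m M v) = \sum_v \tr (xi v *m N v)) ->
  forall v, M v = N v.
Proof.
move=> H v; apply/eqP; rewrite -subr_eq0; apply/eqP; move: v.
apply: trace_form_eq0.
under eq_bigr do rewrite mulmxBr raddfB.
by rewrite sumrB H subrr.
Qed.
Lemma trace_scalar_sum (xi : forall v, 'M[C]_(d v)) (a : Vt -> C) :
  \sum_v \tr (xi v *m (a v)%:M) = \sum_v a v * \tr (xi v).
Proof. by apply: eq_bigr => v _; rewrite mul_mx_scalar mxtraceZ. Qed.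
End Transport.

Section Moments.
Variables (R : realType) (Q : quiver) (d : vert Q -> nat).
Local Notation C := (Cplx R).
Local Notation Rep := (mxfam C (fun a => d (tgt a)) (fun a => d (src a))).
Local Notation Rep' := (mxfam C (fun a => d (src a)) (fun a => d (tgt a))).

Lemma moment_level (alpha : vert Q -> R) (x : Rep) :
  (forall v, moment x v = (ofreal (alpha v))%:M) <->
  level (s := @src Q) (t := @tgt Q) alpha (fam_mx x).
Proof.
have W xi : \sum_v \tr (xi v *m moment x v) = wmom (s := @src Q) (t := @tgt Q) (fam_mx x) xi.
  exact: (trace_moment xi (fun a => fam_mx x a *m (fam_mx x a)^t*)
    (fun a => (fam_mx x a)^t* *m fam_mx x a)).
have W' (xi : forall v, 'M[C]_(d v)) : \sum_v \tr (xi v *m (ofreal (alpha v))%:M) =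
    \sum_v ofreal (alpha v) * \tr (xi v).
  exact: trace_scalar_sum.
split=> [h xi|h]; first last.
  apply: trace_form_ext => xi; apply: etrans (W xi) _.
  by apply: etrans (h xi) _; exact: (esym (W' xi)).
apply: etrans (esym (W xi)) _; apply: etrans (W' xi).
by apply: eq_bigr => v _; rewrite h.
Qed.

(* The quiver doubled by the opposite of each arrow *)
Definition dsrc (e : arr Q + arr Q) : vert Q :=
  match e with inl a => src a | inr a => tgt a end.
Definition dtgt (e : arr Q + arr Q) : vert Q :=
  match e with inl a => tgt a | inr a => src a end.

Definition dcoord (p : Rep * Rep') : @rep R _ _ d dsrc dtgt :=
  fun e => match e with inl a => fam_mx p.1 a | inr a => fam_mx p.2 a end.

Definition dmk (X : @rep R _ _ d dsrc dtgt) : Rep * Rep' :=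
  (mx_fam (fun a => X (inl a)), mx_fam (fun a => X (inr a))).

Lemma dcoordK : cancel dcoord dmk.
Proof. by case=> x y; rewrite /dmk /dcoord /= !fam_mxK. Qed.

Lemma dmkK : cancel dmk dcoord.
Proof.
move=> X; apply: functional_extensionality_dep => -[a|a];
by rewrite /dcoord /dmk /= mx_famK.
Qed.

Lemma moment_real_level (alpha : vert Q -> R) (p : Rep * Rep') :
  (forall v, moment_real p v = (ofreal (alpha v))%:M) <-> level alpha (dcoord p).
Proof.
have W xi : \sum_v \tr (xi v *m moment_real p v) = wmom (dcoord p) xi.
  rewrite /wmom big_sumType /=.
  exact: (trace_moment_double xi
    (fun a => fam_mx p.1 a *m (fam_mx p.1 a)^t*) (fun a => (fam_mx p.2 a)^t* *m fam_mx p.2 a)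
    (fun a => fam_mx p.2 a *m (fam_mx p.2 a)^t*) (fun a => (fam_mx p.1 a)^t* *m fam_mx p.1 a)).
have W' (xi : forall v, 'M[C]_(d v)) : \sum_v \tr (xi v *m (ofreal (alpha v))%:M) =
    \sum_v ofreal (alpha v) * \tr (xi v).
  exact: trace_scalar_sum.
split=> [h xi|h]; first last.
  apply: trace_form_ext => xi; apply: etrans (W xi) _.
  by apply: etrans (h xi) _; exact: (esym (W' xi)).
apply: etrans (esym (W xi)) _; apply: etrans (W' xi).
by apply: eq_bigr => v _; rewrite h.
Qed.

Definition cwmom (p : Rep * Rep') (xi : forall v, 'M[C]_(d v)) : C :=
  \sum_a (\tr (xi (tgt a) *m (fam_mx p.1 a *m fam_mx p.2 a)) -
          \tr (xi (src a) *m (fam_mx p.2 a *m fam_mx p.1 a))).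

Lemma moment_cplx_weak (p : Rep * Rep') :
  (forall v, moment_cplx p v = 0) <-> forall xi, cwmom p xi = 0.
Proof.
have W xi : \sum_v \tr (xi v *m moment_cplx p v) = cwmom p xi.
  exact: (trace_moment xi (fun a => fam_mx p.1 a *m fam_mx p.2 a)
    (fun a => fam_mx p.2 a *m fam_mx p.1 a)).
split=> [h xi|h].
  by rewrite -W; rewrite big1 // => v _; rewrite h mulmx0 mxtrace0.
apply: trace_form_ext => xi; rewrite W h big1 // => v _.
by rewrite mulmx0 mxtrace0.
Qed.

End Moments.

Section CotangentCoordinates.
Variables (R : realType) (Q : quiver) (d : vert Q -> nat).
Local Notation C := (Cplx R).
Local Notation Rep := (mxfam C (fun a => d (tgt a)) (fun a => d (src a))).
Local Notation Rep' := (mxfam C (fun a => d (src a)) (fun a => d (tgt a))).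
Local Notation dcoord := (@dcoord R Q d).
Local Notation dmk := (@dmk R Q d).

Lemma dcoord_cvg (T : Type) (F : set_system T) (FF : Filter F) (X : T -> Rep * Rep') (v : Rep * Rep') :
  X @ F --> v <-> cvgrep (F := F) (fun k => dcoord (X k)) (dcoord v).
Proof.
split=> [h [a|a]|h].
- have h1 : (fun k => (X k).1) @ F --> v.1 by apply: (cvg_comp _ _ h); exact: cvg_fst.
  by move/(fam_cvg FF): h1; exact.
- have h1 : (fun k => (X k).2) @ F --> v.2 by apply: (cvg_comp _ _ h); exact: cvg_snd.
  by move/(fam_cvg FF): h1; exact.
have h1 : (fun k => (X k).1) @ F --> v.1.
  by apply/(fam_cvg FF) => a; exact: (h (inl a)).
have h2 : (fun k => (X k).2) @ F --> v.2.
  by apply/(fam_cvg FF) => a; exact: (h (inr a)).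
have XE : X = (fun k => ((X k).1, (X k).2)) by apply: funext => k; case: (X k).
by rewrite XE; exact: (cvg_pair h1 h2).
Qed.

Definition cplx_level : set (Rep * Rep')%type := [set p | forall v, moment_cplx p v = 0].

Lemma cplx_level_closed : closed cplx_level.
Proof.
apply: (@closed_of_limits R (Rep * Rep')%type) => F p PF FZ Fp.
have FF : Filter F by exact: _.
apply/moment_cplx_weak => xi.
have c : cvgrep (F := F) dcoord (dcoord p) by apply/(dcoord_cvg FF (fun q => q)).
have h1 : (fun q => cwmom q xi) @ F --> (cwmom p xi : C).
  apply: cvg_sumK => a _.
  have c1 : cvgmx F (fun q : (Rep * Rep')%type => xi (tgt a) *m (fam_mx q.1 a *m fam_mx q.2 a))
      (xi (tgt a) *m (fam_mx p.1 a *m fam_mx p.2 a)).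
    exact: (cvgmx_mul (FF := FF) (cvgmx_cst (FF := FF) (x := _))
      (cvgmx_mul (FF := FF) (c (inl a)) (c (inr a)))).
  have c2 : cvgmx F (fun q : (Rep * Rep')%type => xi (src a) *m (fam_mx q.2 a *m fam_mx q.1 a))
      (xi (src a) *m (fam_mx p.2 a *m fam_mx p.1 a)).
    exact: (cvgmx_mul (FF := FF) (cvgmx_cst (FF := FF) (x := _))
      (cvgmx_mul (FF := FF) (c (inr a)) (c (inl a)))).
  exact: (cvg_subK FF (cvg_trace FF c1) (cvg_trace FF c2)).
have h2 : (fun q => cwmom q xi) @ F --> (0 : C).
  have c0 : (fun _ : (Rep * Rep')%type => 0 : C) @ F --> (0 : C) by exact: cvg_cst.
  apply: cvg_trans c0; apply: near_eq_cvg; apply: filterS FZ => q Zq.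
  by move/moment_cplx_weak: Zq => ->.
exact: (cvg_uniqueC h1 h2).
Qed.

Lemma trace_act m n (xi g : 'M[C]_m) (h : 'M[C]_n) (x : 'M[C]_(m, n)) (y : 'M[C]_(n, m)) :
  h \in unitmx ->
  \tr (xi *m (g *m x *m invmx h *m (h *m y *m invmx g))) =
  \tr (invmx g *m xi *m g *m (x *m y)).
Proof.
move=> hu; rewrite -!mulmxA (mulmxA (invmx h)) mulVmx; last exact: hu.
by rewrite mul1mx !mulmxA mxtrace_mulC !mulmxA.
Qed.

Lemma cplx_level_orbKC (p q : Rep * Rep') :
  orbKC dcoord dmk p q -> cplx_level p -> cplx_level q.
Proof.
move=> [g [gu ->]] /moment_cplx_weak Zp; apply/moment_cplx_weak => xi.
rewrite -(Zp (fun v => invmx (g v) *m xi v *m g v)); apply: eq_bigr => a _.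
rewrite /dmk /= !mx_famK /gact /=.
by rewrite !trace_act; [|exact: gu|exact: gu].
Qed.
End CotangentCoordinates.

Section LinearAlgebra.
Variable F : fieldType.

Lemma row_full_mul m n p (A : 'M[F]_(m, n)) (B : 'M[F]_(n, p)) :
  row_full A -> row_full B -> row_full (A *m B).
Proof.
move=> /row_fullP[A' hA] /row_fullP[B' hB]; apply/row_fullP; exists (B' *m A').
by rewrite -mulmxA (mulmxA A') hA mul1mx.
Qed.

Lemma row_full_mulr m n p (A : 'M[F]_(m, n)) (B : 'M[F]_(n, p)) :
  row_full (A *m B) -> row_full B.
Proof.
by move=> /row_fullP[D h]; apply/row_fullP; exists (D *m A); rewrite -mulmxA.
Qed.

Lemma row_full_cancel m n p (A : 'M[F]_(m, n)) (B B' : 'M[F]_(n, p)) :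
  row_full A -> A *m B = A *m B' -> B = B'.
Proof.
by move=> /row_fullP[D h] e; rewrite -(mul1mx B) -h -mulmxA e mulmxA h mul1mx.
Qed.

Lemma row_full_kernel m n (A : 'M[F]_(m, n)) :
  (forall c : 'cV[F]_n, A *m c = 0 -> c = 0) -> row_full A.
Proof.
move=> H; rewrite -[row_full A]/(\rank A == n) -mxrank_tr -/(row_free A^T) -kermx_eq0.
apply/rowV0P => v /sub_kermxP h; apply: (can_inj (@trmxK _ _ _)).
by rewrite trmx0; apply: H; apply: (can_inj (@trmxK _ _ _)); rewrite trmx_mul trmxK h trmx0.
Qed.

Lemma row_full_unit n (A : 'M[F]_n) : row_full A = (A \in unitmx).
Proof. exact: row_full_unit. Qed.

Definition mxim m n (A : 'M[F]_(m, n)) : {vspace 'cV[F]_m} := limg (linfun (mulmx A : 'cV[F]_n -> _)).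

Lemma mximP m n (A : 'M[F]_(m, n)) (u : 'cV[F]_m) :
  reflect (exists c, u = A *m c) (u \in mxim A).
Proof.
apply: (iffP memv_imgP) => [[c _ ->]|[c ->]]; first by exists c; rewrite lfunE.
by exists c; rewrite ?memvf // lfunE.
Qed.

Lemma dim_mxim m n (A : 'M[F]_(m, n)) : row_full A -> \dim (mxim A) = n.
Proof.
move=> fA; rewrite limg_dim_eq ?dimvf /dim /= ?muln1 //.
have -> : (fullv :&: lker (linfun (mulmx A : 'cV[F]_n -> _)) = 0)%VS; last by [].
apply/eqP; rewrite capfv -subv0; apply/subvP => c; rewrite memv_ker lfunE memv0 /=.
by move=> /eqP h; apply/eqP; apply: (row_full_cancel fA); rewrite h mulmx0.
Qed.

Lemma mxim_subP m n p (A : 'M[F]_(m, n)) (B : 'M[F]_(m, p)) :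
  reflect (exists c, A = B *m c) (mxim A <= mxim B)%VS.
Proof.
apply: (iffP subvP) => [H|[c ->] u /mximP[x ->]]; last first.
  by apply/mximP; exists (c *m x); rewrite mulmxA.
have h j : {c | col j A = B *m c}.
  apply: cid; apply/mximP; apply: H; apply/mximP; exists (delta_mx j 0).
  by rewrite -colE.
exists (\matrix_(i, j) sval (h j) i 0); apply/matrixP => i j.
have := congr1 (fun u : 'cV[F]_m => u i 0) (svalP (h j)).
rewrite [LHS]mxE => ->; rewrite !mxE; apply: eq_bigr => k _; by rewrite !mxE.
Qed.

Lemma mxim_eq_unit m n (A B : 'M[F]_(m, n)) : row_full B -> mxim A = mxim B -> row_full A ->
  exists2 c, c \in unitmx & A = B *m c.
Proof.
move=> fB e fA; have /mxim_subP[c Ac] : (mxim A <= mxim B)%VS by rewrite e subvv.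
exists c => //; rewrite -row_full_unit; apply: (@row_full_mulr _ _ _ B).
by rewrite -Ac.
Qed.
End LinearAlgebra.

Section StarAlgebra.
Variables (R : realType) (n r : nat) (Q : star_quiver n r).
Local Notation C := (Cplx R).
Local Notation S := (star Q).
Local Notation Rep := (mxfam C (fun a : arr S => star_dim (tgt a)) (fun a : arr S => star_dim (src a))).
Local Notation Rep' := (mxfam C (fun a : arr S => star_dim (src a)) (fun a : arr S => star_dim (tgt a))).

Lemma star_arr_eq (a b : star_arr Q) : tag a = tag b -> tagged a = tagged b :> nat -> a = b.
Proof.
case: a => i [j lt]; case: b => i' [j' lt'] /= e; subst i' => /= e; subst j'.
by rewrite (bool_irrelevance lt lt').
Qed.

Lemma star_tgt_tag (a b : star_arr Q) : star_tgt a = Some b ->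
  tag a = tag b /\ tagged a = (tagged b).+1 :> nat.
Proof. by case: a => i [[|j] lt] //= [<-]. Qed.

Lemma star_vert_ind (P : vert S -> Prop) : P None ->
  (forall a : arr S, P (tgt a) -> P (Some a)) -> forall v, P v.
Proof.
move=> P0 PS [[i [j lt]]|//]; elim: j lt => [|j IH] lt.
  by apply: (PS (existT _ i (Ordinal lt))).
by apply: (PS (existT _ i (Ordinal lt))); exact: IH.
Qed.

(* The composite of the arrows from a vertex to the sink *)
Definition Tv (x : Rep) (v : vert S) : 'M[C]_(r, star_dim v) :=
  match v as v return 'M[C]_(r, star_dim v) with
  | None => 1%:M
  | Some (existT i (Ordinal j lt)) => to_sink x lt
  end.

Lemma TvE (x : Rep) (a : arr S) : Tv x (Some a) = Tv x (tgt a) *m fam_mx x a.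
Proof. by case: a => i [[|j] lt] //=; rewrite mul1mx. Qed.

Definition pathv (i : 'I_n) (j : nat) : vert S :=
  match j with
  | 0%N => None
  | j'.+1 => if (insub j' : option 'I_(len Q i)) is Some k
             then Some (existT (fun i => 'I_(len Q i)) i k) else None
  end.

Lemma pathv_arr (a : arr S) : pathv (tag a) (tagged a).+1 = Some a.
Proof.
case: a => i k /=; rewrite /pathv; case: insubP => [k' _ e|].
  by congr (Some (existT _ _ _)); apply: val_inj.
by rewrite ltn_ord.
Qed.

Lemma pathv_tgt (a : arr S) : pathv (tag a) (tagged a) = tgt a.
Proof.
case: a => i [[|j] lt] //=; case: insubP => [k' _ e|]; last by rewrite ltnW.
by congr (Some _); apply: star_arr_eq.
Qed.

Lemma pathvS i j : (j < len Q i)%N ->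
  exists a : arr S, [/\ pathv i j.+1 = Some a, pathv i j = tgt a, tag a = i & tagged a = j :> nat].
Proof.
move=> lt; exists (star_vtx lt); split=> //.
  exact: (pathv_arr (star_vtx lt)).
exact: (pathv_tgt (star_vtx lt)).
Qed.

Lemma star_dim_pathv i j : (j <= len Q i)%N -> star_dim (pathv i j) = dimp Q i j.
Proof.
case: j => [|j] lt; first by rewrite dimp_sink.
by have [a [-> _ <- <-]] := pathvS lt.
Qed.

Lemma colspanE k (g : 'M[C]_(r, k)) : colspan g = mxim g.
Proof.
apply/eqP; rewrite eqEsubv; apply/andP; split.
  apply/span_subvP => u /mapP[l _ ->]; apply/mximP; exists (delta_mx l 0).
  by rewrite -colE.
apply/subvP => u /mximP[c ->].
have -> : g *m c = \sum_l c l 0 *: col l g.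
  apply/matrixP => i j; rewrite (ord1 j) mxE summxE; apply: eq_bigr => l _.
  by rewrite !mxE mulrC.
apply: memv_suml => l _; apply: memvZ; apply: memv_span; apply/mapP.
by exists l => //; rewrite mem_enum.
Qed.

Lemma mxim1 : mxim (1%:M : 'M[C]_r) = fullv.
Proof.
apply/eqP; rewrite eqEsubv subvf /=; apply/subvP => u _.
by apply/mximP; exists u; rewrite mul1mx.
Qed.

Lemma parabolic_of_repE (x : Rep) i j :
  parabolic_of_rep x i j = if (j <= len Q i)%N then mxim (Tv x (pathv i j)) else 0%VS.
Proof.
case: j => [|j] /=; first by rewrite mxim1.
case: insubP => [[k lt] h /= e|/negPf->//]; subst k.
by rewrite h colspanE (bool_irrelevance (ltn_ord (Ordinal lt)) lt).
Qed.

Definition inj_arrows (x : Rep) : Prop := forall a : arr S, row_full (fam_mx x a).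

Lemma inj_Tv x : inj_arrows x -> forall v, row_full (Tv x v).
Proof.
move=> Ix; apply: star_vert_ind => [|a h].
  by rewrite /Tv row_full_unit; exact: unitmx1.
by rewrite TvE; apply: row_full_mul; [exact: h|exact: Ix].
Qed.

Lemma Tv_inj x : (forall a : arr S, row_full (Tv x (Some a))) -> inj_arrows x.
Proof. by move=> h a; have := h a; rewrite TvE => /row_full_mulr. Qed.

Lemma parabolic_of_rep_valid x : inj_arrows x -> is_parabolic Q (parabolic_of_rep x).
Proof.
move=> Ix i; split=> [|j jl|j jl|j jl]; first by [].
- rewrite !parabolic_of_repE jl; case: ifP => [lt|_]; last exact: sub0v.
  have [a [-> -> _ _]] := pathvS lt; apply/mxim_subP.
  by exists (fam_mx x a); rewrite TvE.
- rewrite parabolic_of_repE jl dim_mxim; last exact: inj_Tv.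
  exact: star_dim_pathv.
- by rewrite parabolic_of_repE leqNgt jl.
Qed.

Lemma Tv_act (g : gauge R (@star_dim n r Q)) x v : (forall v, g v \in unitmx) ->
  Tv (act g x) v = g None *m Tv x v *m invmx (g v).
Proof.
move=> gu; move: v; apply: star_vert_ind => [|a h].
  by rewrite /Tv mulmx1 mulmxV; [|exact: gu].
rewrite !TvE h /act mx_famK !mulmxA -(mulmxA _ (invmx _)) mulVmx; last exact: gu.
by rewrite mulmx1.
Qed.

Lemma mximg_mxim k (h : 'M[C]_r) (T : 'M[C]_(r, k)) : mximg h (mxim T) = mxim (h *m T).
Proof.
apply/vspaceP => u; apply/memv_imgP/mximP => [[_ /mximP[c ->] ->]|[c ->]].
  by exists c; rewrite lfunE /= mulmxA.
exists (T *m c); first by apply/mximP; exists c.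
by rewrite lfunE /= mulmxA.
Qed.

Lemma mxim_mulr m k (T : 'M[C]_(m, k)) c : c \in unitmx -> mxim (T *m c) = mxim T.
Proof.
move=> cu; apply/eqP; rewrite eqEsubv; apply/andP; split.
  by apply/mxim_subP; exists c.
by apply/mxim_subP; exists (invmx c); rewrite mulmxK //; exact: cu.
Qed.

Lemma mximg0 (h : 'M[C]_r) : mximg h 0%VS = 0%VS.
Proof. by rewrite /mximg limg0. Qed.

Lemma parabolic_of_rep_act (g : gauge R (@star_dim n r Q)) x : (forall v, g v \in unitmx) ->
  parabolic_of_rep (act g x) = flags_act (g None) (parabolic_of_rep x).
Proof.
move=> gu; apply: funext => i; apply: funext => j.
rewrite /flags_act (parabolic_of_repE (act g x)) (parabolic_of_repE x).
case: (j <= len Q i)%N; last exact: (esym (mximg0 _)).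
rewrite mximg_mxim Tv_act; last exact: gu.
by rewrite mxim_mulr; [|rewrite unitmx_inv; exact: gu].
Qed.

Lemma mxim_flag (x y : Rep) (h : 'M[C]_r) v :
  parabolic_of_rep y = flags_act h (parabolic_of_rep x) -> h \in unitmx ->
  mxim (Tv y v) = mxim (h *m Tv x v).
Proof.
move=> e hu; case: v => [a|].
  have := congr1 (fun F : flags R n r => F (tag a) (tagged a).+1) e.
  by rewrite /flags_act !parabolic_of_repE ltn_ord !pathv_arr mximg_mxim.
by rewrite /Tv mulmx1 -[X in _ = mxim X](mul1mx h) mxim_mulr; [|exact: hu].
Qed.

Lemma matching_frames (x y : Rep) (h : 'M[C]_r) : inj_arrows x -> inj_arrows y -> h \in unitmx ->
  parabolic_of_rep y = flags_act h (parabolic_of_rep x) ->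
  exists g : gauge R (@star_dim n r Q), [/\ forall v, g v \in unitmx, g None = h &
    forall v, Tv y v *m g v = h *m Tv x v].
Proof.
move=> Ix Iy hu e.
have hf : row_full h by rewrite row_full_unit; exact: hu.
have H v : {c | (c \in unitmx) /\ h *m Tv x v = Tv y v *m c}.
  apply: cid; have [c cu E] := mxim_eq_unit (inj_Tv Iy v) (esym (mxim_flag v e hu))
    (row_full_mul hf (inj_Tv Ix v)).
  by exists c; split; [exact: cu|exact: E].
exists (fun v => sval (H v)); split=> [v||v].
- have [h1 _] := svalP (H v); exact: h1.
- by case: (H None) => c /= [_]; rewrite /Tv mulmx1 mul1mx.
- by have [_] := svalP (H v).
Qed.

Lemma act_of_frames (x y : Rep) (h : 'M[C]_r) (g : gauge R (@star_dim n r Q)) : inj_arrows y ->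
  (forall v, g v \in unitmx) -> (forall v, Tv y v *m g v = h *m Tv x v) -> y = act g x.
Proof.
move=> Iy gu e; rewrite -(fam_mxK y); congr mx_fam; apply: functional_extensionality_dep => a.
suff E : fam_mx y a *m g (src a) = g (tgt a) *m fam_mx x a.
  by rewrite -E mulmxK //; exact: gu.
apply: (row_full_cancel (inj_Tv Iy (tgt a))).
by rewrite !mulmxA -TvE e e TvE mulmxA.
Qed.

(* The cotangent directions *)

Lemma sink_residueE (p : Rep * Rep') i (lt : (0 < len Q i)%N) :
  sink_residue p i = fam_mx p.1 (star_vtx lt : arr S) *m fam_mx p.2 (star_vtx lt : arr S).
Proof. by rewrite /sink_residue (bool_irrelevance (len_gt0 Q i) lt). Qed.

Lemma moment_path (p : Rep * Rep') (a : arr S) : moment_cplx p (Some a) =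
  \sum_(b : arr S | tgt b == Some a) conform_mx 0 (fam_mx p.1 b *m fam_mx p.2 b) -
  fam_mx p.2 a *m fam_mx p.1 a.
Proof.
by rewrite /moment_cplx; congr (_ - _); rewrite (big_pred1 a) // conform_mx_id.
Qed.

Lemma moment_next (p : Rep * Rep') i j (lt : (j.+1 < len Q i)%N) :
  moment_cplx p (Some (star_vtx (ltnW lt))) =
  fam_mx p.1 (star_vtx lt : arr S) *m fam_mx p.2 (star_vtx lt : arr S) -
  fam_mx p.2 (star_vtx (ltnW lt) : arr S) *m fam_mx p.1 (star_vtx (ltnW lt) : arr S).
Proof.
rewrite moment_path; congr (_ - _).
rewrite (big_pred1 (star_vtx lt : arr S)); first by rewrite conform_mx_id.
move=> b; apply/eqP/eqP => [e|-> //].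
have [e1 e2] := star_tgt_tag e; exact: star_arr_eq.
Qed.

Lemma moment_last (p : Rep * Rep') (a : arr S) : (tagged a).+1 = len Q (tag a) ->
  moment_cplx p (Some a) = - (fam_mx p.2 a *m fam_mx p.1 a).
Proof.
move=> la; rewrite moment_path big_pred0 ?sub0r // => b; apply/eqP => e.
have [e1 e2] := star_tgt_tag e; have := ltn_ord (tagged b).
by rewrite e2 la e1 ltnn.
Qed.

Lemma moment_sink (p : Rep * Rep') : moment_cplx p None = \sum_i sink_residue p i.
Proof.
rewrite /moment_cplx [X in _ - X]big_pred0 ?subr0 //.
rewrite (reindex_onto (fun i => star_vtx (len_gt0 Q i) : arr S) (fun a => tag a)).
  rewrite (eq_bigl predT) => [|i]; last by rewrite /= eqxx /=; case: (len_gt0 Q i).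
  by apply: eq_bigr => i _; rewrite conform_mx_id.
case=> i [[|j] lt] //= _; by apply: star_arr_eq.
Qed.

Lemma residue_relation (p : Rep * Rep') : cplx_level p -> forall a : arr S,
  Tv p.1 (Some a) *m fam_mx p.2 a = sink_residue p (tag a) *m Tv p.1 (tgt a).
Proof.
move=> Zp [i [j lt]]; elim: j lt => [|j IH] lt.
  by rewrite (sink_residueE p lt) mulmx1.
rewrite TvE -mulmxA.
have := Zp (Some (star_vtx (ltnW lt))); rewrite (moment_next p lt) => /eqP.
rewrite subr_eq0 => /eqP e.
rewrite [X in _ *m X = _]e.
have := IH (ltnW lt) => /= IH'.
rewrite mulmxA [LHS](congr1 (mulmx^~ _) IH') -mulmxA; congr (_ *m _).
by have := TvE p.1 (star_vtx (ltnW lt)).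
Qed.

Lemma sink_residue_sum (p : Rep * Rep') : cplx_level p -> \sum_i sink_residue p i = 0.
Proof. by move=> Zp; have := Zp None; rewrite moment_sink. Qed.

Lemma residue_last (p : Rep * Rep') (a : arr S) : cplx_level p ->
  (tagged a).+1 = len Q (tag a) -> sink_residue p (tag a) *m Tv p.1 (Some a) = 0.
Proof.
move=> Zp la; rewrite TvE mulmxA -residue_relation // -mulmxA.
by have := Zp (Some a); rewrite moment_last // => /eqP; rewrite oppr_eq0 => /eqP ->; rewrite mulmx0.
Qed.

Lemma cplx_level_intro (p : Rep * Rep') (A : 'I_n -> 'M[C]_r) : inj_arrows p.1 ->
  \sum_i A i = 0 ->
  (forall a : arr S, Tv p.1 (Some a) *m fam_mx p.2 a = A (tag a) *m Tv p.1 (tgt a)) ->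
  (forall a : arr S, (tagged a).+1 = len Q (tag a) -> A (tag a) *m Tv p.1 (Some a) = 0) ->
  cplx_level p /\ forall i, sink_residue p i = A i.
Proof.
move=> Ip A0 rel lst.
have res i : sink_residue p i = A i.
  have := rel (star_vtx (len_gt0 Q i)); rewrite /sink_residue.
  rewrite TvE.
  have -> : A (tag (star_vtx (len_gt0 Q i) : star_arr Q)) = A i by [].
  by move: (len_gt0 Q i) => lt /=; rewrite mul1mx mulmx1.
split; last exact: res.
case=> [[i [j lt]]|]; last first.
  by rewrite moment_sink; under eq_bigr do rewrite res.
apply: (row_full_cancel (inj_Tv Ip (Some (existT _ i (Ordinal lt))))); rewrite mulmx0.
have [la|nl] := eqVneq j.+1 (len Q i).
  rewrite moment_last // mulmxN mulmxA rel -mulmxA -TvE.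
  by rewrite (lst (existT _ i (Ordinal lt))) // oppr0.
have lt' : (j.+1 < len Q i)%N by rewrite ltn_neqAle nl.
rewrite (bool_irrelevance lt (ltnW lt')).
rewrite (moment_next p lt') mulmxBr !mulmxA.
have := rel (star_vtx lt'); rewrite TvE => e1.
rewrite [X in X - _]e1.
have e2 := rel (star_vtx (ltnW lt')).
rewrite [X in _ - X *m _]e2 -mulmxA.
have := TvE p.1 (star_vtx (ltnW lt')) => /= <-.
by rewrite subrr.
Qed.

End StarAlgebra.

Section ColumnMatrices.
Variable F : fieldType.

Definition colmx m k (X : k.-tuple 'cV[F]_m) : 'M[F]_(m, k) :=
  \matrix_(i, j) tnth X j i 0.

Lemma colmx_mul m k (X : k.-tuple 'cV[F]_m) (c : 'cV[F]_k) :
  colmx X *m c = \sum_j c j 0 *: tnth X j.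
Proof.
apply/matrixP => i l; rewrite (ord1 l) mxE summxE; apply: eq_bigr => j _.
by rewrite !mxE mulrC.
Qed.

Lemma col_colmx m k (X : k.-tuple 'cV[F]_m) j : col j (colmx X) = tnth X j.
Proof. by apply/matrixP => i l; rewrite (ord1 l) !mxE. Qed.

Lemma mxim_colmx m k (X : k.-tuple 'cV[F]_m) : mxim (colmx X) = <<X>>%VS.
Proof.
apply/eqP; rewrite eqEsubv; apply/andP; split.
  apply/subvP => u /mximP[c ->]; rewrite colmx_mul; apply: memv_suml => j _.
  by apply: memvZ; apply: memv_span; exact: mem_tnth.
apply/span_subvP => u /tnthP[j ->]; apply/mximP; exists (delta_mx j 0).
by rewrite -colE col_colmx.
Qed.

Lemma colmx_full m k (X : k.-tuple 'cV[F]_m) : free X -> row_full (colmx X).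
Proof.
move=> /freeP fX; apply: row_full_kernel => c; rewrite colmx_mul => h.
apply/matrixP => i l; rewrite (ord1 l) mxE; apply: (fX (fun j => c j 0)).
by rewrite -[RHS]h; apply: eq_bigr => j _; rewrite (tnth_nth 0).
Qed.

Lemma basis_matrix m (U : {vspace 'cV[F]_m}) :
  exists B : 'M[F]_(m, \dim U), row_full B /\ U = mxim B.
Proof.
exists (colmx (vbasis U)); split; first by apply: colmx_full; exact: basis_free (vbasisP U).
by rewrite mxim_colmx; apply/esym/eqP; case/andP: (vbasisP U).
Qed.
End ColumnMatrices.

Section CoordinateSubspaces.
Variable C : numClosedFieldType.

Lemma gram_unit m k (B : 'M[C]_(m, k)) : row_full B -> B^t* *m B \in unitmx.
Proof.
move=> fB; rewrite -row_full_unit; apply: row_full_kernel => c h.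
apply: (row_full_cancel fB); rewrite mulmx0.
have h1 : (B *m c)^t* *m (B *m c) = 0 by rewrite adj_mul -!mulmxA (mulmxA (B^t*)) h mulmx0.
apply/matrixP => i l; rewrite (ord1 l) [RHS]mxE.
have : \sum_j `|(B *m c) j 0| ^+ 2 = 0.
  have := congr1 (fun M : 'M[C]_1 => M 0 0) h1; rewrite mxE [RHS]mxE => h2.
  by rewrite -[RHS]h2; apply: eq_bigr => j _; rewrite [X in _ = X * _]mxE [X in _ = X^* * _]mxE normCKC.
move=> /psumr_eq0P h2; apply/eqP; rewrite -normr_eq0 -sqrf_eq0; apply/eqP; by apply: h2.
Qed.

(* The span of the columns of w^* selected by J *)
Definition cspan n (w : 'M[C]_n) (J : pred 'I_n) : {vspace 'cV[C]_n} :=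
  mxim (colsub (enum_val : 'I_#|J| -> 'I_n) (w^t*)).

Lemma cspan_full n (w : 'M[C]_n) (J : pred 'I_n) : w \is unitarymx ->
  row_full (colsub (enum_val : 'I_#|J| -> 'I_n) (w^t*)).
Proof.
move=> /unitarymxP wu; apply/row_fullP; exists (rowsub (enum_val : 'I_#|J| -> 'I_n) w).
apply/matrixP => k l; rewrite [RHS]mxE -(inj_eq enum_val_inj).
transitivity ((w *m w^t*) (enum_val k) (enum_val l)); last by rewrite wu mxE.
by rewrite mxE [RHS]mxE; apply: eq_bigr => j _; rewrite [X in X * _]mxE [X in _ * X]mxE.
Qed.

Lemma dim_cspan n (w : 'M[C]_n) (J : pred 'I_n) : w \is unitarymx ->
  \dim (cspan w J) = #|J|.
Proof. by move=> wu; rewrite dim_mxim //; exact: cspan_full. Qed.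

Lemma cspanP n (w : 'M[C]_n) (J : pred 'I_n) (u : 'cV[C]_n) : w \is unitarymx ->
  reflect (forall i, ~~ J i -> (w *m u) i 0 = 0) (u \in cspan w J).
Proof.
move=> wu; have /unitarymxP ww := wu; have w'w := unitary_adjK wu.
apply: (iffP (mximP _ _)) => [[c ->] i nJ|H].
  rewrite mulmxA mxE big1 // => l _.
  have -> : (w *m colsub (enum_val : 'I_#|J| -> 'I_n) (w^t*)) i l = (w *m w^t*) i (enum_val l).
    by rewrite mxE [RHS]mxE; apply: eq_bigr => j _; rewrite [X in _ * X]mxE.
  rewrite ww mxE; have := enum_valP l; case: eqP => [<-|_ _]; last by rewrite mul0r.
  by rewrite unfold_in (negPf nJ).
exists (\col_l (w *m u) (enum_val l) 0); apply/matrixP => k l0; rewrite (ord1 l0).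
have uE : u = w^t* *m (w *m u) by rewrite mulmxA w'w mul1mx.
rewrite [LHS](congr1 (fun z : 'cV[C]_n => z k 0) uE) mxE [RHS]mxE.
rewrite (bigID (fun i => i \in J)) /= [X in _ + X]big1 ?addr0 => [|i nJ]; last first.
  by rewrite H ?mulr0.
rewrite big_enum_val; apply: eq_bigr => l _.
by rewrite [X in _ = X * _]mxE [X in _ = _ * X]mxE.
Qed.
End CoordinateSubspaces.

Section Subrepresentations.
Variables (R : realType) (Vt E : finType) (d : Vt -> nat) (s t : E -> Vt).
Local Notation C := (Cplx R).
Local Notation rep := (@rep R Vt E d s t).
Local Notation ggauge := (@ggauge R Vt d).
Local Notation idx := {v : Vt & 'I_(d v)}.

Lemma subspace_cspan n (U : {vspace 'cV[C]_n}) :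
  exists (w : 'M[C]_n) (J : pred 'I_n), w \is unitarymx /\ U = cspan w J.
Proof.
have [B [fB UB]] := basis_matrix U.
pose P := B *m invmx (B^t* *m B) *m B^t*.
have Gu := gram_unit fB.
have PB : P *m B = B by rewrite /P -!mulmxA mulVmx ?mulmx1 //; exact: Gu.
have hP : P^t* = P.
  rewrite /P !adj_mul trmxCK mulmxA; congr (_ *m _ *m _).
  set G := B^t* *m B in Gu *.
  have hG : G^t* = G by rewrite /G adj_mul trmxCK.
  apply/esym/invmx_eq; apply: (can_inj (@trmxCK _ _ _)).
  rewrite adj_mul trmxCK hG mulVmx; last exact: Gu.
  by rewrite !trmx1 map_mx1 ?trmx1.
have [w [phi [wu PE]]] := hermitian_spectral hP.
exists w, (fun i => phi i == 1); split; first exact: wu.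
have w'w := unitary_adjK wu; have /unitarymxP ww' := wu.
apply/vspaceP => u; rewrite UB; apply/mximP/(cspanP _ _ wu) => [[c uE] i ni|H].
  have Pu : P *m u = u by rewrite uE mulmxA PB.
  have h : rdiag phi *m (w *m u) = w *m u.
    by rewrite -[in RHS]Pu PE !mulmxA ww' mul1mx.
  have := congr1 (fun z : 'cV[C]_n => z i 0) h; rewrite /= rdiag_mul => /eqP.
  rewrite -subr_eq0 -{2}[(w *m u) i 0]mul1r -mulrBl mulf_eq0 => /orP[|/eqP //].
  by rewrite subr_eq0 => /eqP e; case/negP: ni; apply/eqP; apply: ofrealI; rewrite e rmorph1.
have Pu : P *m u = u.
  have h : rdiag phi *m (w *m u) = w *m u.
    apply/matrixP => i l; rewrite (ord1 l) rdiag_mul.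
    have [->|/H ->] := eqVneq (phi i) 1; last by rewrite mulr0.
    by rewrite rmorph1 mul1r.
  by rewrite PE -!mulmxA h mulmxA w'w mul1mx.
by exists (invmx (B^t* *m B) *m B^t* *m u); rewrite -[LHS]Pu /P !mulmxA.
Qed.

Definition subrep (x : rep) (S : forall v, {vspace 'cV[C]_(d v)}) : Prop :=
  forall e u, u \in S (s e) -> x e *m u \in S (t e).

Definition sub_semistable (alpha : Vt -> R) (x : rep) : Prop :=
  forall S, subrep x S -> 0 <= \sum_v alpha v * (\dim (S v))%:R.

Lemma sum_idx (alpha : Vt -> R) (J : pred idx) :
  \sum_(a : idx | J a) alpha (tag a) =
  \sum_v alpha v * #|[pred i : 'I_(d v) | J (idx_of i)]|%:R.
Proof.
transitivity (\sum_v \sum_(i : 'I_(d v) | J (idx_of i)) alpha v).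
  by rewrite sig_big_dep /=; apply: eq_bigl; case.
by apply: eq_bigr => v _; rewrite sumr_const mulr_natr.
Qed.

Lemma coord_semistableP alpha (x : rep) : coord_semistable alpha x <->
  \sum_v (d v)%:R * alpha v = 0 /\ sub_semistable alpha x.
Proof.
split=> -[a0 H]; split=> //.
  move=> S subS.
  have h v : {p : 'M[C]_(d v) * pred 'I_(d v) | p.1 \is unitarymx /\ S v = cspan p.1 p.2}.
    by apply: cid; have [w [J [h1 h2]]] := subspace_cspan (S v); exists (w, J); split; [exact: h1|exact: h2].
  pose w v := (sval (h v)).1; pose Jv v := (sval (h v)).2.
  have wu v : w v \is unitarymx by have [h1 _] := svalP (h v); exact: h1.
  have SE v : S v = cspan (w v) (Jv v) by have [_ h2] := svalP (h v).
  pose J : pred idx := fun a => Jv (tag a) (tagged a).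
  have := H w J wu; rewrite sum_idx => HH.
  have dE v : \dim (S v) = #|Jv v| by rewrite SE dim_cspan; [|exact: wu].
  under eq_bigr do rewrite dE.
  apply: HH => e i j ni Jj.
  pose u : 'cV[C]_(d (s e)) := col j ((w (s e))^t*).
  have uS : u \in S (s e).
    rewrite SE; apply/(cspanP _ _ (wu _)) => k nk.
    have -> : w (s e) *m u = col j (w (s e) *m (w (s e))^t*) by rewrite /u !colE mulmxA.
    have /unitarymxP -> := wu (s e); rewrite !mxE.
    by case: eqP nk => // -> /negP.
  have := subS e u uS; rewrite SE => /(cspanP _ _ (wu _))/(_ i ni) h0.
  rewrite -[RHS]h0 /uact /u.
  have -> : w (t e) *m (x e *m col j ((w (s e))^t*)) = col j (w (t e) *m x e *m (w (s e))^t*).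
    by rewrite !colE !mulmxA.
  by rewrite [RHS]mxE.
move=> w J wu van.
pose S v := cspan (w v) (fun i => J (idx_of i)).
have -> : \sum_(a : idx | J a) alpha (tag a) = \sum_v alpha v * (\dim (S v))%:R.
  by rewrite sum_idx; apply: eq_bigr => v _; rewrite dim_cspan //; exact: wu.
apply: H => e u /(cspanP _ _ (wu _)) Hu; apply/(cspanP _ _ (wu _)) => i ni.
have -> : w (t e) *m (x e *m u) = uact w x e *m (w (s e) *m u).
  by rewrite /uact -!mulmxA (mulmxA ((w (s e))^t*)) unitary_adjK ?mul1mx //; exact: wu.
rewrite mxE big1 // => j _.
case Jj : (J (idx_of j)); first by rewrite van ?mul0r ?Jj.
by rewrite Hu ?mulr0 ?Jj.
Qed.

Lemma sub_semistable_gact alpha (g : ggauge) (x : rep) : (forall v, g v \in unitmx) ->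
  sub_semistable alpha x -> sub_semistable alpha (gact g x).
Proof.
move=> gu H S subS.
pose S' v : {vspace 'cV[C]_(d v)} := (linfun (mulmx (invmx (g v)) : 'cV[C]_(d v) -> _) @: S v)%VS.
have dS v : \dim (S' v) = \dim (S v).
  apply: limg_dim_eq; apply/eqP; rewrite -subv0; apply/subvP => u.
  rewrite memv_cap memv_ker lfunE /= memv0 => /andP[_ /eqP h].
  apply/eqP; have : g v *m (invmx (g v) *m u) = 0 by rewrite h mulmx0.
  by rewrite mulKVmx //; exact: gu.
under eq_bigr do rewrite -dS.
apply: H => e u /memv_imgP[u' Su' ->]; rewrite lfunE /=.
apply/memv_imgP; exists (gact g x e *m u'); first exact: subS.
rewrite lfunE /= /gact !mulmxA mulVmx ?mul1mx //; exact: gu.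
Qed.
End Subrepresentations.

Section StarSemistability.
Variables (R : realType) (n r : nat) (Q : star_quiver n r).
Local Notation C := (Cplx R).
Local Notation S := (star Q).
Local Notation Rep := (mxfam C (fun a : arr S => star_dim (tgt a)) (fun a : arr S => star_dim (src a))).
Local Notation Rep' := (mxfam C (fun a : arr S => star_dim (src a)) (fun a : arr S => star_dim (tgt a))).
Variable alpha : vert S -> R.
Hypothesis halpha : flag_level alpha.

Lemma sum_star (f : vert S -> R) : \sum_v f v = f None + \sum_(a : arr S) f (Some a).
Proof.
rewrite (bigD1 (None : vert S)) //=; congr (_ + _).
rewrite (reindex_omap (Some : arr S -> vert S) id) => [|[a|]] //=.
by apply: eq_bigl => a; rewrite eqxx.
Qed.

Lemma sum_arrows (f : arr S -> R) :
  \sum_(a : arr S) f a = \sum_i \sum_(k < len Q i) f (existT _ i k).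
Proof. by rewrite sig_big_dep; apply: eq_bigr; case. Qed.

Lemma pardegE (F : flags R n r) (U : {vspace 'cV[C]_r}) : is_parabolic Q F ->
  pardeg alpha F U = - \sum_(a : arr S) alpha (Some a) *
    (\dim (U :&: F (tag a) (tagged a).+1))%:R.
Proof.
move=> pF; rewrite sum_arrows.
rewrite -sumrN; apply: eq_bigr => i _.
pose D j : R := (\dim (U :&: F i j))%:R.
have Dl : D (len Q i).+1 = 0.
  by have [_ _ _ h] := pF i; rewrite /D h // capv0 dimv0.
rewrite /par_weight; under eq_bigr do rewrite mulr_suml.
rewrite (exchange_big_dep predT) //= -sumrN; apply: eq_bigr => k _.
rewrite -mulr_sumr mulNr; congr (- (_ * _)).
  by congr (alpha (Some _)); apply: star_arr_eq.
transitivity (\sum_(k.+1 <= j < (len Q i).+1) (D j - D j.+1)); first by rewrite big_geq_mkord.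
have -> : \sum_(k.+1 <= j < (len Q i).+1) (D j - D j.+1) =
    - \sum_(k.+1 <= j < (len Q i).+1) (D j.+1 - D j).
  by rewrite -sumrN; apply: eq_bigr => j _; rewrite opprB.
rewrite (telescope_sumr D); first by rewrite Dl sub0r opprK.
by rewrite ltnS ltnW.
Qed.

Lemma slope_leP (F : flags R n r) (U : {vspace 'cV[C]_r}) : is_parabolic Q F ->
  slope_le alpha F U <-> 0 <= alpha None * (\dim U)%:R +
    \sum_(a : arr S) alpha (Some a) * (\dim (U :&: F (tag a) (tagged a).+1))%:R.
Proof.
move=> pF; rewrite /slope_le !pardegE //; set s := \sum_a _; set s' := \sum_a _.
have s'E : - s' = r%:R * alpha None.
  have [] := halpha; rewrite sum_star => h _; apply/eqP; rewrite eqr_oppLR -addr_eq0 addrC.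
  rewrite -[X in _ == X]h; apply/eqP; congr (_ + _); apply: eq_bigr => a _.
  rewrite capfv mulrC; congr (_%:R * _).
  by have [_ _ hd _] := pF (tag a); rewrite hd.
rewrite s'E mulrN -subr_ge0 opprK.
have -> : (\dim U)%:R * (r%:R * alpha None) + r%:R * s = r%:R * (alpha None * (\dim U)%:R + s).
  by ring.
rewrite pmulr_rge0 // ltr0n; exact: rank_gt0 Q.
Qed.

(* The largest family of subspaces whose images in C^r lie in U *)
Definition pre (x : Rep) (U : {vspace 'cV[C]_r}) (v : vert S) : {vspace 'cV[C]_(star_dim v)} :=
  (linfun (mulmx (Tv x v) : 'cV[C]_(star_dim v) -> 'cV[C]_r) @^-1: U)%VS.

Lemma mem_pre x U v u : (u \in pre x U v) = (Tv x v *m u \in U).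
Proof. by rewrite -memv_preim lfunE. Qed.

Lemma dim_pre x U v : row_full (Tv x v) -> \dim (pre x U v) = \dim (U :&: mxim (Tv x v)).
Proof.
move=> fT; set f := linfun (mulmx (Tv x v) : 'cV[C]_(star_dim v) -> 'cV[C]_r).
have -> : (U :&: mxim (Tv x v) = f @: pre x U v)%VS.
  apply/vspaceP => u; rewrite memv_cap; apply/andP/memv_imgP => [[uU /mximP[c uE]]|[c]].
    by exists c; rewrite ?mem_pre -?uE // lfunE.
  rewrite mem_pre => cU ->; rewrite lfunE; split=> //.
  by apply/mximP; exists c.
apply/esym/limg_dim_eq/eqP; rewrite -subv0; apply/subvP => u.
rewrite memv_cap memv_ker lfunE memv0 => /andP[_ /eqP h].
by apply/eqP; apply: (row_full_cancel fT); rewrite mulmx0.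
Qed.

Lemma pre_arrow x U (a : arr S) u : u \in pre x U (src a) -> fam_mx x a *m u \in pre x U (tgt a).
Proof. by rewrite !mem_pre TvE mulmxA. Qed.

Lemma pre_coarrow (p : Rep * Rep') (U : {vspace 'cV[C]_r}) (a : arr S) u : cplx_level p ->
  (forall i w, w \in U -> sink_residue p i *m w \in U) ->
  u \in pre p.1 U (tgt a) -> fam_mx p.2 a *m u \in pre p.1 U (src a).
Proof.
by move=> Zp HU; rewrite !mem_pre mulmxA residue_relation // -mulmxA; exact: HU.
Qed.

Lemma flag_of_arrow (x : Rep) (a : arr S) : parabolic_of_rep x (tag a) (tagged a).+1 = mxim (Tv x (Some a)).
Proof. by rewrite parabolic_of_repE ltn_ord pathv_arr. Qed.

Lemma sum_pre (x : Rep) U : inj_arrows x ->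
  \sum_v alpha v * (\dim (pre x U v))%:R = alpha None * (\dim U)%:R +
    \sum_(a : arr S) alpha (Some a) * (\dim (U :&: parabolic_of_rep x (tag a) (tagged a).+1))%:R.
Proof.
move=> Ix; rewrite sum_star dim_pre; last exact: (inj_Tv Ix).
rewrite /Tv mxim1 capvf; congr (_ + _); apply: eq_bigr => a _.
by rewrite flag_of_arrow dim_pre //; exact: (inj_Tv Ix (Some a)).
Qed.

Lemma slope_pre (x : Rep) U : inj_arrows x ->
  slope_le alpha (parabolic_of_rep x) U <-> 0 <= \sum_v alpha v * (\dim (pre x U v))%:R.
Proof.
by move=> Ix; rewrite sum_pre //; apply: slope_leP; exact: parabolic_of_rep_valid.
Qed.

(* Of all subrepresentations with a given subspace at the sink, pre is the most destabilizing *)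
Lemma pre_extremal x (W : forall v : vert S, {vspace 'cV[C]_(star_dim v)}) :
  (forall (a : arr S) u, u \in W (src a) -> fam_mx x a *m u \in W (tgt a)) ->
  \sum_v alpha v * (\dim (pre x (W None) v))%:R <= \sum_v alpha v * (\dim (W v))%:R.
Proof.
move=> hW.
have sub v : (W v <= pre x (W None) v)%VS.
  move: v; apply: star_vert_ind => [|a h]; apply/subvP => u uW; rewrite mem_pre.
    by rewrite /Tv mul1mx.
  rewrite TvE -mulmxA -mem_pre; apply: (subvP h); exact: hW.
have W0 : pre x (W None) None = W None.
  by apply/vspaceP => u; rewrite mem_pre /Tv mul1mx.
rewrite !sum_star W0 lerD2l; apply: ler_sum => a _.
have [_ /(_ a) a0] := halpha.
by apply: ler_wnM2l; [exact: ltW|rewrite ler_nat dimvS].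
Qed.

Lemma pre0_inj x : 0 <= \sum_v alpha v * (\dim (pre x 0 v))%:R -> inj_arrows x.
Proof.
have [_ an] := halpha.
have W0 : pre x 0 None = 0%VS.
  by apply/vspaceP => u; rewrite mem_pre /Tv mul1mx.
rewrite sum_star W0 dimv0 mulr0 add0r => h.
apply: Tv_inj => a.
have : \sum_(a : arr S) - (alpha (Some a) * (\dim (pre x 0 (Some a)))%:R) = 0.
  apply/eqP; rewrite eq_le; apply/andP; split; first by rewrite sumrN oppr_le0.
  by apply: sumr_ge0 => b _; rewrite oppr_ge0 mulr_le0_ge0 // ltW.
move=> /psumr_eq0P H.
have /eqP : - (alpha (Some a) * (\dim (pre x 0 (Some a)))%:R) = 0.
  by apply: H => // b _; rewrite oppr_ge0 mulr_le0_ge0 // ltW.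
rewrite oppr_eq0 mulf_eq0 lt_eqF //= pnatr_eq0 dimv_eq0 => /eqP p0.
apply: (@row_full_kernel _ _ _ (Tv x (Some a) : 'M[C]_(r, star_dim (Some a : vert S)))) => c hc.
have : c \in pre x 0%VS (Some a).
  by rewrite mem_pre hc; exact: mem0v.
by rewrite p0 memv0 => /eqP.
Qed.

Lemma semistable_inj (x : Rep) :
  coord_semistable (s := @src S) (t := @tgt S) alpha (fam_mx x) -> inj_arrows x.
Proof.
move=> /coord_semistableP[_ H]; apply: pre0_inj; apply: H => a u.
exact: pre_arrow.
Qed.

Lemma par_semistableP (x : Rep) : inj_arrows x ->
  coord_semistable (s := @src S) (t := @tgt S) alpha (fam_mx x) <->
  par_semistable alpha (parabolic_of_rep x).
Proof.
move=> Ix; split=> [/coord_semistableP[_ H]|[_ H]].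
  split; first exact: parabolic_of_rep_valid.
  by move=> U; apply/(slope_pre _ Ix); apply: H => a u; exact: pre_arrow.
apply/coord_semistableP; split; first by have [] := halpha.
move=> W subW; apply: le_trans (pre_extremal subW).
by apply/(slope_pre _ Ix); exact: H.
Qed.

Section Higgs.
Variables (a : 'I_n -> P1 R).
Hypothesis ha : injective a.

Lemma mximg_subP (h : 'M[C]_r) (U U' : {vspace 'cV[C]_r}) :
  (mximg h U <= U')%VS <-> forall u, u \in U -> h *m u \in U'.
Proof.
split=> [/subvP H u uU|H].
  by apply: H; apply/memv_imgP; exists u => //; rewrite lfunE.
by apply/subvP => w /memv_imgP[u uU ->]; rewrite lfunE; exact: H.
Qed.

Lemma field_preservesP (A : 'I_n -> 'M[C]_r) (U : {vspace 'cV[C]_r}) :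
  field_preserves (field_of_residues a A) U <-> forall i u, u \in U -> A i *m u \in U.
Proof.
split=> [H i u uU|H].
  rewrite -(residue_field_of_residues ha A i) /residue.
  case: (a i) => [_|]; rewrite /chart_residue; case: (_ i) => [b|]; rewrite ?mul0mx ?mem0v //.
    by rewrite -scalemxAl; apply: memvZ; have [/mximg_subP h _] := H b; exact: h.
  by rewrite -scalemxAl; apply: memvZ; have [_ /mximg_subP h] := H b; exact: h.
have key c t u : u \in U -> chart_field c A t *m u \in U.
  move=> uU; rewrite /chart_field mulmx_suml; apply: memv_suml => i _.
  by case: (c i) => [b|]; rewrite ?mul0mx ?mem0v // -scalemxAl; apply: memvZ; exact: H.
by move=> t; split; apply/mximg_subP => u; exact: key.
Qed.

Lemma higgs_of_rep_valid (p : Rep * Rep') : inj_arrows p.1 -> cplx_level p ->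
  is_higgs Q a (higgs_of_rep a p).
Proof.
move=> Ip Zp; split; first exact: parabolic_of_rep_valid.
  by apply: is_field_of_residues => //; exact: sink_residue_sum.
move=> i j jl.
suff : (mximg (residue a (field_of_residues a (sink_residue p)) i)
  (parabolic_of_rep p.1 i j) <= parabolic_of_rep p.1 i j.+1)%VS by [].
apply/mximg_subP => u; rewrite residue_field_of_residues //.
rewrite !parabolic_of_repE jl => /mximP[c ->]; rewrite mulmxA.
case: ifP => lt.
  have [b [e1 e2 e3 _]] := pathvS lt; rewrite e1; move: c; rewrite e2 -e3 => c.
  rewrite -residue_relation //.
  by apply/mximP; exists (fam_mx p.2 b *m c); rewrite mulmxA.
have jE : j = len Q i by apply/eqP; rewrite eqn_leq jl leqNgt lt.
have lt0 : ((len Q i).-1 < len Q i)%N by rewrite prednK ?len_gt0.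
have [b [e1 _ e2 e3]] := pathvS lt0; rewrite prednK ?len_gt0 // in e1.
move: c; rewrite jE e1 -e2 => c; rewrite residue_last //; first by rewrite mul0mx mem0v.
by rewrite e3 e2 prednK ?len_gt0.
Qed.

Lemma semistable_inj_cot (p : Rep * Rep') : cplx_level p ->
  coord_semistable alpha (dcoord p) -> inj_arrows p.1.
Proof.
move=> Zp /coord_semistableP[_ H]; apply: pre0_inj; apply: H => -[b|b] u /=.
  exact: pre_arrow.
apply: pre_coarrow => // i w; rewrite memv0 => /eqP ->; rewrite mulmx0; exact: mem0v.
Qed.

Lemma higgs_semistableP (p : Rep * Rep') : inj_arrows p.1 -> cplx_level p ->
  coord_semistable alpha (dcoord p) <-> higgs_semistable alpha a (higgs_of_rep a p).
Proof.
move=> Ip Zp; split=> [/coord_semistableP[_ H]|[_ H]].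
  split; first exact: higgs_of_rep_valid.
  move=> U /field_preservesP HU; apply/(slope_pre _ Ip); apply: H => -[b|b] u /=.
    exact: pre_arrow.
  exact: pre_coarrow.
apply/coord_semistableP; split; first by have [] := halpha.
move=> W subW; apply: le_trans (pre_extremal (x := p.1) (W := W) _); last first.
  by move=> b u; exact: (subW (inl b)).
apply/(slope_pre _ Ip); apply: H; apply/field_preservesP => i u uW.
rewrite /sink_residue -mulmxA.
exact: (subW (inl (star_vtx (len_gt0 Q i))) _ (subW (inr (star_vtx (len_gt0 Q i))) u uW)).
Qed.

End Higgs.
End StarSemistability.

Section AdaptedFrames.
Variables (F : fieldType) (r : nat).

Lemma adapted_basis (U : nat -> {vspace 'cV[F]_r}) l :
  (forall j, (j < l)%N -> (U j.+1 <= U j)%VS) -> forall k, (k <= l)%N ->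
  exists X : seq 'cV[F]_r, basis_of (U (l - k)%N) X /\
    forall j, (l - k <= j)%N -> (j <= l)%N -> <<take (\dim (U j)) X>>%VS = U j.
Proof.
move=> dec; elim=> [|k IH] kl.
  exists (vbasis (U (l - 0)%N)); split; first exact: vbasisP.
  move=> j; rewrite subn0 => lj jl; have -> : j = l by apply/eqP; rewrite eqn_leq jl lj.
  by rewrite take_oversize ?size_tuple //; case/andP: (vbasisP (U l)) => /eqP.
have [X [bX HX]] := IH (ltnW kl).
set j0 := (l - k.+1)%N; have j0S : (l - k)%N = j0.+1 by rewrite /j0 subnSK.
have j0l : (j0 < l)%N by rewrite -j0S leq_subr.
rewrite j0S in bX HX; have sub := dec j0 j0l.
have /andP[/eqP spX fX] := bX.
have szX : size X = \dim (U j0.+1) by rewrite -spX; apply/esym/eqP; exact: fX.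
pose Y : seq 'cV[F]_r := vbasis (U j0 :\: U j0.+1).
have spY : <<Y>>%VS = (U j0 :\: U j0.+1)%VS by case/andP: (vbasisP (U j0 :\: U j0.+1)) => /eqP.
have spXY : <<X ++ Y>>%VS = U j0.
  by rewrite span_cat spX spY addvC addv_diff; apply/addv_idPl.
have szXY : size (X ++ Y) = \dim (U j0).
  rewrite size_cat szX size_tuple -(dimv_cap_compl (U j0) (U j0.+1)).
  by congr (\dim _ + _)%N; apply/esym/capv_idPr.
exists (X ++ Y); split; first by rewrite basisEdim spXY subvv szXY leqnn.
move=> j; rewrite leq_eqVlt => /orP[/eqP <- _|j0j jl].
  by rewrite -szXY take_size.
rewrite take_cat; have : (\dim (U j) <= \dim (U j0.+1))%N.
  apply: dimvS; elim: j j0j jl => // j IHj; rewrite ltnS leq_eqVlt => /orP[/eqP -> //|h] jl.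
  by apply: subv_trans (IHj h (ltnW jl)); exact: dec.
rewrite -szX leq_eqVlt => /orP[/eqP e|->]; last exact: HX.
by rewrite e ltnn subnn take0 cats0 -[X in <<X>>%VS]take_size -e; exact: HX.
Qed.

Lemma adapted_frame (U : nat -> {vspace 'cV[F]_r}) l : U 0%N = fullv ->
  (forall j, (j < l)%N -> (U j.+1 <= U j)%VS) ->
  exists2 G : 'M[F]_r, G \in unitmx & forall j, (j <= l)%N ->
    U j = <<[seq col k G | k : 'I_r <- enum 'I_r & (k < \dim (U j))%N]>>%VS.
Proof.
move=> U0 dec; have [X [bX HX]] := adapted_basis dec (leqnn l).
rewrite subnn U0 in bX HX.
have /andP[/eqP spX fX] := bX.
have sX : size X == r.
  have /eqP <- : \dim <<X>> == size X by exact: fX.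
  by rewrite spX dimvf /dim /= muln1.
pose G := colmx (Tuple sX); exists G.
  rewrite -row_full_unit; apply: colmx_full; exact: basis_free bX.
move=> j jl; rewrite -[LHS]HX //; apply: eq_span => u; apply/idP/mapP.
  move=> /(nthP 0)[k]; rewrite size_take_min => kd <-.
  have kr : (k < r)%N by rewrite -(eqP sX); apply: leq_trans kd (geq_minr _ _).
  have kU : (k < \dim (U j))%N by apply: leq_trans kd (geq_minl _ _).
  exists (Ordinal kr); first by rewrite mem_filter /= kU mem_enum.
  by rewrite col_colmx nth_take // (tnth_nth 0).
move=> [k]; rewrite mem_filter => /andP[kU _] ->; rewrite col_colmx (tnth_nth 0) /=.
rewrite -(nth_take _ kU); apply: mem_nth; rewrite size_take_min (eqP sX).
by rewrite ltn_min kU ltn_ord.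
Qed.

End AdaptedFrames.

Section Frames.
Variables (R : realType) (n r : nat) (Q : star_quiver n r).
Local Notation C := (Cplx R).
Local Notation S := (star Q).
Local Notation Rep := (mxfam C (fun a : arr S => star_dim (tgt a)) (fun a : arr S => star_dim (src a))).
Local Notation Rep' := (mxfam C (fun a : arr S => star_dim (src a)) (fun a : arr S => star_dim (tgt a))).
Local Notation mxtuple := (mxfam C (fun _ : 'I_n => r) (fun _ : 'I_n => r)).

Lemma frame_span (G : 'M[C]_r) k : (k <= r)%N ->
  <<[seq col l G | l : 'I_r <- enum 'I_r & (l < k)%N]>>%VS = mxim (G *m (pid_mx k : 'M[C]_(r, k))).
Proof.
move=> kr; apply/eqP; rewrite eqEsubv; apply/andP; split.
  apply/span_subvP => u /mapP[l]; rewrite mem_filter => /andP[lk _] ->.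
  apply/mximP; exists (delta_mx (Ordinal lk) 0); rewrite -mulmxA colE; congr (_ *m _).
  apply/matrixP => i j; rewrite -colE !mxE (ord1 j) /= eqxx andbT -(inj_eq val_inj) /=.
  by case: eqP => [->|]; rewrite ?lk.
apply/subvP => u /mximP[c ->]; rewrite -mulmxA; set w := pid_mx k *m c.
have -> : G *m w = \sum_l w l 0 *: col l G.
  apply/matrixP => i j; rewrite (ord1 j) mxE summxE; apply: eq_bigr => l _.
  by rewrite !mxE mulrC.
apply: memv_suml => l _; have [lk|kl] := ltnP l k.
  apply: memvZ; apply: memv_span; apply/mapP; exists l => //.
  by rewrite mem_filter lk mem_enum.
suff -> : w l 0 = 0 by rewrite scale0r mem0v.
rewrite mxE big1 // => j _; rewrite mxE; case: eqP => [e|_]; last by rewrite mul0r.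
by have := ltn_ord j; rewrite -e ltnNge kl.
Qed.

Lemma dimp_mono i j j' : (j <= j')%N -> (j' <= len Q i)%N -> (dimp Q i j' <= dimp Q i j)%N.
Proof.
move=> /subnK <-; elim: (j' - j)%N => [|k IH] h; first by rewrite add0n.
by apply: leq_trans (IH (ltnW h)); apply: ltnW; apply: dimp_decr.
Qed.

Lemma dimp_le i j : (j <= len Q i)%N -> (dimp Q i j <= r)%N.
Proof. by move=> h; apply: leq_trans (dimp_mono (leq0n j) h) _; rewrite dimp_sink. Qed.

Lemma frame_flagsE (g : mxtuple) i j : (j <= len Q i)%N -> frame_flags Q g i j =
  mxim (fam_mx g i *m (pid_mx (star_dim (pathv Q i j)) : 'M[C]_(r, star_dim (pathv Q i j)))).
Proof.
move=> jl; rewrite /frame_flags jl star_dim_pathv //; apply: frame_span; exact: dimp_le.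
Qed.

Lemma star_dim_le (v : vert S) : (star_dim v <= r)%N.
Proof. by case: v => [a|] //=; apply: dimp_le. Qed.

Lemma star_dim_tgt (a : arr S) : (star_dim (src a) <= star_dim (tgt a))%N.
Proof.
case: a => i [[|j] lt] /=; first exact: dimp_le.
by apply: dimp_mono.
Qed.

Lemma row_full_pid m k : (k <= m)%N -> row_full (pid_mx k : 'M[C]_(m, k)).
Proof.
move=> km; apply/row_fullP; exists (pid_mx k).
by rewrite mul_pid_mx minnn (minn_idPr km) pid_mx_1.
Qed.

(* A representation from frames: on each path all arrows but the last are
   coordinate inclusions *)
Definition frame_arrow (g : mxtuple) (a : arr S) : 'M[C]_(star_dim (tgt a), star_dim (src a)) :=
  match tgt a as v return 'M[C]_(star_dim v, star_dim (src a)) with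
  | None => fam_mx g (tag a) *m pid_mx (star_dim (src a))
  | Some b => pid_mx (star_dim (src a))
  end.

Definition rep_of_frames (g : mxtuple) : Rep := mx_fam (frame_arrow g).

Lemma fam_rep_of_frames g a : fam_mx (rep_of_frames g) a = frame_arrow g a.
Proof. by rewrite /rep_of_frames mx_famK. Qed.

Lemma Tv_rep_of_frames (g : mxtuple) (a : arr S) : Tv (rep_of_frames g) (Some a) =
  fam_mx g (tag a) *m (pid_mx (star_dim (src a)) : 'M[C]_(r, star_dim (src a))).
Proof.
pose P (v : vert S) := forall b : arr S, v = Some b -> Tv (rep_of_frames g) (Some b) =
  fam_mx g (tag b) *m (pid_mx (star_dim (src b)) : 'M[C]_(r, star_dim (src b))).
suff : P (Some a) by exact.
move: (Some a); apply: star_vert_ind => // {}a h _ [<-]; rewrite TvE fam_rep_of_frames.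
rewrite /frame_arrow.
suff key v : v = tgt a -> (star_dim (src a) <= star_dim v)%N -> P v ->
    Tv (rep_of_frames g) v *m
      match v as v return 'M[C]_(star_dim v, star_dim (src a)) with
      | None => fam_mx g (tag a) *m pid_mx (star_dim (src a))
      | Some b => pid_mx (star_dim (src a))
      end = fam_mx g (tag a) *m (pid_mx (star_dim (src a)) : 'M[C]_(r, star_dim (src a))).
  exact: (key _ erefl (star_dim_tgt a) h).
case: v => [b|] e le {}h; last by rewrite /Tv mul1mx.
have [tE _] := star_tgt_tag (esym e); rewrite tE.
rewrite (h b erefl) -mulmxA mul_pid_mx minnA minnn.
by rewrite (minn_idPr _).
Qed.

Lemma inj_rep_of_frames (g : mxtuple) : (forall i, fam_mx g i \in unitmx) ->
  inj_arrows (rep_of_frames g).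
Proof.
move=> gu; apply: Tv_inj => a; rewrite Tv_rep_of_frames; apply: row_full_mul.
  by rewrite row_full_unit; exact: gu.
by apply: row_full_pid; exact: (star_dim_le (src a)).
Qed.

Lemma parabolic_of_frames (g : mxtuple) : (forall i, fam_mx g i \in unitmx) ->
  parabolic_of_rep (rep_of_frames g) = frame_flags Q g.
Proof.
move=> gu; apply: funext => i; apply: funext => j; rewrite parabolic_of_repE.
case jl : (j <= len Q i)%N; last by rewrite /frame_flags jl.
rewrite frame_flagsE //; case: j jl => [|j] jl.
  rewrite [Tv _ _]/(1%:M) /= pid_mx_1 mulmx1 -[fam_mx g i]mul1mx mxim_mulr //.
have [b [-> _ <- _]] := pathvS jl; by rewrite Tv_rep_of_frames.
Qed.

Lemma frames_exist (F : flags R n r) : is_parabolic Q F -> exists g, presents_flags Q g F.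
Proof.
move=> pF.
have H i : {G : 'M[C]_r | G \in unitmx /\ forall j, (j <= len Q i)%N ->
    F i j = <<[seq col k G | k : 'I_r <- enum 'I_r & (k < dimp Q i j)%N]>>%VS}.
  apply: cid; have [F0 Fs Fd _] := pF i.
  have [G Gu HG] := @adapted_frame C r (F i) (len Q i) F0 (fun j jl => Fs j (ltnW jl)).
  exists G; split; first exact: Gu.
  by move=> j jl; rewrite [LHS]HG // Fd.
exists (mx_fam (fun i => sval (H i))); split=> [i|].
  by rewrite mx_famK; have [h _] := svalP (H i); exact: h.
apply: funext => i; apply: funext => j; rewrite /frame_flags mx_famK.
case: leqP => jl; first by have [_ h] := svalP (H i); exact: h.
by have [_ _ _ h] := pF i; exact: h.
Qed.

(* The deepest flag member in which the k-th vector of a frame lies *)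
Definition depth (i : 'I_n) (k : 'I_r) : nat :=
  \max_(j < (len Q i).+1 | (k < dimp Q i j)%N) j.

Lemma depthP i k : (depth i k <= len Q i)%N /\ (k < dimp Q i (depth i k))%N.
Proof.
have h0 : (k < dimp Q i (ord0 : 'I_(len Q i).+1))%N by rewrite dimp_sink.
have : (0 < #|[pred j : 'I_(len Q i).+1 | (k < dimp Q i j)%N]|)%N.
  by apply/card_gt0P; exists ord0.
move=> /(eq_bigmax_cond (fun j : 'I_(len Q i).+1 => j : nat))[j hj e].
have -> : depth i k = j by exact: e.
by split; [rewrite -ltnS|exact: hj].
Qed.

Lemma depth_max i (k : 'I_r) j : (j <= len Q i)%N -> (k < dimp Q i j)%N -> (j <= depth i k)%N.
Proof.
move=> jl h; have jl' : (j < (len Q i).+1)%N by rewrite ltnS.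
exact: (@leq_bigmax_cond _ (fun j : 'I_(len Q i).+1 => (k < dimp Q i j)%N)
  (fun j => j : nat) (Ordinal jl')).
Qed.

Lemma Tv_path (x : Rep) i j j' : (j <= j')%N -> (j' <= len Q i)%N ->
  (mxim (Tv x (pathv Q i j')) <= mxim (Tv x (pathv Q i j)))%VS.
Proof.
move=> /subnK <-; elim: (j' - j)%N => [|k IH] h; first by rewrite add0n subvv.
apply: subv_trans (IH (ltnW h)).
have [a [-> -> _ _]] := pathvS h; apply/mxim_subP.
by exists (fam_mx x a); rewrite TvE.
Qed.

Lemma frame_coefficients (x : Rep) (g : mxtuple) : presents_flags Q g (parabolic_of_rep x) ->
  exists c : forall (i : 'I_n) (k : 'I_r), 'cV[C]_(star_dim (pathv Q i (depth i k))),
  forall i k, col k (fam_mx g i) = Tv x (pathv Q i (depth i k)) *m c i k.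
Proof.
move=> [_ e].
have H i k : {c | col k (fam_mx g i) = Tv x (pathv Q i (depth i k)) *m c}.
  apply: cid; apply/mximP; have [dl dk] := depthP i k.
  have := congr1 (fun F : flags R n r => F i (depth i k)) e.
  rewrite parabolic_of_repE dl => ->; rewrite /frame_flags dl.
  by apply: memv_span; apply/mapP; exists k => //; rewrite mem_filter dk mem_enum.
by exists (fun i k => sval (H i k)) => i k; exact: (svalP (H i k)).
Qed.

Section MovingFrame.
Variable c : forall (i : 'I_n) (k : 'I_r), 'cV[C]_(star_dim (pathv Q i (depth i k))).

Definition moving_frame (x : Rep) : mxtuple := mx_fam (fun i =>
  \matrix_(l, k) (Tv x (pathv Q i (depth i k)) *m c i k) l 0).

Lemma moving_frame_presents (x : Rep) : inj_arrows x ->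
  (forall i, fam_mx (moving_frame x) i \in unitmx) ->
  presents_flags Q (moving_frame x) (parabolic_of_rep x).
Proof.
move=> Ix gu; split; first exact: gu.
apply: funext => i; apply: funext => j; rewrite parabolic_of_repE.
case jl : (j <= len Q i)%N; last by rewrite /frame_flags jl.
apply/esym/eqP; rewrite eqEdim; apply/andP; split.
  rewrite /frame_flags jl; apply/span_subvP => u /mapP[k].
  rewrite mem_filter => /andP[kd _] ->.
  have [dl _] := depthP i k; have dj := depth_max jl kd.
  apply: (subvP (Tv_path x dj dl)); apply/mximP; exists (c i k).
  by apply/matrixP => l l'; rewrite (ord1 l') /moving_frame mx_famK !mxE.
rewrite frame_flagsE // (dim_mxim (inj_Tv Ix _)) dim_mxim //.
apply: row_full_mul; first by rewrite row_full_unit; exact: gu.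
by apply: row_full_pid; exact: star_dim_le.
Qed.
End MovingFrame.
End Frames.

Section MatrixDifferentiability.
Variables (K : numClosedFieldType) (V : normedModType K).
Implicit Types p : V.

Definition diffmx m n (X : V -> 'M[K]_(m, n)) p : Prop :=
  forall i j, differentiable (fun q => X q i j) p.

Lemma diffmx_cst m n (A : 'M[K]_(m, n)) p : diffmx (fun=> A) p.
Proof. by move=> i j; exact: differentiable_cst. Qed.

Lemma differentiable_bigsum (I : Type) (l : seq I) (P : pred I) (f : I -> V -> K) p :
  (forall i, differentiable (f i) p) -> differentiable (fun q => \sum_(i <- l | P i) f i q) p.
Proof.
move=> h; elim: l => [|i l IH].
  by under eq_fun do rewrite big_nil; exact: differentiable_cst.
under eq_fun do rewrite big_cons; case: (P i) => //.
exact: (@differentiableD K V K (f i) _ p (h i) IH).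
Qed.

Lemma differentiable_mulK (f g : V -> K) p : differentiable f p -> differentiable g p ->
  differentiable (fun q => f q * g q) p.
Proof. exact: differentiableM. Qed.

Lemma differentiable_bigprod (I : Type) (l : seq I) (f : I -> V -> K) p :
  (forall i, differentiable (f i) p) -> differentiable (fun q => \prod_(i <- l) f i q) p.
Proof.
move=> h; elim: l => [|i l IH].
  by under eq_fun do rewrite big_nil; exact: differentiable_cst.
under eq_fun do rewrite big_cons; exact: differentiable_mulK.
Qed.

Lemma diffmx_mul m n k (X : V -> 'M[K]_(m, n)) (Y : V -> 'M[K]_(n, k)) p :
  diffmx X p -> diffmx Y p -> diffmx (fun q => X q *m Y q) p.
Proof.
move=> hX hY i j; under eq_fun do rewrite mxE.
by apply: differentiable_bigsum => l; apply: differentiable_mulK; [exact: hX|exact: hY].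
Qed.

Lemma differentiable_det m (X : V -> 'M[K]_m) p : diffmx X p ->
  differentiable (fun q => \det (X q)) p.
Proof.
move=> hX; apply: differentiable_bigsum => s; apply: differentiable_mulK.
  exact: differentiable_cst.
by apply: differentiable_bigprod => i; exact: hX.
Qed.

Lemma diffmx_adj m (X : V -> 'M[K]_m) p : diffmx X p -> diffmx (fun q => \adj (X q)) p.
Proof.
move=> hX i j; under eq_fun do rewrite mxE /cofactor.
apply: differentiable_mulK; first exact: differentiable_cst.
apply: differentiable_det => k l; under eq_fun do rewrite 2!mxE; exact: hX.
Qed.

Lemma near_unit m (X : V -> 'M[K]_m) p : diffmx X p -> X p \in unitmx ->
  \forall q \near p, X q \in unitmx.
Proof.
move=> hX; rewrite unitmxE unitfE => u.
have c : {for p, continuous (fun q => \det (X q))}.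
  by apply: differentiable_continuous; exact: differentiable_det.
have h : nbhs p [set q | \det (X q) != 0] by exact: (c _ (near_neq u)).
by apply: filterS h => q; rewrite /= unitmxE unitfE.
Qed.

Lemma near_row_full m n (X : V -> 'M[K]_(m, n)) p : diffmx X p -> row_full (X p) ->
  \forall q \near p, row_full (X q).
Proof.
move=> hX /row_fullP[B BX].
have h : diffmx (fun q => B *m X q) p by apply: diffmx_mul => //; exact: diffmx_cst.
have u : B *m X p \in unitmx by rewrite BX unitmx1.
have := near_unit h u; apply: filterS => q; rewrite -row_full_unit.
exact: row_full_mulr.
Qed.

Lemma differentiable_inv (f : V -> K) p : differentiable f p -> f p != 0 ->
  differentiable (fun q => (f q)^-1) p.
Proof. by move=> h1 h2; exact: differentiableV. Qed.

Definition adjinv m (A : 'M[K]_m) : 'M[K]_m := (\det A)^-1 *: \adj A.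

Lemma adjinvE m (A : 'M[K]_m) : A \in unitmx -> adjinv A = invmx A.
Proof. by rewrite /invmx /adjinv => ->. Qed.

Lemma diffmx_adjinv m (X : V -> 'M[K]_m) p : diffmx X p -> X p \in unitmx ->
  diffmx (fun q => adjinv (X q)) p.
Proof.
move=> hX; rewrite unitmxE unitfE => u i j; under eq_fun do rewrite mxE.
apply: differentiable_mulK; last exact: diffmx_adj.
by apply: differentiable_inv => //; exact: differentiable_det.
Qed.

Section Fam.
Variables (A : finType) (m n : A -> nat).

Lemma diffmx_fam (f : V -> mxfam K m n) a p : differentiable f p ->
  diffmx (fun q => fam_mx (f q) a) p.
Proof.
move=> df i j; under eq_fun do rewrite mxE; exact: differentiable_entry.
Qed.

Lemma differentiable_fam (X : V -> forall a, 'M[K]_(m a, n a)) p :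
  (forall a, diffmx (fun q => X q a) p) ->
  differentiable (fun q => mx_fam (X q) : mxfam K m n) p.
Proof.
move=> h; apply: differentiable_mx => i k; under eq_fun do rewrite mxE.
exact: h.
Qed.
End Fam.

End MatrixDifferentiability.

Section PairDifferentiability.
Variables (K : numFieldType) (V W : normedModType K).

Lemma differentiable_fst (p : V * W) : differentiable (fst : V * W -> V) p.
Proof.
have h : differentiable (GRing.Linear.clone _ _ _ _ (@fst V W) _) p.
  apply: linear_differentiable => q; exact: cvg_fst.
exact: h.
Qed.

Lemma differentiable_snd (p : V * W) : differentiable (snd : V * W -> W) p.
Proof.
have h : differentiable (GRing.Linear.clone _ _ _ _ (@snd V W) _) p.
  apply: linear_differentiable => q; exact: cvg_snd.
exact: h.
Qed.
End PairDifferentiability.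

Section StarDifferentiability.
Variables (R : realType) (n r : nat) (Q : star_quiver n r).
Local Notation C := (Cplx R).
Local Notation S := (star Q).
Local Notation Rep := (mxfam C (fun a : arr S => star_dim (tgt a)) (fun a : arr S => star_dim (src a))).
Local Notation Rep' := (mxfam C (fun a : arr S => star_dim (src a)) (fun a : arr S => star_dim (tgt a))).
Local Notation mxtuple := (mxfam C (fun _ : 'I_n => r) (fun _ : 'I_n => r)).
Variable V : normedModType C.

Lemma diffmx_Tv (f : V -> Rep) (p : V) v : differentiable f p ->
  diffmx (fun q => Tv (f q) v) p.
Proof.
move=> df; move: v; apply: star_vert_ind => [|a h]; first exact: diffmx_cst.
have -> : (fun q => Tv (f q) (Some a)) = (fun q => Tv (f q) (tgt a) *m fam_mx (f q) a).
  by apply: funext => q; rewrite TvE.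
exact: (diffmx_mul h (diffmx_fam df (a := a))).
Qed.

Lemma differentiable_rep_of_frames (f : V -> mxtuple) (p : V) : differentiable f p ->
  differentiable (fun q => rep_of_frames Q (f q)) p.
Proof.
move=> df; apply: differentiable_fam => a; rewrite /frame_arrow.
case: (tgt a) => [b|]; first exact: diffmx_cst.
exact: (diffmx_mul (diffmx_fam df (a := _)) (diffmx_cst _ _)).
Qed.

Lemma near_inj_arrows (f : V -> Rep) (p : V) : differentiable f p -> inj_arrows (f p) ->
  \forall q \near p, inj_arrows (f q).
Proof.
move=> df Ip; apply: filter_forall => a.
exact: (near_row_full (diffmx_fam df (a := a)) (Ip a)).
Qed.

Lemma differentiable_moving_frame (f : V -> Rep) c (p : V) : differentiable f p ->
  differentiable (fun q => moving_frame c (f q)) p.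
Proof.
move=> df; apply: differentiable_fam => i l k; under eq_fun do rewrite mxE.
have h := diffmx_mul (diffmx_Tv (v := pathv Q i (depth Q i k)) df) (diffmx_cst (c i k) p).
exact: (h l 0).
Qed.

Lemma near_unit_frames (g : V -> mxtuple) (p : V) : differentiable g p ->
  (forall i, fam_mx (g p) i \in unitmx) ->
  \forall q \near p, forall i, fam_mx (g q) i \in unitmx.
Proof.
move=> dg gu; apply: filter_forall => i.
exact: (near_unit (diffmx_fam dg (a := i)) (gu i)).
Qed.

End StarDifferentiability.

Section QuiverIdentification.
Variables (R : realType) (Vt E : finType) (d : Vt -> nat) (s t : E -> Vt).
Local Notation C := (Cplx R).
Local Notation rep := (@rep R Vt E d s t).
Variables (V V' : normedModType C) (coord : V -> rep) (mk : rep -> V).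
Hypothesis coordK : cancel coord mk.
Hypothesis mkK : cancel mk coord.
Hypothesis coord_cvg : forall (T : Type) (F : set_system T), Filter F ->
  forall (X : T -> V) v, X @ F --> v <-> cvgrep (F := F) (fun k => coord (X k)) (coord v).
Variables (alpha : Vt -> R) (Z I : set V).
Hypothesis alpha_trace : \sum_v (d v)%:R * alpha v = 0.
Local Notation K := (orbK coord mk).
Local Notation KC := (orbKC coord mk).
Hypothesis Z_closed : closed Z.
Hypothesis Z_KC : forall x y, KC x y -> Z x -> Z y.
Variables (M : Type) (pres : V' -> M -> Prop) (valid ss : set M).
Variables (orb : M -> M -> Prop) (Phi : V -> M) (sg : V' -> V).
Hypothesis I_Z : I `<=` Z.
Hypothesis semistable_I : forall x, Z x -> coord_semistable alpha (coord x) -> I x.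
Hypothesis I_open : forall p, I p -> \forall q \near p, Z q -> I q.
Hypothesis I_KC : forall x y, KC x y -> I x -> I y.
Hypothesis orb_refl : forall m, orb m m.
Hypothesis orb_sym : forall m m', orb m m' -> orb m' m.
Hypothesis ss_valid : ss `<=` valid.
Hypothesis Phi_valid : forall x, I x -> valid (Phi x).
Hypothesis Phi_orb : forall x y, I x -> KC x y -> orb (Phi x) (Phi y).
Hypothesis orb_lift : forall x m, I x -> orb (Phi x) m -> exists2 y, KC x y & Phi y = m.
Hypothesis Phi_orb_inv : forall x y, I x -> I y -> orb (Phi x) (Phi y) -> KC x y.
Hypothesis ssP : forall x, I x -> (coord_semistable alpha (coord x) <-> ss (Phi x)).
Hypothesis pres_ex : forall m, valid m -> exists v, pres v m.
Hypothesis pres_inj : forall v m m', valid m -> valid m' -> pres v m -> pres v m' -> m = m'.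
Hypothesis sg_I : forall v m, pres v m -> valid m -> I (sg v) /\ Phi (sg v) = m.
Hypothesis sg_diff : forall v m, pres v m -> valid m -> \forall q \near v, differentiable sg q.
Hypothesis frame : forall p v, I p -> pres v (Phi p) ->
  exists tau : V -> V', [/\ tau p = v, \forall q \near p, differentiable tau q &
    \forall q \near p, I q -> pres (tau q) (Phi q)].

Let level_ss x : levelset coord alpha Z x -> coord_semistable alpha (coord x).
Proof. by move=> [lx _]; exact: level_semistable. Qed.

Let level_I x : levelset coord alpha Z x -> I x.
Proof. by move=> lx; apply: semistable_I; [have [] := lx|exact: level_ss]. Qed.

Theorem quiver_identification :
  identifies (X := level_quotient Z (levelset coord alpha Z) K KC)
             (Y := git_quotient pres valid ss orb) Phi.
Proof.
apply: (identification_criterion (I := I) (sg := sg)).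
- exact: (orbKC_refl coordK).
- exact: (orbKC_sym coordK mkK).
- exact: (orbKC_trans mkK).
- exact: (orbK_refl coordK).
- exact: (orbK_sym coordK mkK).
- exact: (orbK_trans mkK).
- exact: orbK_KC.
- exact: (orbKC_cont mkK coord_cvg).
- exact: level_I.
- exact: (levelset_closed coord_cvg Z_closed).
- exact: I_Z.
- exact: I_open.
- exact: I_KC.
- exact: orb_refl.
- exact: orb_sym.
- move=> m m' mm' sm; have [v pv] := pres_ex (ss_valid sm).
  have [Ix xE] := sg_I pv (ss_valid sm); rewrite -xE in sm mm'.
  have [y xy <-] := orb_lift Ix mm'; apply/(ssP (I_KC xy Ix)).
  have [g [gu ->]] := xy; move/(ssP Ix): sm => /coord_semistableP[_ sx].
  by rewrite mkK; apply/coord_semistableP; split=> //; exact: sub_semistable_gact.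
- exact: ss_valid.
- exact: Phi_valid.
- exact: Phi_orb.
- exact: Phi_orb_inv.
- exact: pres_ex.
- exact: pres_inj.
- exact: sg_I.
- exact: sg_diff.
- exact: frame.
- by move=> x lx; apply/(ssP (level_I lx)); exact: level_ss.
- move=> p Ip /(ssP Ip) sp.
  have := semistable_open coord_cvg sp; apply: filterS => q sq Iq.
  exact/(ssP Iq).
- move=> x Ix /(ssP Ix); exact: (levelset_kempf_ness mkK coord_cvg Z_closed Z_KC (I_Z Ix)).
- exact: (levelset_separation coordK mkK coord_cvg).
- move=> x _; exact: (levelset_proper mkK coord_cvg).
Qed.
End QuiverIdentification.


Lemma differentiable_id (K : numFieldType) (V : normedModType K) (p : V) : differentiable (id : V -> V) p.
Proof. exact: ex_diff. Qed.


Section FlagActions.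
Variables (R : realType) (n r : nat).
Local Notation C := (Cplx R).

Lemma mximg_comp (h h' : 'M[C]_r) U : mximg h (mximg h' U) = mximg (h *m h') U.
Proof.
apply/vspaceP => u; apply/memv_imgP/memv_imgP => [[_ /memv_imgP[w wU ->] ->]|[w wU ->]].
  by exists w => //; rewrite !lfunE /= mulmxA.
exists (h' *m w); first by apply/memv_imgP; exists w => //; rewrite lfunE.
by rewrite !lfunE /= mulmxA.
Qed.

Lemma mximg1 (U : {vspace 'cV[C]_r}) : mximg 1%:M U = U.
Proof.
apply/vspaceP => u; apply/memv_imgP/idP => [[w wU ->]|uU]; first by rewrite lfunE /= mul1mx.
by exists u => //; rewrite lfunE /= mul1mx.
Qed.

Lemma flags_act_comp h h' (F : flags R n r) : flags_act h (flags_act h' F) = flags_act (h *m h') F.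
Proof. by apply: funext => i; apply: funext => j; exact: mximg_comp. Qed.

Lemma flags_act1 (F : flags R n r) : flags_act 1%:M F = F.
Proof. by apply: funext => i; apply: funext => j; exact: mximg1. Qed.

Lemma par_orbit_refl (F : flags R n r) : par_orbit F F.
Proof. by exists 1%:M; [exact: unitmx1|rewrite flags_act1]. Qed.

Lemma flags_actK h (F : flags R n r) : h \in unitmx -> flags_act (invmx h) (flags_act h F) = F.
Proof. by move=> hu; rewrite flags_act_comp mulVmx ?flags_act1 //; exact: hu. Qed.

Lemma par_orbit_sym (F F' : flags R n r) : par_orbit F F' -> par_orbit F' F.
Proof.
move=> [h hu ->]; exists (invmx h); first by rewrite unitmx_inv; exact: hu.
by rewrite flags_actK; [|exact: hu].
Qed.

Lemma field_act_comp h h' (s : field R r) : h \in unitmx -> h' \in unitmx ->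
  field_act h (field_act h' s) = field_act (h *m h') s.
Proof.
move=> hu hu'; case: s => s1 s2; rewrite /field_act /=.
by congr pair; apply: funext => z; rewrite (invmxM hu hu') !mulmxA.
Qed.

Lemma field_act1 (s : field R r) : field_act 1%:M s = s.
Proof.
case: s => s1 s2; rewrite /field_act /=.
by congr pair; apply: funext => z; rewrite invmx1 mul1mx mulmx1.
Qed.

Lemma higgs_orbit_refl (p : flags R n r * field R r) : higgs_orbit p p.
Proof.
exists 1%:M; first exact: unitmx1.
by rewrite flags_act1 field_act1; case: p.
Qed.

Lemma higgs_orbit_sym (p p' : flags R n r * field R r) : higgs_orbit p p' -> higgs_orbit p' p.
Proof.
move=> [h hu ->]; have hu' : invmx h \in unitmx by rewrite unitmx_inv; exact: hu.
exists (invmx h); first exact: hu'.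
rewrite flags_actK; last exact: hu.
rewrite (field_act_comp _ hu' hu) mulVmx; last exact: hu.
by rewrite field_act1; case: p.
Qed.

Lemma field_act_residues (a : 'I_n -> P1 R) (A : 'I_n -> 'M[C]_r) h :
  field_act h (field_of_residues a A) = field_of_residues a (fun i => h *m A i *m invmx h).
Proof.
have key c t : h *m chart_field c A t *m invmx h = chart_field c (fun i => h *m A i *m invmx h) t.
  rewrite /chart_field mulmx_sumr mulmx_suml; apply: eq_bigr => i _.
  by case: (c i) => [b|]; rewrite ?mulmx0 ?mul0mx // -scalemxAr -scalemxAl.
by rewrite /field_act /field_of_residues; congr pair; apply: funext => z; exact: key.
Qed.
End FlagActions.

Section KahlerIdentification.
Variables (R : realType) (n r : nat) (Q : star_quiver n r).
Local Notation C := (Cplx R).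
Local Notation S := (star Q).
Local Notation Rep := (mxfam C (fun a : arr S => star_dim (tgt a)) (fun a : arr S => star_dim (src a))).
Local Notation mxtuple := (mxfam C (fun _ : 'I_n => r) (fun _ : 'I_n => r)).

Definition sink_gauge (h : 'M[C]_r) : gauge R (@star_dim n r Q) :=
  fun v => match v as v return 'M[C]_(@star_dim n r Q v) with None => h | Some a => 1%:M end.

Lemma sink_gauge_unit h v : h \in unitmx -> sink_gauge h v \in unitmx.
Proof. by move=> hu; case: v => [a|]; [exact: unitmx1|exact: hu]. Qed.

Lemma inj_arrows_act (g : gauge R (@star_dim n r Q)) x : (forall v, g v \in unitmx) ->
  inj_arrows x -> inj_arrows (act g x).
Proof.
move=> gu Ix; apply: Tv_inj => a; rewrite Tv_act; last exact: gu.
apply: row_full_mul; first apply: row_full_mul.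
- by rewrite row_full_unit; exact: (gu None).
- exact: inj_Tv.
by rewrite row_full_unit unitmx_inv; exact: gu.
Qed.

Variable alpha : vert S -> R.
Hypothesis halpha : flag_level alpha.

Theorem kahler_identification : @identifies C
  (kahler_quotient (@star_dim n r Q) alpha) (parabolic_moduli alpha)
  (@parabolic_of_rep R n r Q).
Proof.
have LE : [set x : Rep | forall v, moment x v = (ofreal (alpha v))%:M] =
    levelset (s := @src S) (t := @tgt S) (fun x : Rep => fam_mx x) alpha setT.
  apply/seteqP; split=> x => [h|[lx _]].
    by split; first exact: (proj1 (moment_level alpha x) h).
  exact: (proj2 (moment_level alpha x) lx).
rewrite /kahler_quotient LE.
apply: (@quiver_identification R _ _ _ (@src S) (@tgt S) Rep mxtuple
  (fun x : Rep => fam_mx x) (fun X => mx_fam X : Rep) _ _ _ alpha setT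
  [set x | inj_arrows x] _ _ _ _ _ _ _ _ _ (@rep_of_frames R n r Q)).
- exact: fam_mxK.
- by move=> X; exact: mx_famK.
- by move=> T F FF X v; exact: (fam_cvg FF).
- by have [] := halpha.
- exact: closedT.
- by [].
- by [].
- by move=> x _; exact: semistable_inj.
- move=> p Ip; have := near_inj_arrows (f := id) _ Ip.
  by move=> /(_ (@differentiable_id _ _ p)); apply: filterS.
- by move=> x y [g [gu ->]]; exact: inj_arrows_act.
- exact: par_orbit_refl.
- exact: par_orbit_sym.
- by move=> F [].
- exact: parabolic_of_rep_valid.
- move=> x y Ix [g [gu ->]]; exists (g None); first exact: (gu None).
  exact: parabolic_of_rep_act.
- move=> x F Ix [h hu ->]; exists (act (sink_gauge h) x).
    by exists (sink_gauge h); split=> // v; exact: sink_gauge_unit.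
  by rewrite parabolic_of_rep_act // => v; exact: sink_gauge_unit.
- move=> x y Ix Iy [h hu e]; have [g [gu _ gE]] := matching_frames Ix Iy hu e.
  by exists g; split; [exact: gu|exact: (act_of_frames Iy gu gE)].
- by move=> x; exact: par_semistableP.
- exact: frames_exist.
- by move=> v F F' _ _ [_ ->] [_ ->].
- move=> v F [vu ->] _; split; first exact: inj_rep_of_frames.
  exact: parabolic_of_frames.
- move=> v F _ _; apply: filterE => q.
  exact: (differentiable_rep_of_frames _ (@differentiable_id _ _ q)).
- move=> p v Ip pv; have [c cE] := frame_coefficients pv.
  exists (moving_frame c).
  have tp : moving_frame c p = v.
    rewrite -(fam_mxK v); congr mx_fam; apply: functional_extensionality_dep => i.
    by apply/matrixP => l k; rewrite mxE -cE mxE.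
  have dt q : differentiable (moving_frame c) q.
    exact: (differentiable_moving_frame c (@differentiable_id _ _ q)).
  split; [exact: tp|by apply: filterE|].
  have vu i : fam_mx (moving_frame c p) i \in unitmx by rewrite tp; have [h _] := pv; exact: h.
  have := near_unit_frames (dt p) vu; apply: filterS => q qu Iq.
  exact: moving_frame_presents.
Qed.
End KahlerIdentification.

Section HyperkahlerIdentification.
Variables (R : realType) (n r : nat) (Q : star_quiver n r).
Local Notation C := (Cplx R).
Local Notation S := (star Q).
Local Notation Rep := (mxfam C (fun a : arr S => star_dim (tgt a)) (fun a : arr S => star_dim (src a))).
Local Notation Rep' := (mxfam C (fun a : arr S => star_dim (src a)) (fun a : arr S => star_dim (tgt a))).
Local Notation mxtuple := (mxfam C (fun _ : 'I_n => r) (fun _ : 'I_n => r)).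
Local Notation dcoord := (@dcoord R S (@star_dim n r Q)).
Local Notation dmk := (@dmk R S (@star_dim n r Q)).

Definition higgs_coarrow (v : mxtuple * mxtuple) (b : arr S) :
    'M[C]_(star_dim (src b), star_dim (tgt b)) :=
  (pid_mx (star_dim (src b)) : 'M[C]_(star_dim (src b), r)) *m adjinv (fam_mx v.1 (tag b))
  *m fam_mx v.2 (tag b) *m Tv (rep_of_frames Q v.1) (tgt b).

Definition cot_of_frames (v : mxtuple * mxtuple) : Rep * Rep' :=
  (rep_of_frames Q v.1, mx_fam (higgs_coarrow v)).

Lemma fam_cot_of_frames v b : fam_mx (cot_of_frames v).2 b = higgs_coarrow v b.
Proof. by rewrite /cot_of_frames mx_famK. Qed.

Lemma coarrow_relation (v : mxtuple * mxtuple) (b : arr S) c : fam_mx v.1 (tag b) \in unitmx ->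
  fam_mx v.2 (tag b) *m Tv (rep_of_frames Q v.1) (tgt b) = Tv (rep_of_frames Q v.1) (Some b) *m c ->
  Tv (rep_of_frames Q v.1) (Some b) *m higgs_coarrow v b =
  fam_mx v.2 (tag b) *m Tv (rep_of_frames Q v.1) (tgt b).
Proof.
move=> gu e; rewrite /higgs_coarrow -[X in _ *m X = _]mulmxA e adjinvE // Tv_rep_of_frames.
rewrite -!mulmxA (mulmxA (invmx _)) mulVmx // mul1mx !mulmxA; congr (_ *m _).
rewrite -!mulmxA; congr (_ *m _); rewrite !mul_pid_mx.
by rewrite !(minn_idPr (star_dim_le (src b)), minn_idPl (star_dim_le (src b)), minnn).
Qed.

Variables (a : 'I_n -> P1 R).
Hypothesis ha : injective a.

Lemma cot_of_frames_correct v m : presents_higgs Q a v m -> is_higgs Q a m ->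
  [/\ inj_arrows (cot_of_frames v).1, cplx_level (cot_of_frames v) &
     higgs_of_rep a (cot_of_frames v) = m].
Proof.
case: m => F s [[/= vu FE] res] [/= pF fs sp].
have [A0 sE] := field_determined ha fs.
have Iv : inj_arrows (cot_of_frames v).1 by exact: inj_rep_of_frames.
have PF : parabolic_of_rep (rep_of_frames Q v.1) = F by rewrite parabolic_of_frames.
have sub (b : arr S) j : (j <= len Q (tag b))%N ->
    (mximg (residue a s (tag b)) (F (tag b) j) <= F (tag b) j.+1)%VS by exact: sp.
have rel (b : arr S) : Tv (cot_of_frames v).1 (Some b) *m fam_mx (cot_of_frames v).2 b =
    residue a s (tag b) *m Tv (cot_of_frames v).1 (tgt b).
  rewrite fam_cot_of_frames -res.
  have := sub b (tagged b) (ltnW (ltn_ord (tagged b))).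
  rewrite -PF flag_of_arrow parabolic_of_repE ltnW // pathv_tgt mximg_mxim -res.
  by move=> /mxim_subP[c e]; apply: coarrow_relation e; exact: vu.
have lst (b : arr S) : (tagged b).+1 = len Q (tag b) ->
    residue a s (tag b) *m Tv (cot_of_frames v).1 (Some b) = 0.
  move=> bl; have := sub b (tagged b).+1; rewrite bl => /(_ (leqnn _)).
  rewrite -bl -PF flag_of_arrow parabolic_of_repE bl ltnn mximg_mxim subv0 => /eqP e.
  apply/matrixP => i j; rewrite [RHS]mxE.
  have : residue a s (tag b) *m Tv (rep_of_frames Q v.1) (Some b) *m delta_mx j 0 \in
      mxim (residue a s (tag b) *m Tv (rep_of_frames Q v.1) (Some b)).
    by apply/mximP; exists (delta_mx j 0).
  rewrite e memv0 -colE => /eqP/matrixP/(_ i 0).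
  by rewrite [LHS]mxE [RHS]mxE.
have [Zv srE] := cplx_level_intro Iv A0 rel lst.
split; [exact: Iv|exact: Zv|].
rewrite /higgs_of_rep /= PF sE; congr (_, field_of_residues a _).
by apply: funext => i; exact: srE.
Qed.

Lemma presents_higgs_inj v m m' : is_higgs Q a m -> is_higgs Q a m' ->
  presents_higgs Q a v m -> presents_higgs Q a v m' -> m = m'.
Proof.
case: m m' => F s [F' s'] [/= _ fs _] [/= _ fs' _] [[/= _ ->] h] [[/= _ ->] h'].
have [_ ->] := field_determined ha fs; have [_ ->] := field_determined ha fs'.
congr (_, field_of_residues a _); apply: funext => i.
by rewrite -h -h'.
Qed.

Lemma sink_residue_act (g : gauge R (@star_dim n r Q)) (p : Rep * Rep') i : (forall v, g v \in unitmx) ->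
  sink_residue (act g p.1, act' g p.2) i = g None *m sink_residue p i *m invmx (g None).
Proof.
move=> gu; rewrite !(sink_residueE _ (len_gt0 Q i)) /= /act /act' !mx_famK.
rewrite -!mulmxA (mulmxA (invmx (g (src _)))) mulVmx; last exact: gu.
by rewrite mul1mx.
Qed.

Lemma higgs_of_rep_act (g : gauge R (@star_dim n r Q)) (p : Rep * Rep') : (forall v, g v \in unitmx) ->
  higgs_of_rep a (act g p.1, act' g p.2) =
  (flags_act (g None) (higgs_of_rep a p).1, field_act (g None) (higgs_of_rep a p).2).
Proof.
move=> gu; rewrite /higgs_of_rep /= parabolic_of_rep_act // field_act_residues.
by congr (_, field_of_residues a _); apply: funext => i; exact: sink_residue_act.
Qed.

Lemma cot_act_of_frames (p q : Rep * Rep') (h : 'M[C]_r) (g : gauge R (@star_dim n r Q)) :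
  inj_arrows p.1 -> inj_arrows q.1 -> cplx_level p -> cplx_level q -> h \in unitmx ->
  (forall v, g v \in unitmx) -> (forall v, Tv q.1 v *m g v = h *m Tv p.1 v) ->
  (forall i, sink_residue q i = h *m sink_residue p i *m invmx h) ->
  q = (act g p.1, act' g p.2).
Proof.
move=> Ip Iq Zp Zq hu gu gE res; rewrite (surjective_pairing q); congr pair.
  exact: act_of_frames Iq gu gE.
rewrite -(fam_mxK q.2); congr mx_fam; apply: functional_extensionality_dep => b.
suff E : fam_mx q.2 b *m g (tgt b) = g (src b) *m fam_mx p.2 b.
  by rewrite -E mulmxK //; exact: gu.
apply: (row_full_cancel (inj_Tv Iq (Some b))).
have e1 := gE (src b); have e2 := gE (tgt b).
rewrite [RHS]mulmxA [X in _ = X *m _]e1 -[RHS]mulmxA (residue_relation Zp).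
rewrite mulmxA (residue_relation Zq) res -!mulmxA e2.
by rewrite (mulmxA (invmx h)) mulVmx ?mul1mx //; exact: hu.
Qed.

Variable alpha : vert S -> R.
Hypothesis halpha : flag_level alpha.

Theorem hyperkahler_identification : @identifies C
  (hyperkahler_quotient (@star_dim n r Q) alpha) (higgs_moduli alpha a)
  (@higgs_of_rep R n r Q a).
Proof.
have LE : [set p : Rep * Rep' | (forall v, moment_real p v = (ofreal (alpha v))%:M) /\
      (forall v, moment_cplx p v = 0)] = levelset dcoord alpha (@cplx_level R S (@star_dim n r Q)).
  apply/seteqP; split=> p [h1 h2]; split; try exact: h2.
    exact: (proj1 (moment_real_level alpha p) h1).
  exact: (proj2 (moment_real_level alpha p) h1).
rewrite /hyperkahler_quotient LE.
apply: (@quiver_identification R _ _ _ _ _ (Rep * Rep')%type (mxtuple * mxtuple)%type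
  dcoord dmk _ _ _ alpha (@cplx_level R S (@star_dim n r Q))
  [set p | inj_arrows p.1 /\ cplx_level p] _ _ _ _ _ _ _ _ _ cot_of_frames).
- exact: dcoordK.
- exact: dmkK.
- by move=> T F FF X v; exact: (dcoord_cvg FF).
- by have [] := halpha.
- exact: cplx_level_closed.
- exact: cplx_level_orbKC.
- by move=> p [].
- by move=> p Zp ss; split; [exact: semistable_inj_cot halpha _ Zp ss|].
- move=> p [Ip _]; have := near_inj_arrows (differentiable_fst p) Ip.
  by apply: filterS => q Iq Zq.
- move=> p q pq [Ip Zp]; split; last exact: cplx_level_orbKC pq Zp.
  have [g [gu ->]] := pq; exact: inj_arrows_act gu Ip.
- exact: higgs_orbit_refl.
- exact: higgs_orbit_sym.
- by move=> m [].
- by move=> p [Ip Zp]; exact: higgs_of_rep_valid.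
- move=> p q [Ip Zp] [g [gu ->]]; exists (g None); first exact: (gu None).
  exact: higgs_of_rep_act.
- move=> p m [Ip Zp] [h hu ->].
  have gu (v : vert S) : sink_gauge h v \in unitmx by exact: sink_gauge_unit.
  exists (act (sink_gauge h) p.1, act' (sink_gauge h) p.2).
    by exists (sink_gauge h); split; first exact: gu.
  by rewrite higgs_of_rep_act; [|exact: gu].
- move=> p q [Ip Zp] [Iq Zq] [h hu e].
  have e1 := congr1 fst e; have e2 := congr1 snd e.
  have [g [gu _ gE]] := matching_frames Ip Iq hu e1.
  exists g; split; first exact: gu.
  apply: (cot_act_of_frames Ip Iq Zp Zq hu gu gE) => i.
  rewrite -(residue_field_of_residues ha (sink_residue q) i).
  rewrite -(residue_field_of_residues ha (fun i => h *m sink_residue p i *m invmx h) i).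
  congr (residue a _ i); rewrite -field_act_residues.
  exact: e2.
- by move=> p [Ip Zp]; exact: higgs_semistableP.
- move=> m [pF _ _]; have [g gF] := frames_exist pF.
  exists (g, mx_fam (residue a m.2)); split; first exact: gF.
  by move=> i; rewrite mx_famK.
- exact: presents_higgs_inj.
- move=> v m pm vm; have [h1 h2 h3] := cot_of_frames_correct pm vm.
  by split; [split; [exact: h1|exact: h2]|exact: h3].
- move=> v m [[vu _] _] _.
  have := near_unit_frames (differentiable_fst v) vu; apply: filterS => q qu.
  have d1 := differentiable_fst q; have d2 := differentiable_snd q.
  have k1 : differentiable (fun q : mxtuple * mxtuple => rep_of_frames Q q.1) q.
    exact: differentiable_rep_of_frames d1.
  apply: (differentiable_pair k1).
  apply: differentiable_fam => b; rewrite /higgs_coarrow.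
  apply: diffmx_mul; last exact: (diffmx_Tv k1).
  apply: diffmx_mul; last exact: (diffmx_fam d2).
  apply: diffmx_mul; first exact: diffmx_cst.
  by apply: diffmx_adjinv; [exact: (diffmx_fam d1)|exact: qu].
- move=> p v [Ip Zp] [pv res]; have [c cE] := frame_coefficients pv.
  have tp : moving_frame c p.1 = v.1.
    rewrite -(fam_mxK v.1); congr mx_fam; apply: functional_extensionality_dep => i.
    by apply/matrixP => l k; rewrite mxE -cE mxE.
  have dt (q : Rep * Rep') : differentiable (fun q : Rep * Rep' => moving_frame c q.1) q.
    exact: (differentiable_moving_frame c (differentiable_fst q)).
  exists (fun q : Rep * Rep' => (moving_frame c q.1, mx_fam (sink_residue q))); split.
  + rewrite tp (surjective_pairing v); congr pair.
    rewrite -(fam_mxK v.2); congr mx_fam; apply: functional_extensionality_dep => i.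
    by rewrite res /= residue_field_of_residues.
  + apply: filterE => q; apply: (differentiable_pair (dt q)).
    apply: differentiable_fam => i.
    pose b : arr S := star_vtx (len_gt0 Q i).
    exact: (diffmx_mul (diffmx_fam (differentiable_fst q) (a := b))
      (diffmx_fam (differentiable_snd q) (a := b))).
  have vu i : fam_mx (moving_frame c p.1) i \in unitmx by rewrite tp; have [h _] := pv; exact: h.
  have := near_unit_frames (dt p) vu; apply: filterS => q qu [Iq Zq]; split.
    exact: moving_frame_presents.
  by move=> i; rewrite /= mx_famK residue_field_of_residues.
Qed.
End HyperkahlerIdentification.

Theorem theorem5p1p9 (R : realType) (n r : nat) (Q : star_quiver n r)
    (alpha : vert (star Q) -> R) (halpha : flag_level alpha)
    (a : 'I_n -> P1 R) (ha : injective a) :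
  @identifies (Cplx R)
    (kahler_quotient (@star_dim n r Q) alpha)
    (parabolic_moduli alpha)
    (@parabolic_of_rep R n r Q) /\
  @identifies (Cplx R)
    (hyperkahler_quotient (@star_dim n r Q) alpha)
    (higgs_moduli alpha a)
    (@higgs_of_rep R n r Q a).
Proof.
by split; [exact: kahler_identification|exact: hyperkahler_identification].
Qed.
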